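(* Let $n\ge 1$ and $r\ge 1$ be integers with $\gcd(r,n)=1$. Let $\mathcal{F}=p(\omega_n^{-1})\frac{dz}{z}$ be a rank $n$ maximally ramified formal type of slope $r/n$ with $p(0)=0$; that is, $p\in\mathbb{C}[x]$ is a polynomial of degree $r$ with zero constant term. Let $\mathscr{O}\subset\mathfrak{gl}_n(\mathbb{C})$ be any nilpotent adjoint orbit with at most $r$ Jordan blocks. Then there exists a rigid framable Coxeter connection with formal type $\mathcal{F}$ at $0$ and unipotent monodromy at $\infty$ determined by $\mathscr{O}$ if and only if $\mathscr{O}=\mathscr{O}^r_{x^n}$ and $r$ divides $n+1$ or $n-1$.
   Context: **Matrices and filtration.** Let $F=\mathbb{C}((z))$, $\mathfrak{o}=\mathbb{C}[[z]]$. Let $\omega_n=\sum_{i=1}^{n-1}e_{i,i+1}+z\,e_{n,1}\in \mathrm{GL}_n(F)$ (with $\omega_1=z$), so $\omega_n^n=z\cdot I$. Let $\mathfrak{i}\subset\mathfrak{gl}_n(\mathfrak{o})$ be the standard Iwahori subalgebra, consisting of the matrices over $\mathfrak{o}$ that are upper triangular modulo $z$. For $s\in\mathbb{Z}$ set $\mathfrak{i}^s=\omega_n^s\,\mathfrak{i}=\mathfrak{i}\,\omega_n^s$, and let $I^1=1+\mathfrak{i}^1\subset \mathrm{GL}_n(\mathfrak{o})$. **Connections.** All connections are on trivializable rank $n$ vector bundles over $\mathbb{P}^1$ (over $\mathbb{C}$). In a global trivialization $\phi$ such a meromorphic connection is $\nabla=d+[\nabla]_\phi$, where $[\nabla]_\phi$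 is a matrix of meromorphic one-forms. Changing the trivialization by $g\in\mathrm{GL}_n(\mathbb{C})$ gives $[\nabla]_{g\phi}=g[\nabla]_\phi g^{-1}$. **Framable Coxeter connection with formal type $\mathcal{F}$ at $0$ and unipotent monodromy at $\infty$ determined by $\mathscr{O}$.** This means a meromorphic connection $\nabla$ on $\mathbb{P}^1$ with the following properties. 1. $\nabla$ has no singularities on $\mathbb{G}_m=\mathbb{P}^1\setminus\{0,\infty\}$. 2. $\nabla$ is framable at $0$ with respect to $\mathcal{F}$. That is, for a global trivialization $\phi$ there is $g\in\mathrm{GL}_n(\mathbb{C})$ such that, after expanding at $0$: (a) $[\nabla]_{g\phi}\in\mathfrak{i}^{-r}\frac{dz}{z}$ and $[\nabla]_{g\phi}-\mathcal{F}\in\mathfrak{i}^{1-r}\frac{dz}{z}$; (b) there is $h\in I^1$ with $h[\nabla]_{g\phi}h^{-1}-\mathcal{F}\in\mathfrak{i}^{1}\frac{dz}{z}$. Equivalently, $\mathrm{Ad}^*(h)([\nabla]_{g\phi})$ and $\mathcal{F}$ define the same functional $X\mapsto\mathrm{Res}\,\mathrm{Tr}(X\,\cdot\,)$ on $\mathfrak{i}$. 3. At $\infty$, in a global trivialization, the matrix of $\nabla$ has at most a simple pole in the coordinate $w=z^{-1}$, and its residue (the coefficient of $\frac{dw}{w}$) lies in $\mathscr{O}$. For $Y\in\mathscr{O}$ the monodromy at $\infty$ is then conjugate to the unipotent matrix $\exp(-2\pi i Y)$. If $\mathscr{O}=\{0\}$, then $\nabla$ is regular at $\infty$. **Rigidity.**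 Let $j:\mathbb{G}_m\hookrightarrow\mathbb{P}^1$ be the inclusion. The connection $\nabla$ is called (cohomologically) rigid if $H^1(\mathbb{P}^1,j_{!*}\mathrm{ad}_\nabla)=0$. Here $\mathrm{ad}_\nabla$ is the connection induced by $\nabla|_{\mathbb{G}_m}$ on the adjoint (endomorphism) bundle, $j_{!*}$ is the intermediate extension, and the cohomology is de Rham cohomology, normalized so that $H^1(\mathbb{P}^1,j_{!*}\mathrm{ad}_\nabla)$ is the image of $H^1_{\mathrm{dR},c}(\mathbb{G}_m,\mathrm{ad}_\nabla)\to H^1_{\mathrm{dR}}(\mathbb{G}_m,\mathrm{ad}_\nabla)$. **The orbit $\mathscr{O}^r_{x^n}$.** Write $n=kr+r'$ with $k,r'\in\mathbb{Z}$ and $0\le r'<r$. Then $\mathscr{O}^r_{x^n}$ is the nilpotent adjoint orbit in $\mathfrak{gl}_n(\mathbb{C})$ having $r'$ Jordan blocks of size $k+1$ and $r-r'$ Jordan blocks of size $k$ (blocks of size $0$ are ignored). It is the unique smallest nilpotent orbit, with respect to the closure order, having at most $r$ Jordan blocks. It is $\{0\}$ if $r\ge n$. *)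

(* Defs.v *)
From HB Require Import structures.
From mathcomp Require Import all_boot all_order all_algebra.
From mathcomp Require Import ring.
From mathcomp Require Import boolp classical_sets.

Set Implicit Arguments.
Unset Strict Implicit.
Unset Printing Implicit Defensive.

Import GRing.Theory.
Local Open Scope ring_scope.

(** * Formal power series *)

(* A wrapper, so as not to inherit the pointwise ring structure of functions. *)
Record pseries (C : Type) := PSeries { pscoef : nat -> C }.

Section PowerSeriesRing.
Variable C : idomainType.
Implicit Types f g h : pseries C.

Lemma pseriesP f g : (forall k, pscoef f k = pscoef g k) -> f = g.
Proof. by case: f g => f [g] /= fg; congr PSeries; apply/funext. Qed.

HB.instance Definition _ := gen_eqMixin (pseries C).
HB.instance Definition _ := gen_choiceMixin (pseries C).

Definition psconst (c : C) : pseries C :=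
  PSeries (fun k => if k is 0%N then c else 0).
Definition psvar : pseries C := PSeries (fun k => (k == 1%N)%:R).
Definition psadd f g := PSeries (fun k => pscoef f k + pscoef g k).
Definition psopp f := PSeries (fun k => - pscoef f k).
Definition psmul f g :=
  PSeries (fun k => \sum_(i < k.+1) pscoef f i * pscoef g (k - i)).

Lemma psaddA : associative psadd.
Proof. by move=> f g h; apply: pseriesP => k /=; rewrite addrA. Qed.
Lemma psaddC : commutative psadd.
Proof. by move=> f g; apply: pseriesP => k /=; rewrite addrC. Qed.
Lemma psadd0 : left_id (psconst 0) psadd.
Proof. by move=> f; apply: pseriesP => -[|k] /=; rewrite add0r. Qed.
Lemma psaddN : left_inverse (psconst 0) psopp psadd.
Proof. by move=> f; apply: pseriesP => -[|k] /=; rewrite addNr. Qed.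

HB.instance Definition _ :=
  GRing.isZmodule.Build (pseries C) psaddA psaddC psadd0 psaddN.

Definition pstrunc N f : {poly C} := \poly_(i < N) pscoef f i.

Lemma coef_pstrunc N f i : (i < N)%N -> (pstrunc N f)`_i = pscoef f i.
Proof. by move=> iN; rewrite coef_poly iN. Qed.

Lemma psmul_trunc N f g k : (k < N)%N ->
  pscoef (psmul f g) k = (pstrunc N f * pstrunc N g)`_k.
Proof.
move=> kN; rewrite coefM /=; apply: eq_bigr => i _.
have iN : (i < N)%N by apply: leq_ltn_trans kN; rewrite -ltnS.
by rewrite !coef_pstrunc // (leq_ltn_trans (leq_subr _ _) kN).
Qed.

Lemma psmulC : commutative psmul.
Proof.
by move=> f g; apply: pseriesP => k; rewrite !(@psmul_trunc k.+1) // mulrC.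
Qed.

Lemma psmulA : associative psmul.
Proof.
move=> f g h; apply: pseriesP => k; set N := k.+1.
transitivity ((pstrunc N f * (pstrunc N g * pstrunc N h))`_k).
  rewrite coefM; apply: eq_bigr => i _.
  by rewrite -psmul_trunc ?ltnS ?leq_subr // coef_pstrunc.
rewrite mulrA coefM; apply: eq_bigr => i _.
by rewrite -psmul_trunc // coef_pstrunc // ltnS leq_subr.
Qed.

Lemma psmul1 : left_id (psconst 1) psmul.
Proof.
move=> f; apply: pseriesP => k /=.
rewrite big_ord_recl /= mul1r subn0 big1 ?addr0 // => i _.
by rewrite mul0r.
Qed.

Lemma psmulDl : left_distributive psmul psadd.
Proof.
move=> f g h; apply: pseriesP => k /=.
by rewrite -big_split /=; apply: eq_bigr => i _; rewrite mulrDl.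
Qed.

Lemma psone_neq0 : psconst 1 != psconst 0.
Proof. by apply/eqP => -[] /(congr1 (@^~ 0%N))/eqP; rewrite oner_eq0. Qed.

HB.instance Definition _ := GRing.Zmodule_isComNzRing.Build (pseries C)
  psmulA psmulC psmul1 psmulDl psone_neq0.

Definition psunit f := `[< exists g, g * f = 1 >].
Definition psinv f :=
  if pselect (exists g, g * f = 1) is left e then projT1 (cid e) else f.

Lemma psmulV : {in psunit, left_inverse 1 psinv *%R}.
Proof.
move=> f; rewrite unfold_in => /asboolP e; rewrite /psinv.
by case: pselect => // e'; case: cid.
Qed.
Lemma psunitP f g : g * f = 1 -> psunit f.
Proof. by move=> gf; apply/asboolP; exists g. Qed.
Lemma psinv_out : {in [predC psunit], psinv =1 id}.
Proof.
move=> f; rewrite inE /= unfold_in => /asboolPn nf; rewrite /psinv.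
by case: pselect.
Qed.

HB.instance Definition _ := GRing.ComNzRing_hasMulInverse.Build (pseries C)
  psmulV psunitP psinv_out.

Lemma psval f : f != 0 ->
  exists m, pscoef f m != 0 /\ forall k, (k < m)%N -> pscoef f k = 0.
Proof.
move=> f0; have ex : exists m, pscoef f m != 0.
  apply: contrapT => nex; case/eqP: f0; apply: pseriesP => k.
  have -> : pscoef (0 : pseries C) k = 0 by case: k.
  by apply/eqP/negP => fk; apply: nex; exists k; apply/negP.
case: (ex_minnP ex) => m fm mmin; exists m; split=> // k km.
by apply/eqP; apply: contraTT km => /mmin; rewrite -leqNgt.
Qed.

Lemma psmul_eq0 f g : f * g = 0 -> (f == 0) || (g == 0).
Proof.
move=> fg; apply: contrapT => /negP; rewrite negb_or => /andP[].
move=> /psval[a [fa fmin]] /psval[b [gb gmin]].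
have /eqP[] : pscoef (f * g) (a + b)%N != 0.
  rewrite /= (bigD1 (Ordinal (leq_addr b a : (a < (a + b).+1)%N))) //=.
  rewrite addKn big1 ?addr0 ?mulf_neq0 // => i ia.
  have [lt_ia|lt_ai|/eqP eq_ia] := ltngtP i a.
  - by rewrite fmin ?mul0r.
  - rewrite gmin ?mulr0 // ltn_subLR; last by rewrite -ltnS.
    by rewrite ltn_add2r.
  - by case/negP: ia; rewrite -val_eqE.
by rewrite fg; case: (a + b)%N.
Qed.

HB.instance Definition _ :=
  GRing.ComUnitRing_isIntegral.Build (pseries C) psmul_eq0.

Lemma psconst_zmod : zmod_morphism psconst.
Proof. by move=> a b; apply: pseriesP => -[|k] //=; rewrite subr0. Qed.
Lemma psconst_monoid : monoid_morphism psconst.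
Proof.
split=> // a b; apply: pseriesP => -[|k] /=; first by rewrite big_ord1.
by rewrite big_ord_recl mulr0 big1 ?addr0 // => i _; rewrite mul0r.
Qed.
HB.instance Definition _ :=
  GRing.isZmodMorphism.Build C (pseries C) psconst psconst_zmod.
HB.instance Definition _ :=
  GRing.isMonoidMorphism.Build C (pseries C) psconst psconst_monoid.

(* The Euler derivation t d/dt. *)
Definition pseuler f : pseries C := PSeries (fun k => pscoef f k *+ k).

End PowerSeriesRing.

(** * Functions and derivations on fraction fields *)

Section Fractions.
Variable A : idomainType.
Local Notation "x %:F" := (@FracField.tofrac A x) (at level 1).

Lemma fracE (x : {fraction A}) :
  x = (\n_(repr x))%:F / (\d_(repr x))%:F.
Proof.
have d0 : \d_(repr x) != 0 by exact: denom_ratioP.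
apply: (canRL (mulfK _)); first by rewrite tofrac_eq0.
move: (repr x) (reprK x) d0 => y <- d0.
rewrite /FracField.tofrac; unlock.
rewrite -[LHS]FracField.pi_mul; apply/eqmodP; rewrite /= FracField.equivfE.
by rewrite !numden_Ratio ?oner_neq0 ?mulf_neq0 ?oner_neq0 // !mulr1 mulrC.
Qed.

Variables (K : fieldType) (f : A -> K).

(* The extension to {fraction A} of an injective ring morphism f : A -> K. *)
Definition frac_lift (x : {fraction A}) : K :=
  f \n_(repr x) / f \d_(repr x).

(* The extension to {fraction A} of a derivation of A. *)
Definition frac_der (delta : A -> A) (x : {fraction A}) : {fraction A} :=
  let n := \n_(repr x) in let d := \d_(repr x) in
  (delta n * d - n * delta d)%:F / (d ^+ 2)%:F.

Lemma frac_cross a b : b != 0 ->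
  let x := a%:F / b%:F in \n_(repr x) * b = a * \d_(repr x).
Proof.
move=> b0 x; apply/eqP; rewrite -tofrac_eq !tofracM.
by rewrite -eqr_div ?tofrac_eq0 ?denom_ratioP // -fracE.
Qed.

End Fractions.

(* Both extensions do not depend on the representative of the fraction. *)
Lemma frac_liftE (A : idomainType) (K : fieldType) (f : {rmorphism A -> K})
    (a b : A) : injective f -> b != 0 ->
  frac_lift f (FracField.tofrac a / FracField.tofrac b) = f a / f b.
Proof.
move=> finj b0; rewrite /frac_lift.
have fneq0 c : c != 0 -> f c != 0 by rewrite -(rmorph0 f) (inj_eq finj).
apply/eqP; rewrite eqr_div ?fneq0 ?denom_ratioP //.
by rewrite -!rmorphM (inj_eq finj); apply/eqP/frac_cross.
Qed.

Lemma frac_derE (A : idomainType) (delta : A -> A) (a b : A) :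
    zmod_morphism delta ->
    (forall x y, delta (x * y) = delta x * y + x * delta y) -> b != 0 ->
  frac_der delta (FracField.tofrac a / FracField.tofrac b) =
  FracField.tofrac (delta a * b - a * delta b) / FracField.tofrac (b ^+ 2).
Proof.
move=> dB dM b0; rewrite /frac_der; have := @frac_cross A a b b0 => /=.
move: (denom_ratioP (repr (FracField.tofrac a / FracField.tofrac b))).
move: (\n_ _) (\d_ _) => n d d0 nb; have /eqP := congr1 delta nb.
rewrite !dM => dnb; apply/eqP; rewrite eqr_div ?tofrac_eq0 ?expf_neq0 //.
rewrite -!tofracM tofrac_eq -subr_eq0.
have -> : (delta n * d - n * delta d) * b ^+ 2 -
          (delta a * b - a * delta b) * d ^+ 2 =
  b * d * (delta n * b + n * delta b - (delta a * d + a * delta d))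
  - (b * delta d + d * delta b) * (n * b - a * d) by ring.
by rewrite (eqP dnb) nb !subrr !mulr0 subrr.
Qed.

(** * Expansions at 0 and infinity of rational functions *)

Local Open Scope classical_set_scope.

Section Expansions.
Variable C : fieldType.

(* C(z), and C((t)) as the fraction field of C[[t]]. *)
Local Notation ratfun := {fraction {poly C}}.
Local Notation laurent := {fraction (pseries C)}.

Definition rconst (c : C) : ratfun := FracField.tofrac c%:P.
Definition lconst (c : C) : laurent := FracField.tofrac (psconst c).
Definition lvar : laurent := FracField.tofrac (psvar C).

(* The embedding of C(z) in C((t)) over C sending z to a transcendental x. *)
Definition expand (x : laurent) : ratfun -> laurent :=
  frac_lift (fun q : {poly C} => (map_poly lconst q).[x]).

(* At 0 the coordinate t is z, at infinity it is w = z^-1. *)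
Definition expand0 : ratfun -> laurent := expand lvar.
Definition expandoo : ratfun -> laurent := expand lvar^-1.

(* The derivation z d/dz on C(z), then on C((z)), and on C((w)), where
   z d/dz = - w d/dw. *)
Definition euler : ratfun -> ratfun :=
  frac_der (fun q : {poly C} => 'X * q^`()).
Definition euler0 : laurent -> laurent := frac_der (@pseuler C).
Definition euleroo (f : laurent) : laurent := - euler0 f.

Definition regular_at (a : C) (f : ratfun) : Prop :=
  exists p q : {poly C}, q.[a] != 0 /\
    f = FracField.tofrac p / FracField.tofrac q.

Definition regular_on_Gm (f : ratfun) : Prop :=
  forall a : C, a != 0 -> regular_at a f.

End Expansions.

(** * The Iwahori filtration and formal types *)

Section Iwahori.
Variables (C : fieldType) (n : nat).
Local Notation laurent := {fraction (pseries C)}.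

Definition omega : 'M[laurent]_n :=
  \matrix_(i, j) ((j == i.+1 :> nat)%:R +
                  ((i == n.-1 :> nat) && (j == 0%N :> nat))%:R * lvar C).

Definition omega_exp (s : int) : 'M[laurent]_n :=
  match s with
  | Posz k => omega ^+ k
  | Negz k => invmx omega ^+ k.+1
  end.

Definition iwahori : set 'M[laurent]_n :=
  [set X | exists Y : 'M[pseries C]_n,
     X = map_mx (@FracField.tofrac (pseries C)) Y /\
     forall i j : 'I_n, (j < i)%N -> pscoef (Y i j) 0 = 0].

Definition iwahori_filt (s : int) : set 'M[laurent]_n :=
  [set omega_exp s *m X | X in iwahori].

(* The group I^1. *)
Definition iwahori_unip : set 'M[laurent]_n :=
  [set h | iwahori_filt 1 (h - 1%:M)].

(* The coefficient of dz/z in p(omega^-1) dz/z. *)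
Definition formal_type (p : {poly C}) : 'M[laurent]_n :=
  \sum_(i < size p) lconst p`_i *: invmx omega ^+ i.

End Iwahori.

(** * Nilpotent orbits *)

Section NilpotentOrbits.
Variables (C : fieldType) (n : nat).

Definition adjoint_orbit (N : 'M[C]_n) : set 'M[C]_n :=
  [set g *m N *m invmx g | g in [set g : 'M[C]_n | g \in unitmx]].

Definition is_nilpotent_orbit (O : set 'M[C]_n) : Prop :=
  exists N : 'M[C]_n, (exists k : nat, N ^+ k = 0) /\ O = adjoint_orbit N.

(* The nilpotent Jordan matrix with successive block sizes s. *)
Definition jordan_nilp (s : seq nat) : 'M[C]_n :=
  \matrix_(i, j) ((j == i.+1 :> nat) &&
                  (reshape_index s i == reshape_index s j))%:R.

Definition has_jordan_type (s : seq nat) (O : set 'M[C]_n) : Prop :=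
  [/\ all (leq 1) s, sumn s = n & O = adjoint_orbit (jordan_nilp s)].

Definition at_most_jordan_blocks (r : nat) (O : set 'M[C]_n) : Prop :=
  exists2 s : seq nat, has_jordan_type s O & (size s <= r)%N.

(* The orbit O^r_{x^n}; blocks of size 0 are dropped. *)
Definition min_orbit (r : nat) : set 'M[C]_n :=
  adjoint_orbit (jordan_nilp
    [seq b <- nseq (n %% r) (n %/ r).+1 ++ nseq (r - n %% r) (n %/ r)
     | 0 < b]%N).

End NilpotentOrbits.

Arguments min_orbit C n r : clear implicits.

(** * Connections on the trivial bundle of rank n *)

(* A connection, in a global trivialization, is d + A dz/z, and is represented
   by the matrix A over C(z). *)
Section Connections.
Variables (C : fieldType) (n : nat).
Local Notation ratfun := {fraction {poly C}}.
Local Notation laurent := {fraction (pseries C)}.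
Implicit Type A : 'M[ratfun]_n.

Definition regular_mx_on_Gm (X : 'M[ratfun]_n) : Prop :=
  forall i j, regular_on_Gm (X i j).

Definition change_triv (g : 'M[C]_n) A : 'M[ratfun]_n :=
  map_mx (@rconst C) g *m A *m map_mx (@rconst C) (invmx g).

Definition framable_at0 (r : nat) (Ft : 'M[laurent]_n) A : Prop :=
  exists2 g : 'M[C]_n, g \in unitmx &
    let B := map_mx (@expand0 C) (change_triv g A) in
    [/\ iwahori_filt (- r%:Z) B,
        iwahori_filt (1 - r%:Z) (B - Ft) &
        exists2 h : 'M[laurent]_n, iwahori_unip h &
          iwahori_filt 1 (h *m B *m invmx h - Ft)].

(* As A dz/z = - A dw/w, the matrix Y holds the coefficients of dw/w. *)
Definition residue_oo_in (O : set 'M[C]_n) A : Prop :=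
  exists2 Y : 'M[pseries C]_n,
    - map_mx (@expandoo C) A = map_mx (@FracField.tofrac (pseries C)) Y &
    O (map_mx (fun f => pscoef f 0) Y).

Definition framable_coxeter (r : nat) (Ft : 'M[laurent]_n)
    (O : set 'M[C]_n) A : Prop :=
  [/\ regular_mx_on_Gm A, framable_at0 r Ft A & residue_oo_in O A].

(* The coefficient of dz/z in ad_nabla (X), for sections X over a ring K of
   functions with derivation delta = z d/dz. *)
Definition ad_conn (K : pzRingType) (delta : K -> K) (A X : 'M[K]_n) : 'M[K]_n :=
  map_mx delta X + (A *m X - X *m A).

(* H^1_dR(Gm, ad) is the quotient of the matrices W (standing for W dz/z) that
   are regular on Gm by those of the following form. *)
Definition dR_coboundary A (W : 'M[ratfun]_n) : Prop :=
  exists2 X : 'M[ratfun]_n, regular_mx_on_Gm X & W = ad_conn (@euler C) A X.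

(* H^1_dR,c(Gm, ad) is the H^1 of the shifted cone of the restriction of the de
   Rham complex of Gm to those of the punctured formal discs at 0 and infinity.
   A cocycle is a form on Gm with a primitive on each punctured disc, and its
   image in H^1_dR(Gm, ad) is the class of this form. *)
Definition dRc_cocycle A (W : 'M[ratfun]_n) (X0 Xoo : 'M[laurent]_n) : Prop :=
  [/\ regular_mx_on_Gm W,
      ad_conn (@euler0 C) (map_mx (@expand0 C) A) X0
        = map_mx (@expand0 C) W &
      ad_conn (@euleroo C) (map_mx (@expandoo C) A) Xoo
        = map_mx (@expandoo C) W].

(* The image of H^1_dR,c(Gm, ad) in H^1_dR(Gm, ad) vanishes. *)
Definition rigid A : Prop :=
  forall W X0 Xoo, dRc_cocycle A W X0 Xoo -> dR_coboundary A W.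

End Connections.

(* Main.v *)
From HB Require Import structures.
Require Import Defs.
From mathcomp Require Import all_boot all_order all_algebra.
From mathcomp Require Import ring zify.
From mathcomp Require Import boolp classical_sets reals.
From mathcomp Require Import complex.

(* After a constant change of trivialization, d + A dz/z has A in Mat(C[1/z]) with
   A(oo) = -Y, Y in O, and A = p_r omega^-r + lower order terms at 0; put
   D = z d/dz + [A, -]. At 0, D lowers the Iwahori degree by r, and acts on leading
   terms as the commutator with p_r omega^-r, whose kernel is spanned by the powers
   of omega; the framing gauge h provides elements h^-1 omega^d h on which D acts by
   d/n to leading order. Hence on the punctured disc at 0 the kernel of D consists of
   the scalars and the only obstruction to exactness is the residue of the trace. At
   infinity D is invertible in degrees k <> 0, since k + ad Y is, and exactness of a
   holomorphic form means that its value lies in the image of ad Y. Counting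
   dimensions of polynomial spaces of bounded degree in 1/z, the image of
   H^1_c in H^1 has dimension r n - r + 1 - dim Z(Y).

   If O has block sizes s_1, ..., s_r (padded by zeros) then
   dim Z(Y) = sum_(a, b) min(s_a, s_b) = r n - sum_(a < b) |s_a - s_b|, so rigidity
   means sum_(a < b) |s_a - s_b| <= r - 1. If the s_a are not all equal, which
   gcd(r, n) = 1 excludes for r > 1, the sum is at least r - 1, with equality exactly
   when all but one of the s_a agree and the exceptional one differs by 1.

   Conversely p_r omega^-r has value p_r S^r at infinity, S the shift, and -p_r S^r lies
   in the minimal orbit. Adding monomials in the first row, one for each degree
   between -r and 0, does not change this value and corrects the formal type degree
   by degree; in degree 0 the trace does not leave anything to correct. *)
Set Implicit Arguments.
Unset Strict Implicit.
Unset Printing Implicit Defensive.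

Import Order.TTheory GRing.Theory Num.Theory.
Local Open Scope ring_scope.

(** * Laurent series *)

(** How the dimension count closes up. For q >= r let L be the polynomials in 1/z of degree at most
    q whose Iwahori degree at 0 is at least -qn, T the part of L that D maps into L, and S the forms
    in L exact on both punctured discs. In each of the r lowest degrees, membership in T leaves only
    the multiple of h^-1 omega^d h free, so dim T = dim L - rn + r. The kernel of D on T is the
    scalars, and S has codimension dim Z(Y) in L; hence S / D(T) has dimension rn - r + 1 - dim
    Z(Y), whatever q is. As D(T) always lies in S, rigidity becomes one numerical inequality. The
    obstacle is to stay inside such finite-dimensional spaces. A global primitive of an element of L
    has no worse poles than that element: at 0, a leading term a h^-1 omega^s h with s < 0 leaves
    the trace a s in degree s, and at infinity k + ad Y is injective for k <> 0. Conversely a class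
    exact at infinity can be made holomorphic there, and then lies in L once q is large. *)

Section LaurentCoef.
Variable C : fieldType.
Local Notation laurent := {fraction (pseries C)}.
Local Notation "f %:F" := (@FracField.tofrac (pseries C) f) (at level 1).
Implicit Types (f g : pseries C) (x y : laurent) (k : int).

(** The first m coefficients of 1/f, kept as a list because each one depends on all the earlier
    ones. *)
Fixpoint psinv_seq f (m : nat) : seq C :=
  if m is m'.+1 then
    let s := psinv_seq f m' in
    rcons s (((m' == 0%N)%:R - \sum_(i < m') s`_i * pscoef f (m' - i)%N)
              / pscoef f 0)
  else [::].

Lemma size_psinv_seq f m : size (psinv_seq f m) = m.
Proof. by elim: m => //= m IH; rewrite size_rcons IH. Qed.

Lemma nth_psinv_seq f m i : (i < m)%N ->
  (psinv_seq f m)`_i = (psinv_seq f i.+1)`_i.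
Proof.
elim: m => // m IH; rewrite ltnS leq_eqVlt => /orP[/eqP -> //|im].
by rewrite [psinv_seq f m.+1]/= nth_rcons size_psinv_seq im IH.
Qed.

Lemma psinv_ex f : pscoef f 0 != 0 -> exists g, g * f = 1.
Proof.
move=> f0; exists (PSeries (fun m => (psinv_seq f m.+1)`_m)).
apply: pseriesP => k; rewrite /= big_ord_recr /= subnn nth_rcons.
rewrite size_psinv_seq ltnn eqxx divfK //.
under eq_bigr => i _ do rewrite -[rcons _ _]/(psinv_seq f i.+1).
under [X in _ + (_ - X)]eq_bigr => i _ do rewrite nth_psinv_seq //.
by rewrite addrC subrK; case: k.
Qed.

Definition zcoef f k : C := if k is Posz m then pscoef f m else 0.

Lemma zcoefD f g k : zcoef (f + g) k = zcoef f k + zcoef g k.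
Proof. by case: k => //= m; rewrite addr0. Qed.

Lemma pscoefM f g (k : nat) :
  pscoef (f * g) k = \sum_(i < k.+1) pscoef f i * pscoef g (k - i)%N.
Proof. by []. Qed.

Lemma pscoef_varX f m (k : nat) :
  pscoef (psvar C ^+ m * f) k = if (m <= k)%N then pscoef f (k - m)%N else 0.
Proof.
elim: m k => [|m IH] k; first by rewrite expr0 mul1r subn0.
rewrite exprS -mulrA pscoefM; case: k => [|k].
  by rewrite big_ord1 mul0r.
rewrite big_ord_recl mul0r add0r big_ord_recl mul1r big1 ?addr0.
  by rewrite lift0 subSS subn0 IH subSS.
by move=> i _; rewrite mul0r.
Qed.

Lemma zcoef_varX f m k : zcoef (psvar C ^+ m * f) k = zcoef f (k - m%:Z).
Proof.
case: k => k; last by have -> : Negz k - m%:Z = Negz (k + m) by lia.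
rewrite [LHS]/zcoef pscoef_varX; case: leqP => km.
  by have -> : k%:Z - m%:Z = (k - m)%N by lia.
by have -> : k%:Z - m%:Z = Negz (m - k).-1 by lia.
Qed.

Lemma psvar_neq0 : psvar C != 0.
Proof. by apply/eqP => -[] /(congr1 (@^~ 1%N))/eqP; rewrite oner_eq0. Qed.

Lemma lvar_neq0 : lvar C != 0.
Proof. by rewrite tofrac_eq0 psvar_neq0. Qed.

(** A nonzero power series is a power of the variable times a unit, so powers of the variable
    suffice as denominators. *)
Lemma laurent_ex x : exists Nf : nat * pseries C,
  x = Nf.2%:F / lvar C ^+ Nf.1.
Proof.
rewrite [x]fracE; move: (\n_ _) (\d_ _) (denom_ratioP (repr x)) => a b.
move=> /psval[m [bm bmin]]; pose b' : pseries C := PSeries (fun i => pscoef b (i + m)%N).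
have Eb : b = psvar C ^+ m * b'.
  apply: pseriesP => k; rewrite pscoef_varX; case: leqP => [mk|/bmin //].
  by rewrite /= subnK.
have [c cb] : exists c, c * b' = 1 by apply: psinv_ex; rewrite /= add0n.
exists (m, a * c); rewrite Eb /= /lvar -tofracXn; apply/eqP.
have b'0 : b' != 0 by apply: contraPneq cb => ->; rewrite mulr0 => /esym/eqP; rewrite oner_eq0.
have v0 := expf_neq0 m psvar_neq0.
rewrite eqr_div ?tofrac_eq0 ?mulf_neq0 //.
rewrite -!tofracM tofrac_eq; apply/eqP.
by rewrite -[LHS]mulr1 -cb; ring.
Qed.

(* Locked: unifying Laurent series up to unfolding is prohibitively slow. *)
Definition lc : laurent -> int -> C := locked (fun x k =>
  let Nf := projT1 (cid (laurent_ex x)) in zcoef Nf.2 (k + Nf.1%:Z)).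

Lemma lcE N f k : lc (f%:F / lvar C ^+ N) k = zcoef f (k + N%:Z).
Proof.
rewrite /lc -lock; case: cid => -[M g] /= /eqP.
have v0 m := expf_neq0 m psvar_neq0.
rewrite /lvar -!tofracXn eqr_div ?tofrac_eq0 // -!tofracM tofrac_eq => /eqP fg.
have := congr1 (zcoef^~ (k + N%:Z + M%:Z)) fg.
rewrite ![_ * psvar C ^+ _]mulrC !zcoef_varX addrK => ->; congr zcoef; lia.
Qed.

Lemma lc_tofrac f k : lc f%:F k = zcoef f k.
Proof. by rewrite -[f%:F]divr1 -(expr0 (lvar C)) lcE addr0. Qed.

Lemma lcD x y k : lc (x + y) k = lc x k + lc y k.
Proof.
have [[N f] /= ->] := laurent_ex x; have [[M g] /= ->] := laurent_ex y.
rewrite [in RHS](lcE N f) [in RHS](lcE M g) addf_div ?expf_neq0 ?lvar_neq0 // -exprD.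
rewrite /lvar -!tofracXn -!tofracM -tofracD tofracXn lcE zcoefD.
by rewrite ![_ * psvar C ^+ _]mulrC !zcoef_varX; congr (zcoef _ _ + zcoef _ _); lia.
Qed.

Lemma lcXz x (m : int) k : lc (lvar C ^ m * x) k = lc x (k - m).
Proof.
have lcX (N : nat) y l : lc (y / lvar C ^+ N) l = lc y (l + N%:Z).
  have [[M f] /= ->] := laurent_ex y.
  by rewrite -mulrA -invfM -exprD !lcE; congr zcoef; lia.
case: m => m.
  rewrite -[X in _ = lc X _](mulfK (expf_neq0 m lvar_neq0)) lcX subrK.
  by rewrite -exprnP mulrC.
by rewrite NegzE -exprnN mulrC lcX opprK.
Qed.

Lemma lcZ c x k : lc (lconst c * x) k = c * lc x k.
Proof.
have [[N f] /= ->] := laurent_ex x.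
rewrite mulrA -tofracM !lcE; case: (k + N%:Z) => m /=; last by rewrite mulr0.
by rewrite big_ord_recl /= subn0 big1 ?addr0 // => i _; rewrite mul0r.
Qed.

Lemma lc0 k : lc 0 k = 0.
Proof. by apply: (addIr (lc 0 k)); rewrite -lcD !add0r. Qed.

Lemma lcN x k : lc (- x) k = - lc x k.
Proof. by apply: (addIr (lc x k)); rewrite -lcD !addNr lc0. Qed.

Lemma lcB x y k : lc (x - y) k = lc x k - lc y k.
Proof. by rewrite lcD lcN. Qed.

Lemma lc_sum (I : Type) (s : seq I) (P : pred I) (F : I -> laurent) k :
  lc (\sum_(i <- s | P i) F i) k = \sum_(i <- s | P i) lc (F i) k.
Proof. by apply: (big_morph (lc^~ k)) => [x y|]; rewrite ?lcD ?lc0. Qed.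

Lemma lc1 k : lc 1 k = (k == 0)%:R.
Proof. by rewrite -tofrac1 lc_tofrac; case: k => [[]|]. Qed.

Lemma lc_lvarXz (m k : int) : lc (lvar C ^ m) k = (k == m)%:R.
Proof. by rewrite -[_ ^ m]mulr1 lcXz lc1 subr_eq0. Qed.

Lemma lc_const c k : lc (lconst c) k = c *+ (k == 0).
Proof. by rewrite -[lconst c]mulr1 lcZ lc1 mulr_natr. Qed.

Lemma lc_inj x y : (forall k, lc x k = lc y k) -> x = y.
Proof.
move=> xy; apply/eqP; rewrite -subr_eq0.
have {xy} : forall k, lc (x - y) k = 0 by move=> k; rewrite lcB xy subrr.
have [[N f] /= ->] := laurent_ex (x - y) => f0; suff -> : f = 0 by rewrite mul0r.
apply: pseriesP => m; have := f0 (m%:Z - N%:Z); rewrite lcE subrK /= => ->.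
by case: m.
Qed.

Lemma lc_bound x : exists N : nat, forall k, k < - N%:Z -> lc x k = 0.
Proof.
have [[N f] /= ->] := laurent_ex x; exists N => k kN; rewrite lcE.
by have -> : k + N = Negz (`|(k + N)%R|.-1)%N by lia.
Qed.

Lemma lc_tofracK x : (forall k, k < 0 -> lc x k = 0) ->
  x = (PSeries (fun m => lc x m%:Z))%:F.
Proof. by move=> x0; apply: lc_inj => -[m|m]; rewrite lc_tofrac //= x0. Qed.

Lemma lcM_lt0 x y k : (forall k, k < 0 -> lc x k = 0) ->
  (forall k, k < 0 -> lc y k = 0) -> k < 0 -> lc (x * y) k = 0.
Proof.
move=> /lc_tofracK -> /lc_tofracK -> k0; rewrite -tofracM lc_tofrac.
by case: k k0.
Qed.

Lemma lcM_0 x y : (forall k, k < 0 -> lc x k = 0) ->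
  (forall k, k < 0 -> lc y k = 0) -> lc (x * y) 0 = lc x 0 * lc y 0.
Proof.
move=> /lc_tofracK -> /lc_tofracK ->; rewrite -tofracM !lc_tofrac /=.
by rewrite big_ord1.
Qed.

Lemma laurent_of (s : int) (u : nat -> C) : exists x : laurent,
  forall k, lc x k = if k - s is Posz m then u m else 0.
Proof.
exists (lvar C ^ s * (PSeries u)%:F) => k.
by rewrite lcXz lc_tofrac.
Qed.

Lemma pseuler_zmod : zmod_morphism (@pseuler C).
Proof. by move=> f g; apply: pseriesP => k /=; rewrite mulrnDl mulNrn. Qed.

Lemma pseulerM f g : pseuler (f * g) = pseuler f * g + f * pseuler g.
Proof.
apply: pseriesP => k /=; rewrite -sumrMnl -big_split /=.
apply: eq_bigr => -[i /= ik] _.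
by rewrite mulrnAl mulrnAr -mulrnDr subnKC.
Qed.

(** With x = f / t^N the quotient rule gives ([pseuler f] - N f) / t^N, and the factor at index k +
    N is (k + N) - N. *)
Lemma lc_euler0 x k : lc (euler0 x) k = k%:~R * lc x k.
Proof.
have [[N f] /= ->] := laurent_ex x.
have psX m : pseuler (psvar C ^+ m) = m%:R * psvar C ^+ m.
  apply: pseriesP => l; have E h : pscoef (m%:R * h : pseries C) l = m%:R * pscoef h l.
    by rewrite !mulr_natl; elim: m => [|m IH]; [case: l | rewrite !mulrS /= IH].
  rewrite E /=; rewrite -[_ ^+ m]mulr1 pscoef_varX; case: leqP => lm; last by rewrite mul0rn mulr0.
  have [->|] := eqVneq l m; first by rewrite mulr_natl.
  move=> lm'; have -> : (l - m)%N = (l - m).-1.+1 by lia.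
  by rewrite /= mul0rn mulr0.
rewrite /euler0 /lvar -tofracXn frac_derE ?expf_neq0 ?psvar_neq0 //;
  [|exact: pseuler_zmod|exact: pseulerM].
rewrite psX.
have -> : pseuler f * psvar C ^+ N - f * (N%:R * psvar C ^+ N) =
  (pseuler f - N%:R * f) * psvar C ^+ N by ring.
rewrite expr2 !tofracM -mulf_div divff ?tofrac_eq0 ?expf_neq0 ?psvar_neq0 // mulr1.
rewrite tofracXn -/(lvar C) !lcE.
have -> : pseuler f - N%:R * f = pseuler f + (- N%:R) * f by ring.
rewrite zcoefD.
have -> : zcoef (- N%:R * f) (k + N%:Z) = - N%:R * zcoef f (k + N%:Z).
  rewrite mulNr mulr_natl mulNr mulr_natl; case: (k + N%:Z) => [m|m] /=.
    congr (- _); elim: N {psX} => [|N IH]; first by case: m.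
    by rewrite !mulrS /= IH.
  by rewrite mul0rn oppr0.
have -> : zcoef (pseuler f) (k + N%:Z) = (k + N%:Z)%:~R * zcoef f (k + N%:Z).
  by case: (k + N%:Z) => m /=; rewrite ?mulr0 // -pmulrn mulr_natl.
by rewrite rmorphD /=; ring.
Qed.

End LaurentCoef.

(** * Rational functions regular on the punctured line *)

Section FracLift.
Variables (A : idomainType) (K : fieldType) (f : {rmorphism A -> K}).
Hypothesis f_inj : injective f.

Let f_neq0 c : c != 0 -> f c != 0.
Proof. by rewrite -(rmorph0 f) (inj_eq f_inj). Qed.

Lemma fracP (x : {fraction A}) : exists ab : A * A,
  ab.2 != 0 /\ x = FracField.tofrac ab.1 / FracField.tofrac ab.2.
Proof.
by exists (\n_(repr x), \d_(repr x)); rewrite -fracE; split=> //; apply: denom_ratioP.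
Qed.

Lemma frac_lift_tofrac a : frac_lift f (FracField.tofrac a) = f a.
Proof.
by rewrite -[FracField.tofrac a]divr1 -tofrac1 frac_liftE ?oner_neq0 // rmorph1 divr1.
Qed.

Lemma frac_lift_zmod : zmod_morphism (frac_lift f).
Proof.
move=> x y; have [[a b] /= [b0 ->]] := fracP x; have [[c d] /= [d0 ->]] := fracP y.
rewrite -mulNr -tofracN addf_div ?tofrac_eq0 // -!tofracM -tofracD.
rewrite !frac_liftE ?mulf_neq0 // rmorphD !rmorphM rmorphN /=.
by rewrite -addf_div ?f_neq0 // mulNr.
Qed.

Lemma frac_lift_monoid : monoid_morphism (frac_lift f).
Proof.
split; first by rewrite -tofrac1 frac_lift_tofrac rmorph1.
move=> x y; have [[a b] /= [b0 ->]] := fracP x; have [[c d] /= [d0 ->]] := fracP y.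
rewrite mulf_div -!tofracM !frac_liftE ?mulf_neq0 // !rmorphM /=.
by rewrite mulf_div.
Qed.

End FracLift.

Section Expansion.
Variable C : fieldType.
Local Notation ratfun := {fraction {poly C}}.
Local Notation laurent := {fraction (pseries C)}.
Implicit Types (p : {poly C}) (f : ratfun) (k : int).

Lemma lconst_zmod : zmod_morphism (@lconst C).
Proof. by move=> a b; rewrite /lconst rmorphB tofracB. Qed.
Lemma lconst_monoid : monoid_morphism (@lconst C).
Proof.
by split=> [|a b]; rewrite /lconst ?rmorph1 ?tofrac1 // rmorphM tofracM.
Qed.
HB.instance Definition _ := GRing.isZmodMorphism.Build _ _ (@lconst C) lconst_zmod.
HB.instance Definition _ := GRing.isMonoidMorphism.Build _ _ (@lconst C) lconst_monoid.

Lemma rconst_zmod : zmod_morphism (@rconst C).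
Proof. by move=> a b; rewrite /rconst rmorphB tofracB. Qed.
Lemma rconst_monoid : monoid_morphism (@rconst C).
Proof.
by split=> [|a b]; rewrite /rconst ?rmorph1 ?tofrac1 // rmorphM tofracM.
Qed.
HB.instance Definition _ := GRing.isZmodMorphism.Build _ _ (@rconst C) rconst_zmod.
HB.instance Definition _ := GRing.isMonoidMorphism.Build _ _ (@rconst C) rconst_monoid.

Definition evl (x : laurent) : {poly C} -> laurent :=
  fun p => (map_poly (@lconst C) p).[x].

Lemma evl_zmod x : zmod_morphism (evl x).
Proof. by move=> p q; rewrite /evl rmorphB hornerD hornerN. Qed.
Lemma evl_monoid x : monoid_morphism (evl x).
Proof. by split=> [|p q]; rewrite /evl ?rmorph1 ?hornerC // rmorphM hornerM. Qed.
HB.instance Definition _ x := GRing.isZmodMorphism.Build _ _ (evl x) (evl_zmod x).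
HB.instance Definition _ x := GRing.isMonoidMorphism.Build _ _ (evl x) (evl_monoid x).

(** The exponents 1 and -1 serve the expansions at 0 and at infinity together; since e e = 1, the
    index m with m e = k is k e. *)
Lemma lc_evl p (e k : int) : (e == 1) || (e == -1) ->
  lc (evl (lvar C ^ e) p) k = if k * e is Posz m then p`_m else 0.
Proof.
move=> e1; rewrite /evl horner_coef lc_sum size_map_poly.
under eq_bigr => i _ do rewrite coef_map /= lcZ exprnP exprz_exp lc_lvarXz.
have kE (i : nat) : (k == e * i) = (k * e == i) by move: e1; lia.
under eq_bigr => i _ do rewrite kE.
case: (k * e) => [m|m]; last by rewrite big1 // => i _; rewrite mulr0.
case: (ltnP m (size p)) => ms.
  rewrite (bigD1 (Ordinal ms)) //= eqxx mulr1 big1 ?addr0 // => i im.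
  rewrite (_ : (_ == _) = false) ?mulr0 //.
  by apply/negbTE; move: im; rewrite -val_eqE /=; lia.
rewrite nth_default // big1 // => -[i /= ip] _.
rewrite (_ : (_ == _) = false) ?mulr0 //.
by apply/negbTE/eqP => -[mi]; move: ip; rewrite -mi ltnNge ms.
Qed.

Lemma evl_inj (e : int) : (e == 1) || (e == -1) -> injective (evl (lvar C ^ e)).
Proof.
move=> e1 p q pq; apply/polyP => m; have := congr1 (fun x => lc x (m%:Z * e)) pq.
by rewrite !lc_evl // -mulrA (_ : e * e = 1) ?mulr1 //; move: e1; lia.
Qed.

Lemma expand0E : @expand0 C = frac_lift (evl (lvar C ^ (1 : int))).
Proof. by rewrite expr1z. Qed.
Lemma expandooE : @expandoo C = frac_lift (evl (lvar C ^ (-1 : int))).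
Proof. by rewrite exprN1. Qed.

Lemma expand0_zmod : zmod_morphism (@expand0 C).
Proof. by rewrite expand0E; apply/frac_lift_zmod/evl_inj. Qed.
Lemma expand0_monoid : monoid_morphism (@expand0 C).
Proof. by rewrite expand0E; apply/frac_lift_monoid/evl_inj. Qed.
Lemma expandoo_zmod : zmod_morphism (@expandoo C).
Proof. by rewrite expandooE; apply/frac_lift_zmod/evl_inj. Qed.
Lemma expandoo_monoid : monoid_morphism (@expandoo C).
Proof. by rewrite expandooE; apply/frac_lift_monoid/evl_inj. Qed.
HB.instance Definition _ := GRing.isZmodMorphism.Build _ _ (@expand0 C) expand0_zmod.
HB.instance Definition _ := GRing.isMonoidMorphism.Build _ _ (@expand0 C) expand0_monoid.
HB.instance Definition _ := GRing.isZmodMorphism.Build _ _ (@expandoo C) expandoo_zmod.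
HB.instance Definition _ := GRing.isMonoidMorphism.Build _ _ (@expandoo C) expandoo_monoid.

Lemma expand0_const (c : C) : expand0 (rconst c) = lconst c.
Proof.
rewrite expand0E frac_lift_tofrac; last exact: evl_inj.
by rewrite /= /evl map_polyC hornerC.
Qed.
Lemma expandoo_const (c : C) : expandoo (rconst c) = lconst c.
Proof.
rewrite expandooE frac_lift_tofrac; last exact: evl_inj.
by rewrite /= /evl map_polyC hornerC.
Qed.

Definition rvar : ratfun := FracField.tofrac 'X.

Lemma rvar_neq0 : rvar != 0.
Proof. by rewrite tofrac_eq0 polyX_eq0. Qed.

Lemma expand0_var : expand0 rvar = lvar C.
Proof.
rewrite expand0E frac_lift_tofrac; last exact: evl_inj.
by rewrite /= /evl map_polyX hornerX expr1z.
Qed.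
Lemma expandoo_var : expandoo rvar = (lvar C)^-1.
Proof.
rewrite expandooE frac_lift_tofrac; last exact: evl_inj.
by rewrite /= /evl map_polyX hornerX exprN1.
Qed.

Lemma expand0_varXz k : expand0 (rvar ^ k) = lvar C ^ k.
Proof. by rewrite rmorphXz ?unitfE ?rvar_neq0 //= expand0_var. Qed.
(** Laurent polynomials; by [regularP] they exhaust the functions regular on the punctured line. *)
Definition lpol N p : ratfun := FracField.tofrac p / FracField.tofrac 'X^N.

Lemma lc_expand0 N p k :
  lc (expand0 (lpol N p)) k = if k + N%:Z is Posz m then p`_m else 0.
Proof.
rewrite rmorphM fmorphV /= tofracXn rmorphXn /= -/rvar expand0_var.
rewrite mulrC exprnN lcXz expand0E frac_lift_tofrac; last exact: evl_inj.
by rewrite lc_evl // mulr1 opprK.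
Qed.

Lemma lc_expandoo_lpol N p k :
  lc (expandoo (lpol N p)) k = lc (expand0 (lpol N p)) (- k).
Proof.
rewrite lc_expand0.
rewrite rmorphM fmorphV /= tofracXn rmorphXn /= -/rvar expandoo_var.
rewrite mulrC exprVn invrK exprnP lcXz expandooE frac_lift_tofrac; last exact: evl_inj.
by rewrite lc_evl // mulrN1 opprB addrC.
Qed.

Lemma expand0_inj : injective (@expand0 C).
Proof. exact: fmorph_inj. Qed.

Lemma euler_lpol N p : euler (lpol N p) = lpol N ('X * p^`() - N%:R *: p).
Proof.
rewrite /euler frac_derE ?expf_neq0 ?polyX_eq0 //; first last.
- by move=> a b; rewrite derivM; ring.
- by move=> a b; rewrite derivB mulrBr.
have -> : 'X * ('X^N)^`() = N%:R * 'X^N :> {poly C}.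
  rewrite derivXn; case: N => [|N]; first by rewrite !mulr0n mulr0 mul0r.
  by rewrite exprS /=; ring.
rewrite /lpol scaler_nat.
have -> : 'X * p^`() * 'X^N - p * (N%:R * 'X^N) = ('X * p^`() - p *+ N) * 'X^N by ring.
by rewrite expr2 !tofracM -mulf_div divff ?mulr1 // tofrac_eq0 expf_neq0 // polyX_eq0.
Qed.

Lemma lc_expand0_euler_lpol N p k :
  lc (expand0 (euler (lpol N p))) k = k%:~R * lc (expand0 (lpol N p)) k.
Proof.
rewrite euler_lpol !lc_expand0; case E: (k + N%:Z) => [m|m]; last by rewrite mulr0.
have -> : k = m%:Z - N%:Z by lia.
rewrite coefB coefZ coefXM rmorphB mulrBl /= -!pmulrn; congr (_ - _).
by case: m {E} => [|m] /=; rewrite ?mul0r // coef_deriv mulr_natl.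
Qed.

End Expansion.

Section RegularOnGm.
Variable C : closedFieldType.
Local Notation ratfun := {fraction {poly C}}.
Implicit Types (p : {poly C}) (f g : ratfun) (k : int).

Lemma regular_lpol N p : regular_on_Gm (lpol N p).
Proof.
by move=> a a0; exists p, 'X^N; rewrite hornerXn expf_neq0.
Qed.

(** Induction on the size of the denominator. A root 0 is moved into the power of z; at a root c <>
    0, regularity forces the numerator to vanish too, and 'X - c cancels. *)
Lemma regularP f : regular_on_Gm f -> exists N p, f = lpol N p.
Proof.
have [[a b] /= [b0 ->]] := fracP f.
have [s] := ubnP (size b); elim: s => // s IH in a b b0 *; rewrite ltnS => bs fr.
have [|b1] := eqVneq (size b) 1%N.
  move/eqP/size_poly1P => [c c0 Eb]; exists 0%N, (c^-1 *: a); apply/eqP.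
  rewrite Eb /lpol eqr_div ?tofrac_eq0 ?polyC_eq0 ?expf_neq0 ?polyX_eq0 ?oner_eq0 //.
  by rewrite -!tofracM expr0 mulr1 -scalerAl [a * _]mulrC mul_polyC scalerA mulVf ?scale1r.
have /closed_rootP[c cb] := b1.



move: (cb) => /factor_theorem[b' Eb].
have b'0 : b' != 0 by apply: contraNneq b0; rewrite Eb => ->; rewrite mul0r.
have sb' : (size b' < s)%N.
  by move: bs; rewrite Eb size_Mmonic ?monicXsubC // size_XsubC addn2.
have Xc0 : 'X - c%:P != 0 :> {poly C} by rewrite polyXsubC_eq0.
have [c0|c0] := eqVneq c 0.
  rewrite c0 subr0 in Eb Xc0; have [|N [p E]] := IH a b' b'0 sb'.
    move=> d /fr[p [q [qd /eqP]]].
    have q0 : q != 0 by apply: contraNneq qd => ->; rewrite horner0.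
    rewrite eqr_div ?tofrac_eq0 // -!tofracM tofrac_eq => /eqP E.
    exists (p * 'X), q; split=> //; apply/eqP.
    by rewrite eqr_div ?tofrac_eq0 // -!tofracM tofrac_eq E Eb; apply/eqP; ring.
  exists N.+1, p; rewrite Eb tofracM invfM mulrA E /lpol exprSr tofracM.
  by rewrite [in RHS]invfM mulrA.
have [p [q [qc /eqP]]] := fr c c0.
have q0 : q != 0 by apply: contraNneq qc => ->; rewrite horner0.
rewrite eqr_div ?tofrac_eq0 // -!tofracM tofrac_eq => /eqP E.
have /factor_theorem[a' Ea] : root a c.
  have /eqP := congr1 (horner^~ c) E; rewrite /= !hornerM (rootP cb) mulr0.
  by rewrite mulf_eq0 (negbTE qc) orbF.
have Eab : FracField.tofrac a / FracField.tofrac b = FracField.tofrac a' / FracField.tofrac b'.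
  apply/eqP; rewrite eqr_div ?tofrac_eq0 // -!tofracM tofrac_eq Ea Eb.
  by apply/eqP; ring.
rewrite Eab; apply: IH => //; by rewrite -Eab.
Qed.

Lemma lc_expandoo f k : regular_on_Gm f ->
  lc (expandoo f) k = lc (expand0 f) (- k).
Proof. by move=> /regularP[N [p ->]]; apply: lc_expandoo_lpol. Qed.

Lemma lc_expand0_euler f k : regular_on_Gm f ->
  lc (expand0 (euler f)) k = k%:~R * lc (expand0 f) k.
Proof. by move=> /regularP[N [p ->]]; apply: lc_expand0_euler_lpol. Qed.

Lemma expand0_euler f : regular_on_Gm f -> expand0 (euler f) = euler0 (expand0 f).
Proof. by move=> fr; apply: lc_inj => k; rewrite lc_expand0_euler // lc_euler0. Qed.

Lemma regular_euler f : regular_on_Gm f -> regular_on_Gm (euler f).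
Proof. by move=> /regularP[N [p ->]]; rewrite euler_lpol; apply: regular_lpol. Qed.

Lemma expandoo_euler f : regular_on_Gm f -> expandoo (euler f) = euleroo (expandoo f).
Proof.
move=> fr; apply: lc_inj => k; rewrite lc_expandoo ?lc_expand0_euler //; last exact: regular_euler.
by rewrite /euleroo lcN lc_euler0 lc_expandoo // mulrNz mulNr.
Qed.

Lemma regularD f g : regular_on_Gm f -> regular_on_Gm g -> regular_on_Gm (f + g).
Proof.
move=> fr gr a a0; have [p [q [qa ->]]] := fr a a0; have [p' [q' [qa' ->]]] := gr a a0.
have q0 : q != 0 by apply: contraNneq qa => ->; rewrite horner0.
have q0' : q' != 0 by apply: contraNneq qa' => ->; rewrite horner0.
exists (p * q' + p' * q), (q * q'); rewrite hornerM mulf_neq0 //; split=> //.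
by rewrite addf_div ?tofrac_eq0 // tofracD !tofracM.
Qed.

Lemma regularM f g : regular_on_Gm f -> regular_on_Gm g -> regular_on_Gm (f * g).
Proof.
move=> fr gr a a0; have [p [q [qa ->]]] := fr a a0; have [p' [q' [qa' ->]]] := gr a a0.
exists (p * p'), (q * q'); rewrite hornerM mulf_neq0 //; split=> //.
by rewrite mulf_div !tofracM.
Qed.

Lemma regular_const (c : C) : regular_on_Gm (rconst c).
Proof.
move=> a a0; exists c%:P, 1; rewrite hornerC oner_eq0; split=> //.
by rewrite tofrac1 divr1.
Qed.

Lemma regularN f : regular_on_Gm f -> regular_on_Gm (- f).
Proof.
by move=> fr; rewrite -mulN1r -(rmorph1 (@rconst C)) -rmorphN; apply: regularM => //; apply: regular_const.
Qed.

Lemma regular_varXz k : regular_on_Gm (rvar C ^ k).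
Proof.
case: k => N.
  have := @regular_lpol 0 'X^N; rewrite /lpol expr0 tofrac1 divr1.
  by rewrite tofracXn.
have := @regular_lpol N.+1 1; rewrite /lpol tofrac1 mul1r.
by rewrite tofracXn NegzE -exprnN.
Qed.

Lemma regular_sum (I : Type) (s : seq I) (P : pred I) (F : I -> ratfun) :
  (forall i, P i -> regular_on_Gm (F i)) -> regular_on_Gm (\sum_(i <- s | P i) F i).
Proof.
move=> Fr; elim/big_rec: _ => [|i f Pi fr].
  by rewrite -(rmorph0 (@rconst C)); apply: regular_const.
by apply: regularD => //; apply: Fr.
Qed.

End RegularOnGm.

(** * The Iwahori filtration *)

Section Shift.
Variable n : nat.
Implicit Types (i j : 'I_n.+1) (d e k : int).

(* The matrix unit [e_ij z^k] has degree [n.+1 * k + j - i]: in row [i], the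
   monomial of degree [d] is [z^(qt i d)] in column [sh i d]. *)
Definition sh i d : 'I_n.+1 := inord `|((i%:Z + d)%R %% n.+1%:Z)%Z|%N.
Definition qt i d : int := ((i%:Z + d)%R %/ n.+1%:Z)%Z.

Lemma shqtE i d : i%:Z + d = n.+1%:Z * qt i d + (sh i d)%:Z.
Proof.
have n0 : n.+1%:Z != 0 by [].
rewrite {1}(divz_eq (i%:Z + d) n.+1%:Z) mulrC; congr (_ + _).
have := ltz_pmod (i%:Z + d) (isT : 0 < n.+1%:Z); have := modz_ge0 (i%:Z + d) n0.
rewrite /sh; move: (_ %% _)%Z => m m0 mn; rewrite inordK; last by lia.
by lia.
Qed.

Lemma shqt_uniq i d j k : i%:Z + d = n.+1%:Z * k + j%:Z -> sh i d = j /\ qt i d = k.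
Proof.
rewrite shqtE => E; have jn := ltn_ord j; have sn := ltn_ord (sh i d).
have qk : qt i d = k.
  move: (nat_of_ord (sh i d)) (nat_of_ord j) sn jn E; clear => a b an bn E.
  have [//|ne] := eqVneq (qt i d) k; exfalso.
  have [lt|gt] : qt i d < k \/ k < qt i d by move: ne; lia.
    have : n.+1%:Z * (qt i d + 1) <= n.+1%:Z * k by rewrite ler_pM2l // lezD1.
    by rewrite mulrDr; lia.
  have : n.+1%:Z * (k + 1) <= n.+1%:Z * qt i d by rewrite ler_pM2l // lezD1.
  by rewrite mulrDr; lia.
split=> //; apply/val_inj => /=; move: E; rewrite qk; lia.
Qed.

Lemma shD i d e : sh (sh i d) e = sh i (d + e).
Proof.
have E1 := shqtE i d; have E2 := shqtE (sh i d) e.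
have [] // := @shqt_uniq i (d + e) (sh (sh i d) e) (qt i d + qt (sh i d) e).
by rewrite addrA E1 -addrA E2 mulrDr addrA.
Qed.

Lemma qtD i d e : qt i (d + e) = qt i d + qt (sh i d) e.
Proof.
have E1 := shqtE i d; have E2 := shqtE (sh i d) e.
have [] // := @shqt_uniq i (d + e) (sh (sh i d) e) (qt i d + qt (sh i d) e).
by rewrite addrA E1 -addrA E2 mulrDr addrA.
Qed.

Lemma sh0 i : sh i 0 = i.
Proof. by have [] := @shqt_uniq i 0 i 0; rewrite ?mulr0 ?addr0 ?add0r. Qed.
Lemma qt0 i : qt i 0 = 0.
Proof. by have [] := @shqt_uniq i 0 i 0; rewrite ?mulr0 ?addr0 ?add0r. Qed.

Lemma shK d : cancel (sh^~ d) (sh^~ (- d)).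
Proof. by move=> i; rewrite shD subrr sh0. Qed.
Lemma shNK d : cancel (sh^~ (- d)) (sh^~ d).
Proof. by move=> i; rewrite shD addNr sh0. Qed.
Lemma sh_bij d : bijective (sh^~ d).
Proof. exists (sh^~ (- d)); [exact: shK|exact: shNK]. Qed.

Lemma sh_pos i j k : sh i (n.+1%:Z * k + j%:Z - i%:Z) = j.
Proof. by have [] := @shqt_uniq i (n.+1%:Z * k + j%:Z - i%:Z) j k; rewrite // addrC subrK. Qed.
Lemma qt_pos i j k : qt i (n.+1%:Z * k + j%:Z - i%:Z) = k.
Proof. by have [] := @shqt_uniq i (n.+1%:Z * k + j%:Z - i%:Z) j k; rewrite // addrC subrK. Qed.

Lemma degE i d : n.+1%:Z * qt i d + (sh i d)%:Z - i%:Z = d.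
Proof. by rewrite -shqtE addrC addKr. Qed.

(* Up to commutators with powers of omega, [z d/dz omega^d] is thus
   [(d / n.+1) omega^d], which is where [d = 0] becomes exceptional. *)
Lemma sum_qt d : \sum_(i < n.+1) qt i d = d.
Proof.
have : \sum_(i < n.+1) (i%:Z + d) = \sum_(i < n.+1) (n.+1%:Z * qt i d + (sh i d)%:Z).
  by apply: eq_bigr => i _; apply: shqtE.
(* [sh^~ d] permutes the indices, so the sums of i and of [sh i d] cancel. *)
rewrite !big_split /= -mulr_sumr (reindex _ (onW_bij _ (sh_bij d))) /=.
rewrite addrC => /addIr; rewrite sumr_const card_ord -mulr_natl natz.
by move/mulfI => <-.
Qed.

End Shift.

Section Filtration.
Variables (C : fieldType) (n : nat).
Local Notation laurent := {fraction (pseries C)}.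
Local Notation mat := 'M[laurent]_n.+1.
Implicit Types (X Y : mat) (i j : 'I_n.+1) (d e k s t : int).

(* The coefficient of degree [d] of [X] in row [i]; [fil s] is the Iwahori
   filtration [i^s] (lemma [iwahori_filtP]). *)
Definition dc X d i : C := lc (X i (sh i d)) (qt i d).
Definition fil s X := forall d i, d < s -> dc X d i = 0.

Lemma dcP X i j k : lc (X i j) k = dc X (n.+1%:Z * k + j%:Z - i%:Z) i.
Proof. by rewrite /dc sh_pos qt_pos. Qed.

Lemma dc_inj X Y : (forall d i, dc X d i = dc Y d i) -> X = Y.
Proof. by move=> XY; apply/matrixP => i j; apply: lc_inj => k; rewrite !dcP XY. Qed.

Lemma dcD X Y d i : dc (X + Y) d i = dc X d i + dc Y d i.
Proof. by rewrite /dc mxE lcD. Qed.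
Lemma dcN X d i : dc (- X) d i = - dc X d i.
Proof. by rewrite /dc mxE lcN. Qed.
Lemma dcB X Y d i : dc (X - Y) d i = dc X d i - dc Y d i.
Proof. by rewrite dcD dcN. Qed.
Lemma dc0 d i : dc 0 d i = 0.
Proof. by rewrite /dc mxE lc0. Qed.
Lemma dcZ c X d i : dc (lconst c *: X) d i = c * dc X d i.
Proof. by rewrite /dc mxE lcZ. Qed.
Lemma dc_sum (I : Type) (r : seq I) (P : pred I) (F : I -> mat) d i :
  dc (\sum_(x <- r | P x) F x) d i = \sum_(x <- r | P x) dc (F x) d i.
Proof. by apply: (big_morph (fun X => dc X d i)) => [X Y|]; rewrite ?dcD ?dc0. Qed.

Lemma fil_weak s t X : t <= s -> fil s X -> fil t X.
Proof. by move=> ts Xs d i dt; apply: Xs; apply: lt_le_trans ts. Qed.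
Lemma fil0 s : fil s 0.
Proof. by move=> d i _; rewrite dc0. Qed.
Lemma filD s X Y : fil s X -> fil s Y -> fil s (X + Y).
Proof. by move=> Xs Ys d i ds; rewrite dcD Xs // Ys // addr0. Qed.
Lemma filN s X : fil s X -> fil s (- X).
Proof. by move=> Xs d i ds; rewrite dcN Xs // oppr0. Qed.
Lemma filB s X Y : fil s X -> fil s Y -> fil s (X - Y).
Proof. by move=> Xs Ys; apply: filD => //; apply: filN. Qed.
Lemma filZ s c X : fil s X -> fil s (lconst c *: X).
Proof. by move=> Xs d i ds; rewrite dcZ Xs // mulr0. Qed.
Lemma filS s X : fil s X -> (forall i, dc X s i = 0) -> fil (s + 1) X.
Proof.
move=> Xs X0 d i; rewrite ltzD1 le_eqVlt => /orP[/eqP -> //|]; exact: Xs.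
Qed.

Lemma fil_bound X : exists N : nat, fil (- N%:Z) X.
Proof.
pose b i j := projT1 (cid (lc_bound (X i j))).
have bP i j k : k < - (b i j)%:Z -> lc (X i j) k = 0 by rewrite /b; case: cid => ?; apply.
pose B := (\sum_i \sum_j b i j)%N.
have Bb i j : (b i j <= B)%N.
  by rewrite /B (bigD1 i) //= (bigD1 j) //= -addnA leq_addr.
(* A degree differs from [n.+1] times its exponent of z by at most n, so a degree below this bound
   has exponent below -B. *)
exists (n.+1 * B.+1)%N => d i dN; apply: bP; have := Bb i (sh i d).
have := degE i d; have := ltn_ord i; have := ltn_ord (sh i d).
move: (b _ _) (qt i d) (nat_of_ord i) (nat_of_ord (sh i d)) => a q x y *.
have [//|aq] := ltP q (- a%:Z).
have : n.+1%:Z * (- a%:Z) <= n.+1%:Z * q by rewrite ler_pM2l.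
have : n.+1%:Z * a%:Z <= n.+1%:Z * B%:Z by rewrite ler_pM2l.
by lia.
Qed.

Lemma fil_all X : (forall s, fil s X) -> X = 0.
Proof. by move=> Xs; apply: dc_inj => d i; rewrite dc0 (Xs (d + 1)) // ltzD1. Qed.

Lemma mx_of_dc s (y : nat -> 'I_n.+1 -> C) : exists X,
  forall d i, dc X d i = if d - s is Posz m then y m i else 0.
Proof.
pose v i j k : C := if n.+1%:Z * k + j%:Z - i%:Z - s is Posz m then y m i else 0.
(* Exponents below -K only occur in degrees below s, in every entry. *)
pose K := (`|s| + n.+1)%N.
have ex i j : exists x, forall k, lc x k = v i j k.
  have [x xE] := laurent_of (- K%:Z) (fun m => v i j (m%:Z - K%:Z)).
  exists x => k; rewrite xE opprK; case E: (k + K%:Z) => [m|m].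
    by congr v; lia.
  rewrite /v; case E': (_ - s) => [m'|//]; exfalso.
  have := ltn_ord i; have := ltn_ord j; move: E'; rewrite /K in E *.
  have : n.+1%:Z * k <= n.+1%:Z * (- K%:Z) by rewrite ler_pM2l //; lia.
  have : K%:Z <= n.+1%:Z * K%:Z by rewrite ler_peMl //.
  by rewrite /K; lia.
exists (\matrix_(i, j) projT1 (cid (ex i j))) => d i.
by rewrite /dc mxE; case: cid => x /= ->; rewrite /v degE.
Qed.

(* [omega ^ d]. *)
Definition Om d : mat := \matrix_(i, j) (if j == sh i d then lvar C ^ qt i d else 0).

Lemma dc_Om d e i : dc (Om d) e i = (e == d)%:R.
Proof.
rewrite /dc mxE; have [E|E] := eqVneq (sh i e) (sh i d); last first.
  by rewrite lc0; case: eqP => // ed; rewrite ed eqxx in E.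
rewrite lc_lvarXz; congr (nat_of_bool _)%:R; apply/eqP/eqP => [E2|-> //].
by rewrite -(degE i e) E E2 degE.
Qed.

Lemma OmMl d X i j : (Om d *m X) i j = lvar C ^ qt i d * X (sh i d) j.
Proof.
rewrite mxE (bigD1 (sh i d)) //= mxE eqxx big1 ?addr0 // => l /negbTE ld.
by rewrite mxE ld mul0r.
Qed.

(** Coefficients are indexed by rows, so left multiplication by a power of omega rotates them while
    right multiplication ([dc_OmMr]) does not. This asymmetry turns commutators with powers of omega
    into cyclic differences. *)
Lemma dc_OmMl d X e i : dc (Om d *m X) e i = dc X (e - d) (sh i d).
Proof.
have E : d + (e - d) = e by rewrite addrC subrK.
rewrite /dc OmMl lcXz shD E; congr lc.
have -> : qt i e = qt i d + qt (sh i d) (e - d) by rewrite -qtD E.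
by rewrite addrC addKr.
Qed.

Lemma OmMr d X i j : (X *m Om d) i j = lvar C ^ (- qt j (- d)) * X i (sh j (- d)).
Proof.
rewrite mxE (bigD1 (sh j (- d))) //= mxE shNK eqxx big1 ?addr0 => [|l ld].
  rewrite mulrC; congr (_ ^ _ * _); apply/eqP; rewrite -addr_eq0 addrC -qtD addNr.
  by rewrite qt0.
rewrite mxE; case: eqP => [jl|]; last by rewrite mulr0.
by case/eqP: ld; rewrite jl shK.
Qed.

Lemma dc_OmMr d X e i : dc (X *m Om d) e i = dc X (e - d) i.
Proof. by rewrite /dc OmMr lcXz shD opprK -qtD. Qed.

Lemma Om_mul d e : Om d *m Om e = Om (d + e).
Proof.
by apply: dc_inj => f i; rewrite dc_OmMl !dc_Om subr_eq addrC.
Qed.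

Lemma Om0 : Om 0 = 1%:M.
Proof.
apply/matrixP => i j; rewrite !mxE sh0 qt0 expr0z eq_sym.
by case: eqP.
Qed.

Lemma Om_unit d : Om d \in unitmx.
Proof.
have E : Om d *m Om (- d) = 1%:M by rewrite Om_mul subrr Om0.
by have [U _] := @mulmx1_unit laurent n.+1 _ _ E.
Qed.

Lemma invmx_Om d : invmx (Om d) = Om (- d).
Proof.
by rewrite -[LHS]mul1mx -Om0 -(addNr d) -Om_mul -mulmxA mulmxV ?Om_unit // mulmx1.
Qed.

Lemma omegaE : omega C n.+1 = Om 1.
Proof.
apply/matrixP => i j; rewrite !mxE.
have := ltn_ord i; rewrite ltnS leq_eqVlt => /orP[/eqP E|lt].
  have [-> ->] : sh i 1 = ord0 /\ qt i 1 = 1.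
    by apply: shqt_uniq; rewrite E /=; lia.
  rewrite E eqxx expr1z /= (_ : (j == n.+1 :> nat) = false); last first.
    by apply/negbTE; rewrite neq_ltn ltn_ord.
  rewrite add0r -val_eqE /=; case: eqP => _; by rewrite ?mul1r ?mul0r.
have [-> ->] : sh i 1 = lift ord0 (Ordinal lt) /\ qt i 1 = 0.
  by apply: shqt_uniq; rewrite /= /bump /=; lia.
rewrite expr0z -val_eqE /= /bump /= add1n (_ : (i == n :> nat) = false) ?mul0r ?addr0.
  by case: eqP.
by apply/negbTE; rewrite neq_ltn lt.
Qed.

Lemma OmX d (k : nat) : Om d ^+ k = Om (d * k%:Z).
Proof.
elim: k => [|k IH]; first by rewrite expr0 mulr0 Om0.
by rewrite exprS IH -[_ * _]/(_ *m _) Om_mul; congr Om; lia.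
Qed.

Lemma invmx_omegaX (k : nat) : invmx (omega C n.+1) ^+ k = Om (- k%:Z).
Proof. by rewrite omegaE invmx_Om OmX mulN1r. Qed.

Lemma omega_expE s : omega_exp C n.+1 s = Om s.
Proof.
case: s => k; rewrite /omega_exp; first by rewrite omegaE OmX mul1r.
by rewrite invmx_omegaX NegzE.
Qed.

Lemma fil0P X : fil 0 X <-> (forall i j k, k < 0 -> lc (X i j) k = 0) /\
  (forall i j, (j < i)%N -> lc (X i j) 0 = 0).
Proof.
split=> [X0|[X0 X1] d i d0].
  split=> [i j k k0|i j ji]; rewrite dcP; apply: X0; last by rewrite mulr0 add0r; lia.
  have : n.+1%:Z * (k + 1) <= n.+1%:Z * 0 by rewrite ler_pM2l // lezD1.
  by have := ltn_ord j; lia.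
rewrite /dc; have E := degE i d; have := ltn_ord (sh i d).
have [k0|k0|k0] := ltgtP (qt i d) 0; first by rewrite X0.
  have : n.+1%:Z * 1 <= n.+1%:Z * qt i d by rewrite ler_pM2l // lezD1.
  have := ltn_ord i; lia.
by move=> _; rewrite k0 X1 //; move: E; rewrite k0 mulr0; lia.
Qed.

Lemma iwahoriP X : iwahori X <-> fil 0 X.
Proof.
rewrite fil0P; split=> [[Y [-> Y0]]|[X0 X1]].
  by split=> [i j k k0|i j ji]; rewrite mxE lc_tofrac; [case: k k0|rewrite /= Y0].
exists (\matrix_(i, j) PSeries (fun m => lc (X i j) m%:Z)); split.
  by apply/matrixP => i j; rewrite !mxE; apply: lc_tofracK => k; apply: X0.
by move=> i j ji; rewrite mxE /= X1.
Qed.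

Lemma iwahori_filtP s X : iwahori_filt s X <-> fil s X.
Proof.
rewrite /iwahori_filt omega_expE; split=> [[Y /iwahoriP Y0 <-] d i ds|Xs].
  by rewrite dc_OmMl Y0 // subr_lt0.
exists (Om (- s) *m X); last by rewrite mulmxA Om_mul subrr Om0 mul1mx.
by apply/iwahoriP => d i d0; rewrite dc_OmMl Xs // opprK -[X in _ < X]add0r ltrD2r.
Qed.

Lemma fil0M X Y : fil 0 X -> fil 0 Y ->
  fil 0 (X *m Y) /\ forall i, dc (X *m Y) 0 i = dc X 0 i * dc Y 0 i.
Proof.
rewrite !fil0P => -[X0 X1] [Y0 Y1]; split; [split|].
- by move=> i j k k0; rewrite mxE lc_sum big1 // => l _; apply: lcM_lt0 => // ??; auto.
- move=> i j ji; rewrite mxE lc_sum big1 // => l _; rewrite lcM_0; [|by auto..].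
  have [li|il] := ltnP l i; first by rewrite X1 ?mul0r.
  by rewrite Y1 ?mulr0 //; apply: leq_trans il.
move=> i; rewrite /dc sh0 qt0 mxE lc_sum (bigD1 i) //= lcM_0; [|by auto..].
rewrite big1 ?addr0 // => l li; rewrite lcM_0; [|by auto..].
have [lt|gt|E] := ltngtP l i; [by rewrite X1 ?mul0r|by rewrite Y1 ?mulr0|].
by rewrite (val_inj E) eqxx in li.
Qed.

(** Splitting off omega^s on the left and omega^t on the right leaves two factors in the Iwahori
    subalgebra, where [fil0M] applies. *)
Lemma filM s t X Y : fil s X -> fil t Y -> fil (s + t) (X *m Y).
Proof.
move=> Xs Yt; pose X' := Om (- s) *m X; pose Y' := Y *m Om (- t).
have X'0 : fil 0 X'.
  by move=> d i d0; rewrite dc_OmMl Xs // opprK -[X in _ < X]add0r ltrD2r.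
have Y'0 : fil 0 Y'.
  by move=> d i d0; rewrite dc_OmMr Yt // opprK -[X in _ < X]add0r ltrD2r.
have -> : X *m Y = Om s *m (X' *m Y' *m Om t).
  rewrite /X' /Y' !mulmxA Om_mul subrr Om0 mul1mx -!mulmxA Om_mul addNr Om0.
  by rewrite mulmx1.
have [XY0 _] := fil0M X'0 Y'0.
by move=> d i dst; rewrite dc_OmMl dc_OmMr XY0 //; lia.
Qed.

Lemma dcM s t X Y i : fil s X -> fil t Y ->
  dc (X *m Y) (s + t) i = dc X s i * dc Y t (sh i s).
Proof.
move=> Xs Yt; pose X' := Om (- s) *m X; pose Y' := Y *m Om (- t).
have X'0 : fil 0 X'.
  by move=> d j d0; rewrite dc_OmMl Xs // opprK -[X in _ < X]add0r ltrD2r.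
have Y'0 : fil 0 Y'.
  by move=> d j d0; rewrite dc_OmMr Yt // opprK -[X in _ < X]add0r ltrD2r.
have -> : X *m Y = Om s *m (X' *m Y' *m Om t).
  rewrite /X' /Y' !mulmxA Om_mul subrr Om0 mul1mx -!mulmxA Om_mul addNr Om0.
  by rewrite mulmx1.
have [_ XY0] := fil0M X'0 Y'0.
rewrite dc_OmMl dc_OmMr (_ : s + t - s - t = 0); last by lia.
rewrite XY0 dc_OmMl dc_OmMr.
by rewrite !sub0r !opprK shK.
Qed.

Lemma fil_Om d : fil d (Om d).
Proof. by move=> e i ed; rewrite dc_Om lt_eqF. Qed.

Lemma dc1 d i : dc 1%:M d i = (d == 0)%:R.
Proof. by rewrite -Om0 dc_Om. Qed.

Lemma dc_formal_type (p : {poly C}) d i :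
  dc (formal_type n.+1 p) d i = if - d is Posz m then p`_m else 0.
Proof.
rewrite /formal_type dc_sum.
under eq_bigr => l _ do rewrite invmx_omegaX dcZ dc_Om -[d == _]eqr_opp opprK.
case: (- d) => m; last by rewrite big1 // => l _; rewrite mulr0.
have [ms|ms] := ltnP m (size p); last first.
  rewrite nth_default // big1 // => -[l /= ls] _.
  rewrite (_ : (_ == _) = false) ?mulr0 //.
  by apply/negbTE/eqP => -[E]; move: ls; rewrite -E ltnNge ms.
rewrite (bigD1 (Ordinal ms)) //= eqxx mulr1 big1 ?addr0 // => l lm.
rewrite (_ : (_ == _) = false) ?mulr0 //.
by apply/negbTE; move: lm; rewrite -val_eqE /= eq_sym.
Qed.

Lemma dc_unip h i : fil 1 (h - 1%:M) -> dc h 0 i = 1.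
Proof.
by move=> h1; rewrite -[h](subrK 1%:M) dcD h1 // add0r dc1.
Qed.

Lemma fil_unip h : fil 1 (h - 1%:M) -> fil 0 h.
Proof.
move=> h1; rewrite -[h](subrK 1%:M); apply: filD; first exact: fil_weak h1.
by rewrite -Om0; apply: fil_Om.
Qed.

(** h has leading coefficient 1 in every row, so X and X h have the same leading terms; X climbs one
    degree at a time from any lower bound. *)
Lemma fil_cancelr h s X : fil 1 (h - 1%:M) -> fil s (X *m h) -> fil s X.
Proof.
move=> h1 Xh; have [N XN] := fil_bound X.
have : forall m : nat, - N%:Z + m%:Z <= s -> fil (- N%:Z + m%:Z) X.
  elim=> [|m IH] ms; first by rewrite addr0.
  have IH' := IH ltac:(lia); rewrite -addn1 PoszD addrA; apply: filS => // i.
  have := dcM i IH' (fil_unip h1); rewrite addr0 dc_unip // mulr1 => <-.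
  by apply: Xh; lia.
have [sN|Ns] := leP s (- N%:Z); first by move=> _; apply: fil_weak XN.
by move=> /(_ `|(s + N%:Z)%R|%N); rewrite (_ : - N%:Z + _ = s); [apply|lia].
Qed.

End Filtration.

Section Unipotent.
Variables (C : fieldType) (n : nat).
Local Notation laurent := {fraction (pseries C)}.
Implicit Types (h : 'M[laurent]_n.+1).

(** By [fil_cancelr] the kernel matrix of h lies in every step of the filtration, hence vanishes. *)
Lemma unip_unit h : fil 1 (h - 1%:M) -> h \in unitmx.
Proof.
move=> h1; rewrite -row_free_unit -kermx_eq0; apply/eqP/fil_all => s.
by apply: fil_cancelr h1 _; rewrite mulmx_ker; apply: fil0.
Qed.

Lemma unip_inv h : fil 1 (h - 1%:M) -> fil 1 (invmx h - 1%:M).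
Proof.
move=> h1; apply: (fil_cancelr h1).
by rewrite mulmxBl mulVmx ?unip_unit // mul1mx -opprB; apply: filN.
Qed.

Lemma unip_mul h g : fil 1 (h - 1%:M) -> fil 1 (g - 1%:M) -> fil 1 (h *m g - 1%:M).
Proof.
move=> h1 g1.
have -> : h *m g - 1%:M = (h - 1%:M) *m g + (g - 1%:M).
  by rewrite mulmxBl mul1mx addrA subrK.
by apply: filD => //; rewrite -[1]addr0; apply: filM => //; apply: fil_unip.
Qed.

End Unipotent.

(** * The irregular singularity *)

Section CyclicShift.
Variables (C : fieldType) (n r : nat).
Hypothesis rn : coprime r n.+1.
Implicit Types (i : 'I_n.+1) (x : 'I_n.+1 -> C).

(** The orbit of row 0 under rotation by -r; coprimality makes it run through all rows. *)
Let o (k : nat) : 'I_n.+1 := sh ord0 (- (r * k)%N%:Z).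

Let oS k : o k.+1 = sh (o k) (- r%:Z).
Proof. by rewrite /o shD; congr sh; lia. Qed.

Let o_mod k : o (k %% n.+1)%N = o k.
Proof.
pose q := (k %/ n.+1)%N; pose m := (k %% n.+1)%N.
suff H : (ord0 : 'I_n.+1)%:Z + - (r * m)%N%:Z =
    n.+1%:Z * (qt (ord0 : 'I_n.+1) (- (r * k)%N%:Z) + r%:Z * q%:Z) + (o k)%:Z.
  by have [] := shqt_uniq H.
have E := degE (ord0 : 'I_n.+1) (- (r * k)%N%:Z).
have kE : k%:Z = q%:Z * n.+1%:Z + m%:Z by rewrite {1}(divn_eq k n.+1) PoszD PoszM.
move: E; rewrite -/(o k) !PoszM kE.
by move: (qt _ _) (nat_of_ord (o k)) => a b /= E; lia.
Qed.

Let o_surj i : exists k : 'I_n.+1, o k = i.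
Proof.
(* c is congruent to -i modulo the rank and divisible by r; with c = k r the orbit reaches row i at
   time k. *)
pose c := chinese n.+1 r (n.+1 - i) 0.
have nr : coprime n.+1 r by rewrite coprime_sym.
have c1 : c = (n.+1 - i)%N %[mod n.+1] := chinese_modl nr _ _.
have /dvdnP[k ck] : (r %| c)%N by rewrite /dvdn /c (chinese_modr nr) mod0n.
have kn : (k %% n.+1 < n.+1)%N by rewrite ltn_mod.
exists (Ordinal kn); rewrite /= o_mod.
suff H : (ord0 : 'I_n.+1)%:Z + - (r * k)%N%:Z =
    n.+1%:Z * (((n.+1 - i) %/ n.+1)%N%:Z - (c %/ n.+1)%N%:Z - 1) + i%:Z.
  by have [] := shqt_uniq H.
have := divn_eq c n.+1; have := divn_eq (n.+1 - i) n.+1; rewrite c1 mulnC [(r * k)%N]mulnC -ck.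
have := ltn_ord i; move: (nat_of_ord i) c {c1 ck kn} => /= a c.
move: (_ %/ _)%N (_ %/ _)%N (_ %% _)%N => x y z.
by lia.
Qed.

Lemma cyc_const x : (forall i, x (sh i (- r%:Z)) = x i) -> forall i, x i = x ord0.
Proof.
move=> xc i; have [k <-] := o_surj i; elim: (nat_of_ord k) => [|m IH].
  by rewrite /o muln0 oppr0 sh0.
by rewrite oS xc.
Qed.

Lemma cyc_sum x : \sum_i (x (sh i (- r%:Z)) - x i) = 0.
Proof.
by rewrite sumrB [X in _ - X](reindex _ (onW_bij _ (sh_bij n (- r%:Z)))) /= subrr.
Qed.

(** y is the partial sum of x along the orbit; the vanishing total makes the equation hold where the
    cycle closes. *)
Lemma cyc_solve x : \sum_i x i = 0 ->
  exists y : 'I_n.+1 -> C, forall i, y (sh i (- r%:Z)) - y i = x i.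
Proof.
move=> x0; have [q qP] := choice o_surj.
have q_inj : injective q by apply: can_inj (fun k : 'I_n.+1 => o k) _.
have [g qg gq] := injF_bij q_inj.
have oq (k : 'I_n.+1) : q (o k) = k by rewrite -{1}(gq k) qP gq.
have o_bij : bijective (fun k : 'I_n.+1 => o k) by exists q.
exists (fun i => \sum_(l < q i) x (o l)) => i.
rewrite -(qP i); move: (q i) => k; rewrite oq -oS.
have [kn|kn] := ltnP k n.
  have kn' : (k.+1 < n.+1)%N by [].
  rewrite (_ : q (o k.+1) = Ordinal kn'); last by rewrite -[k.+1]/(nat_of_ord (Ordinal kn')) oq.
  by rewrite /= big_ord_recr /= addrAC subrr add0r.
have kn2 : k = n :> nat by have := ltn_ord k; move: kn; lia.
have T : \sum_(l < n.+1) x (o l) = 0.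
  by rewrite -[RHS]x0 [RHS](reindex _ (onW_bij _ o_bij)).
move: T; rewrite big_ord_recr /= kn2 -[o n.+1]o_mod modnn => T.
rewrite -[0%N]/(nat_of_ord (ord0 : 'I_n.+1)) oq big_ord0 sub0r.
by apply/eqP; rewrite eq_sym -addr_eq0 addrC T.
Qed.

End CyclicShift.

(** Successive approximation in complete filtered groups, used on both discs. r is the loss of
    degree under D, and [Good] is the solvability condition that every correction preserves: no
    residue of the trace at 0, a value in the image of ad at infinity. *)
Lemma solve_by_approximation (V W : zmodType) (F : nat -> V -> Prop)
    (G : nat -> W -> Prop) (Good : W -> Prop) (D : {additive V -> W}) (r : nat) :
  (forall m x, F (m + r)%N x -> G m (D x)) ->
  (forall m x y, G m x -> G m y -> G m (x - y)) ->
  (forall m x, G m.+1 x -> G m x) ->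
  (forall x, (forall m, G m x) -> x = 0) ->
  (forall x : nat -> V, (forall m, F m (x m)) ->
     exists X, forall m, F m (X - \sum_(l < m) x l)) ->
  (forall m w, G m w -> Good w ->
     exists x, [/\ F m x, G m.+1 (w - D x) & Good (w - D x)]) ->
  forall w, G 0 w -> Good w -> exists2 x, F 0 x & D x = w.
Proof.
move=> DF GB GS G0 lim step w w0 wg.
have stepT (mw : nat * W) : exists x, G mw.1 mw.2 -> Good mw.2 ->
    [/\ F mw.1 x, G mw.1.+1 (mw.2 - D x) & Good (mw.2 - D x)].
  have [[g1 g2]|ng] := pselect (G mw.1 mw.2 /\ Good mw.2).
    by have [x xP] := step _ _ g1 g2; exists x.
  by exists 0 => g1 g2; case: ng.
have [f fP] := choice stepT.
pose S := fix S m : V := if m is m'.+1 then S m' + f (m', w - D (S m')) else 0.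
have SP m : G m (w - D (S m)) /\ Good (w - D (S m)).
  elim: m => [|m [IH1 IH2]] /=; first by rewrite raddf0 subr0.
  have [_] := fP (m, w - D (S m)) IH1 IH2 => /=.
  by rewrite raddfD opprD addrA.
pose x m := f (m, w - D (S m)).
have Sx m : S m = \sum_(l < m) x l.
  by elim: m => [|m IH]; rewrite ?big_ord0 // big_ord_recr /= -IH.
have [X XP] : exists X, forall m, F m (X - \sum_(l < m) x l).
  by apply: lim => m; have [g1 g2] := SP m; have [] := fP (m, w - D (S m)) g1 g2.
exists X; first by have := XP 0%N; rewrite big_ord0 subr0.
apply/eqP; rewrite -subr_eq0; apply/eqP/G0 => m.
have Gle a b y : G (a + b)%N y -> G a y by elim: b => [|b IH]; rewrite ?addn0 // addnS => /GS.
(* Going r terms further in the partial sums compensates the loss of degree under D. *)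
have -> : D X - w = D (X - S (m + r)%N) - (w - D (S (m + r)%N)).
  by rewrite raddfB opprB addrA subrK.
apply: GB; first by apply: DF; rewrite Sx; apply: XP.
by apply: (Gle m r); have [] := SP (m + r)%N.
Qed.

Section AdConn.
Variables (C : fieldType) (n : nat).
Local Notation laurent := {fraction (pseries C)}.
Local Notation mat := 'M[laurent]_n.
Implicit Types (X Y B : mat).

Definition leul : laurent -> laurent := locked (@euler0 C).
Definition leuloo : laurent -> laurent := locked (@euleroo C).

Lemma leulE : @euler0 C = leul. Proof. by rewrite /leul -lock. Qed.
Lemma leulooE : @euleroo C = leuloo. Proof. by rewrite /leuloo -lock. Qed.

Lemma lc_leul x k : lc (leul x) k = k%:~R * lc x k.
Proof. by rewrite -leulE lc_euler0. Qed.
Lemma lc_leuloo x k : lc (leuloo x) k = - k%:~R * lc x k.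
Proof. by rewrite -leulooE /euleroo (lcN (euler0 x)) lc_euler0 mulNr. Qed.

Lemma leul_zmod : zmod_morphism leul.
Proof. by move=> x y; apply: lc_inj => k; rewrite lcB !lc_leul lcB mulrBr. Qed.
HB.instance Definition _ := GRing.isZmodMorphism.Build _ _ leul leul_zmod.

Lemma leuloo_zmod : zmod_morphism leuloo.
Proof. by move=> x y; apply: lc_inj => k; rewrite lcB !lc_leuloo lcB mulrBr. Qed.
HB.instance Definition _ := GRing.isZmodMorphism.Build _ _ leuloo leuloo_zmod.

Lemma ad_conn_zmod (K : pzRingType) (delta : {additive K -> K}) (A : 'M[K]_n) :
  zmod_morphism (ad_conn delta A).
Proof.
move=> X Y; rewrite /ad_conn map_mxB mulmxBr mulmxBl.
by rewrite [in RHS]opprD [RHS]addrACA !opprD ![- - _]opprK [X in _ + X = _]addrACA.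
Qed.

Definition D0 B : mat -> mat := locked (ad_conn leul B).
Definition Doo B : mat -> mat := locked (ad_conn leuloo B).

Lemma D0_adE B X : D0 B X = ad_conn leul B X.
Proof. by rewrite /D0 -lock. Qed.
Lemma D0E B X : D0 B X = map_mx leul X + (B *m X - X *m B).
Proof. exact: D0_adE. Qed.
Lemma Doo_adE B X : Doo B X = ad_conn leuloo B X.
Proof. by rewrite /Doo -lock. Qed.
Lemma DooE B X : Doo B X = map_mx leuloo X + (B *m X - X *m B).
Proof. exact: Doo_adE. Qed.

Lemma D0_zmod B : zmod_morphism (D0 B).
Proof. rewrite /D0 -lock; exact: ad_conn_zmod. Qed.
Lemma Doo_zmod B : zmod_morphism (Doo B).
Proof. rewrite /Doo -lock; exact: ad_conn_zmod. Qed.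

HB.instance Definition _ B := GRing.isZmodMorphism.Build _ _ (D0 B) (D0_zmod B).
HB.instance Definition _ B := GRing.isZmodMorphism.Build _ _ (Doo B) (Doo_zmod B).

Lemma leulZ c (x : laurent) : leul (lconst c * x) = lconst c * leul x.
Proof. by apply: lc_inj => k; rewrite lc_leul !lcZ lc_leul mulrCA. Qed.

Lemma D0Z B c X : D0 B (lconst c *: X) = lconst c *: D0 B X.
Proof.
rewrite !D0E scalerDr scalerBr -!scalemxAl -!scalemxAr; congr (_ + _).
by apply/matrixP => i j; rewrite !mxE leulZ.
Qed.

Lemma leul1 : leul 1 = 0.
Proof.
by apply: lc_inj => k; rewrite lc_leul lc1 lc0; case: eqP => [->|_]; rewrite ?mul0r ?mulr0.
Qed.

Lemma D01 B : D0 B 1%:M = 0.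
Proof.
rewrite D0E mulmx1 mul1mx subrr addr0; apply/matrixP => i j; rewrite !mxE.
by case: eqP => _; rewrite ?mulr1n ?mulr0n ?leul1 ?raddf0.
Qed.

End AdConn.

Section LocalZero.
Variables (C : numFieldType) (n r : nat).
Local Notation laurent := {fraction (pseries C)}.
Local Notation mat := 'M[laurent]_n.+1.
Implicit Types (X Y W : mat) (i j : 'I_n.+1) (d e k s t : int).

Lemma dc_map_leul X d i : dc (map_mx (@leul C) X) d i = (qt i d)%:~R * dc X d i.
Proof. by rewrite /dc mxE lc_leul. Qed.

Lemma fil_map_leul s X : fil s X -> fil s (map_mx (@leul C) X).
Proof. by move=> Xs d i ds; rewrite dc_map_leul Xs ?mulr0. Qed.

(* [u d] will be [h^-1 omega^d h], where [h] is the gauge transformation of the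
   framing. *)
Variables (B : mat) (c : C) (u : int -> mat).
Hypotheses (r_gt0 : (0 < r)%N) (rn : coprime r n.+1) (c0 : c != 0).
Hypotheses (fil_B : fil (- r%:Z) B) (dc_B : forall i, dc B (- r%:Z) i = c).
Hypotheses (fil_u : forall d, fil d (u d)) (dc_u : forall d i, dc (u d) d i = 1).
Hypothesis (comm_u : forall d, fil (d + 1) (B *m u d - u d *m B)).
Local Notation D := (D0 B).

Lemma fil_D0 s X : fil s X -> fil (s - r%:Z) (D X).
Proof.
move=> Xs; rewrite D0E; apply: filD; first by apply: fil_weak (fil_map_leul Xs); lia.
by apply: filB; [rewrite addrC|]; apply: filM.
Qed.

Lemma dc_D0 s X i : fil s X ->
  dc (D X) (s - r%:Z) i = c * (dc X s (sh i (- r%:Z)) - dc X s i).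
Proof.
move=> Xs; rewrite D0E dcD (fil_map_leul Xs); last by lia.
rewrite add0r dcB (dcM i Xs fil_B) dc_B addrC [s - _]addrC (dcM i fil_B Xs) dc_B.
by rewrite mulrBr addrC; congr (_ - _); rewrite mulrC.
Qed.

Lemma fil_D0u d : fil d (D (u d)).
Proof.
rewrite D0E; apply: filD; first exact: fil_map_leul.
by apply: (@fil_weak _ _ (d + 1) d); [lia|exact: comm_u].
Qed.

Lemma sum_dc_D0u d : \sum_i dc (D (u d)) d i = d%:~R.
Proof.
rewrite -[in RHS](sum_qt n d) rmorph_sum; apply: eq_bigr => i _.
by rewrite D0E dcD dc_map_leul dc_u mulr1 (@comm_u d) ?addr0 ?ltzD1.
Qed.

(* On leading terms [D] is the commutator with [c omega^-r], whose kernel is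
   spanned by the powers of omega because [r] is prime to the rank. *)
Lemma peel s X : fil s X -> (forall i, dc (D X) (s - r%:Z) i = 0) ->
  exists a, fil (s + 1) (X - lconst a *: u s) /\ forall i, dc X s i = a.
Proof.
move=> Xs DX0.
have Xc : forall i, dc X s i = dc X s ord0.
  apply: (cyc_const rn) => i; apply/eqP; rewrite -subr_eq0.
  by rewrite -(mulrI_eq0 _ (mulfI c0)) -dc_D0 ?DX0.
exists (dc X s ord0); split=> //; apply: filS => [|i].
  by apply: filB => //; apply: filZ.
by rewrite dcB dcZ dc_u mulr1 Xc subrr.
Qed.

(* Peeling off multiples of the [D (u t)], [s < t], which lie in [fil (s + 1)],
   brings [Y] into degree [s + r], where the sum telescopes. *)
Lemma sum_dc_D0 s Y : fil (s + 1) Y -> fil s (D Y) -> \sum_i dc (D Y) s i = 0.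
Proof.
have base X : fil (s + r%:Z) X -> \sum_i dc (D X) s i = 0.
  move=> Xs; under eq_bigr => i _ do rewrite -[s in dc _ s](addrK r%:Z) dc_D0 //.
  by rewrite -mulr_sumr cyc_sum mulr0.
suff main m X : (m < r)%N -> fil (s + r%:Z - m%:Z) X -> fil s (D X) ->
    \sum_i dc (D X) s i = 0.
  move=> Ys DY; apply: (main r.-1) => //; first by rewrite prednK.
  by rewrite (_ : _ - _ = s + 1) //; move: r_gt0; lia.
elim: m X => [|m IH] X mr Xs DX; first by apply: base; rewrite subr0 in Xs.
set t := s + r%:Z - m.+1%:Z in Xs.
have [|a [Xa _]] := peel Xs; first by move=> i; apply: DX; rewrite /t; lia.
have DaE : D (X - lconst a *: u t) = D X - lconst a *: D (u t).
  by rewrite raddfB /= D0Z.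
have Dut : fil (s + 1) (lconst a *: D (u t)).
  by apply: filZ; apply: fil_weak (@fil_D0u t); rewrite /t; lia.
have := IH (X - lconst a *: u t); rewrite DaE.
have -> : \sum_i dc (D X - lconst a *: D (u t)) s i = \sum_i dc (D X) s i.
  by apply: eq_bigr => i _; rewrite dcB Dut ?subr0 // ltzD1.
apply; first by lia.
- by apply: fil_weak Xa; rewrite /t; lia.
- by apply: filB => //; apply: fil_weak Dut; lia.
Qed.

(** The leading term of X is a multiple a of [u s]. As D X vanishes in degree s, the coefficients of
    D (X - a u_s) there add up to -a s; by [sum_dc_D0] they add up to 0, so a = 0. *)
Lemma fil_D0_up s e X : fil s X -> s != 0 -> s < e -> fil e (D X) -> fil (s + 1) X.
Proof.
move=> Xs s0 se DX.
have [|a [Xa Xc]] := peel Xs; first by move=> i; apply: DX; lia.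
apply: filS => // i; rewrite Xc; apply/eqP.
have DaE : D (X - lconst a *: u s) = D X - lconst a *: D (u s).
  by rewrite raddfB /= D0Z.
have := sum_dc_D0 Xa; rewrite DaE => /(_ _)/eqP.
have -> : \sum_i dc (D X - lconst a *: D (u s)) s i = - (a * s%:~R).
  under eq_bigr => j _ do rewrite dcB DX // sub0r dcZ.
  by rewrite sumrN -mulr_sumr sum_dc_D0u.
rewrite oppr_eq0 mulf_eq0 intr_eq0 (negbTE s0) orbF; apply.
by apply: filB; [apply: fil_weak DX; lia|apply: filZ; apply: fil_D0u].
Qed.

Lemma fil_D0_iter (m : nat) s e X : fil s X -> fil e (D X) -> s + m%:Z <= e ->
  (forall t, s <= t < s + m%:Z -> t != 0) -> fil (s + m%:Z) X.
Proof.
move=> Xs DX; elim: m => [|m IH] sme t0; first by rewrite addr0.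
rewrite -addn1 PoszD addrA; apply: (@fil_D0_up _ e) => //; last by lia.
  by apply: IH => [|t tP]; [lia|apply: t0; lia].
by apply: t0; lia.
Qed.

(** All degrees climbed through are negative, so the exceptional degree 0 is never crossed. *)
Lemma fil_D0_nonpos e X : e <= 0 -> fil e (D X) -> fil e X.
Proof.
move=> e0 DX; have [N XN] := fil_bound X.
have [eN|Ne] := leP e (- N%:Z); first exact: fil_weak XN.
have := @fil_D0_iter `|(e + N%:Z)%R|%N _ e X XN DX.
rewrite (_ : - N%:Z + _ = e); last by lia.
by apply=> // t tP; lia.
Qed.

(** X climbs to degree 0; there its leading term is removed by a scalar matrix, which D kills, and
    the remainder climbs through all positive degrees. *)
Lemma D0_ker X : D X = 0 -> exists a, X = lconst a *: 1%:M.
Proof.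
move=> DX; have Df e : fil e (D X) by rewrite DX; apply: fil0.
have X0 : fil 0 X by apply: fil_D0_nonpos.
have [i|a [_ Xa]] := peel X0; first by rewrite DX dc0.
exists a; apply/eqP; rewrite -subr_eq0; apply/eqP/fil_all => s.
set Y := X - _; have DY : D Y = 0 by rewrite raddfB /= D0Z DX D01 scaler0 subr0.
have Y1 : fil 1 Y.
  rewrite -[1]add0r; apply: filS => [|i].
    by apply: filB => //; apply: filZ; rewrite -Om0; apply: fil_Om.
  by rewrite dcB dcZ dc1 mulr1 Xa subrr.
have [s1|s1] := leP s 1; first exact: fil_weak Y1.
have DYs : fil s (D Y) by rewrite DY; apply: fil0.
have := @fil_D0_iter `|(s - 1)%R|%N 1 s Y Y1 DYs; rewrite (_ : 1 + _ = s); last by lia.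
by apply; [lia|move=> t tP; lia].
Qed.

Lemma sum_dc0 X : \sum_i dc X 0 i = lc (\tr X) 0.
Proof. by rewrite lc_sum; apply: eq_bigr => i _; rewrite /dc sh0 qt0. Qed.

Lemma sum_dc0_D0 X : \sum_i dc (D X) 0 i = 0.
Proof.
under eq_bigr => i _ do rewrite D0E dcD dc_map_leul qt0 mul0r add0r.
by rewrite sum_dc0 mxtraceD raddfN /= mxtrace_mulC subrr lc0.
Qed.

Lemma single_dc s (y : 'I_n.+1 -> C) : exists2 X : mat, fil s X & forall i, dc X s i = y i.
Proof.
have [X XP] := mx_of_dc s (fun m => if m is 0%N then y else fun _ => 0).
exists X => [d i ds|i]; rewrite XP; last by rewrite subrr.
by case E: (d - s) => [m|//]; move: ds; rewrite -subr_lt0 E.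
Qed.

(** Two corrections: a multiple of [u s] removes the sum of the leading coefficients, since D (u s)
    has sum s, and a term of degree s + r then solves the cyclic difference equation. In degree 0
    the sum is already zero. *)
Lemma D0_step s W : fil s W -> \sum_i dc W 0 i = 0 ->
  exists2 X, fil s X & fil (s + 1) (W - D X).
Proof.
move=> Ws W0; have [a aP] : exists a, \sum_i dc W s i = a * s%:~R.
  have [->|s0] := eqVneq s 0; first by exists 0; rewrite mul0r.
  by exists ((\sum_i dc W s i) / s%:~R); rewrite divfK ?intr_eq0.
pose W' := W - lconst a *: D (u s).
have W's : fil s W' by apply: filB => //; apply/filZ/fil_D0u.
have [|y yP] := @cyc_solve C n r rn (fun i => c^-1 * dc W' s i).
  rewrite -mulr_sumr; under eq_bigr => i _ do rewrite dcB dcZ.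
  by rewrite sumrB -mulr_sumr sum_dc_D0u aP subrr mulr0.
have [Y Ys Yy] := single_dc (s + r%:Z) y.
exists (lconst a *: u s + Y).
  by apply: filD; [apply: filZ|apply: fil_weak Ys; lia].
have DE : D (lconst a *: u s + Y) = lconst a *: D (u s) + D Y by rewrite raddfD /= D0Z.
rewrite DE opprD addrA -/W'.
apply: filS => [|i].
  by apply: filB => //; have := fil_D0 Ys; rewrite addrK.
have := dc_D0 i Ys; rewrite addrK dcB => ->.
by rewrite !Yy yP mulrA mulfV // mul1r subrr.
Qed.

Lemma D0_surj W : \sum_i dc W 0 i = 0 -> exists X, D X = W.
Proof.
move=> W0; have [N WN] := fil_bound W.
pose F (m : nat) X := fil (m%:Z - N%:Z) X.
pose G (m : nat) X := fil (m%:Z - N%:Z) X.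
suff [X _ XW] : exists2 X, F 0%N X & D X = W by exists X.
apply: (@solve_by_approximation _ _ F G (fun W => \sum_i dc W 0 i = 0) D r) => //.
- by move=> m X /fil_D0; apply: fil_weak; lia.
- by move=> m X Y; apply: filB.
- by move=> m X; apply: fil_weak; lia.
- move=> X XP; apply: fil_all => s.
  by apply: fil_weak (XP (`|s| + N)%N); lia.
(* In degree m - N only corrections of index at most m contribute, so the infinite sum is finite in
   each degree. *)
- move=> x xP; have [X XP] := mx_of_dc (- N%:Z)
    (fun m i => \sum_(l < m.+1) dc (x l) (m%:Z - N%:Z) i).
  exists X => m d i dm; rewrite dcB XP dc_sum opprK.
  case E: (d + N%:Z) => [a|a].
    have -> : d = a%:Z - N%:Z by lia.
    rewrite -(big_mkord xpredT (fun l => dc (x l) (a%:Z - N%:Z) i)).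
    rewrite -(big_mkord xpredT (fun l => dc (x l) (a%:Z - N%:Z) i)).
    rewrite [X in _ - X](@big_cat_nat _ _ _ a.+1) //=; last by lia.
    have Z : \sum_(a.+1 <= l < m) dc (x l) (a%:Z - N%:Z) i = 0.
      rewrite big_nat_cond big1 // => l.
      by rewrite andbT => /andP[al lm]; apply: (xP l); lia.
    by rewrite Z addr0 subrr.
  by rewrite sub0r big1 ?oppr0 // => l _; apply: (xP l); lia.
- move=> m V Vm V0; have [X Xm XV] := D0_step Vm V0; exists X; split=> //.
    by apply: fil_weak XV; lia.
  by under eq_bigr => i _ do rewrite dcB; rewrite sumrB V0 sum_dc0_D0 subrr.
- by rewrite /G sub0r.
Qed.

End LocalZero.

(** * The regular singularity *)

Section AdMatrix.
Variables (C : fieldType) (n : nat).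
Implicit Types (a x : 'M[C]_n) (c : C).

(** The operator c + ad a: by [cf_Doo], the action at infinity on leading coefficients of degree e,
    with c = -e. *)
Definition adk a c x : 'M[C]_n := a *m x - x *m a + c *: x.

Lemma adk_linear a c : linear (adk a c).
Proof.
move=> b x y; rewrite /adk mulmxDr mulmxDl -!scalemxAr -!scalemxAl.
move: (a *m x) (a *m y) (x *m a) (y *m a) => ax ay xa ya.
by apply/matrixP => i j; rewrite !mxE; ring.
Qed.
HB.instance Definition _ a c :=
  GRing.isLinear.Build C 'M[C]_n 'M[C]_n _ (adk a c) (adk_linear a c).

Lemma nilp_shift_unit a m c : a ^+ m = 0 -> c != 0 -> a + c%:M \in unitmx.
Proof.
move=> am c0; rewrite -row_free_unit -kermx_eq0; apply/eqP.
set v := kermx _; have va : v *m a = (- c) *: v.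
  apply/eqP; rewrite -subr_eq0 scaleNr opprK -mul_mx_scalar -mulmxDr.
  by rewrite mulmx_ker.
have vam k : v *m a ^+ k = (- c) ^+ k *: v.
  elim: k => [|k IH]; first by rewrite !expr0 mulmx1 scale1r.
  by rewrite !exprS [a * _]/(a *m _) mulmxA va -scalemxAl IH scalerA.
have := vam m; rewrite am mulmx0 => /esym/eqP.
by rewrite scaler_eq0 expf_eq0 oppr_eq0 (negbTE c0) andbF => /eqP.
Qed.

(** The equation reads a x = x (a - c), whence a^m x = x (a - c)^m; the left side is 0 and a - c is
    invertible. *)
Lemma adk_inj a m c x : a ^+ m = 0 -> c != 0 -> adk a c x = 0 -> x = 0.
Proof.
move=> am c0 x0; have E : a *m x = x *m (a + (- c)%:M).
  apply/eqP; rewrite mulmxDr mul_mx_scalar scaleNr -subr_eq0 opprB addrA.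
  by rewrite addrAC -/(adk a c x) x0.
have Em k : a ^+ k *m x = x *m (a + (- c)%:M) ^+ k.
  elim: k => [|k IH]; first by rewrite !expr0 mulmx1 mul1mx.
  rewrite exprSr -[_ * a]/(_ *m a) -mulmxA E mulmxA IH -mulmxA.
  by rewrite exprSr.
have := Em m; rewrite am mul0mx => /esym xu.
have u : (a + (- c)%:M) ^+ m \in unitmx.
  have := nilp_shift_unit am (_ : - c != 0); rewrite oppr_eq0 => /(_ c0).
  move: (a + _) => b bu; elim: {am Em xu} m => [|k IH]; first by rewrite expr0 unitmx1.
  by rewrite exprS unitmx_mul bu.
by rewrite -(mulmxK u x) xu mul0mx.
Qed.

Lemma adk_surj a m c y : a ^+ m = 0 -> c != 0 -> exists x, adk a c x = y.
Proof.
move=> am c0; pose f := linfun (adk a c).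
have kf : lker f == 0%VS.
  apply/lker0P => x x'; rewrite /f !lfunE /= => E; apply/eqP; rewrite -subr_eq0.
  by apply/eqP/(adk_inj am c0); rewrite linearB /= E subrr.
have : y \in limg f by rewrite lker0_limgf // memvf.
by case/memv_imgP => x _ ->; exists x; rewrite lfunE.
Qed.

End AdMatrix.

Section LocalInfinity.
Variables (C : numFieldType) (n : nat).
Local Notation laurent := {fraction (pseries C)}.
Local Notation mat := 'M[laurent]_n.
Implicit Types (X Y W : mat) (e k : int).

Definition cf X k : 'M[C]_n := \matrix_(i, j) lc (X i j) k.
Definition ofil e X := forall k, k < e -> cf X k = 0.

Lemma cfD X Y k : cf (X + Y) k = cf X k + cf Y k.
Proof. by apply/matrixP => i j; rewrite !mxE lcD. Qed.
Lemma cfN X k : cf (- X) k = - cf X k.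
Proof. by apply/matrixP => i j; rewrite !mxE lcN. Qed.
Lemma cfB X Y k : cf (X - Y) k = cf X k - cf Y k.
Proof. by rewrite cfD cfN. Qed.
Lemma cf0 k : cf 0 k = 0.
Proof. by apply/matrixP => i j; rewrite !mxE lc0. Qed.
Lemma cf_sum (I : Type) (s : seq I) (P : pred I) (F : I -> mat) k :
  cf (\sum_(x <- s | P x) F x) k = \sum_(x <- s | P x) cf (F x) k.
Proof. by apply: (big_morph (cf^~ k)) => [X Y|]; rewrite ?cfD ?cf0. Qed.

Lemma cf_inj X Y : (forall k, cf X k = cf Y k) -> X = Y.
Proof.
move=> XY; apply/matrixP => i j; apply: lc_inj => k.
by have := XY k => /matrixP/(_ i j); rewrite !mxE.
Qed.

Lemma lc_cf X k i j : lc (X i j) k = cf X k i j.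
Proof. by rewrite mxE. Qed.

Lemma ofil_bound X : exists N : nat, ofil (- N%:Z) X.
Proof.
pose b i j := projT1 (cid (lc_bound (X i j))).
have bP i j k : k < - (b i j)%:Z -> lc (X i j) k = 0 by rewrite /b; case: cid => ?; apply.
exists (\sum_i \sum_j b i j)%N => k kB; apply/matrixP => i j; rewrite !mxE bP //.
apply: lt_le_trans kB _; rewrite lerN2 lez_nat (bigD1 i) //= (bigD1 j) //= -addnA.
by rewrite leq_addr.
Qed.

Lemma lcM_ord (x y : laurent) e : (forall k, k < 0 -> lc x k = 0) ->
  (forall k, k < e -> lc y k = 0) ->
  (forall k, k < e -> lc (x * y) k = 0) /\ lc (x * y) e = lc x 0 * lc y e.
Proof.
move=> x0 ye; pose y' := lvar C ^ (- e) * y.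
have y'0 k : k < 0 -> lc y' k = 0 by move=> k0; rewrite lcXz ye // opprK; lia.
have yE : y = lvar C ^ e * y'.
  by rewrite mulrA -expfzDr ?lvar_neq0 // subrr expr0z mul1r.
clearbody y'; rewrite yE mulrCA; split=> [k ke|]; first by rewrite lcXz lcM_lt0 // subr_lt0.
by rewrite !lcXz subrr lcM_0.
Qed.

Lemma lc_ofil e X i j k : ofil e X -> k < e -> lc (X i j) k = 0.
Proof. by move=> Xe ke; rewrite lc_cf Xe // mxE. Qed.

Lemma ofilMl A X e : ofil 0 A -> ofil e X -> ofil e (A *m X).
Proof.
move=> A0 Xe k ke; apply/matrixP => i j; rewrite !mxE lc_sum big1 // => l _.
have [H _] := @lcM_ord (A i l) (X l j) e (fun k => @lc_ofil _ _ i l k A0)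
  (fun k => @lc_ofil _ _ l j k Xe).
exact: H.
Qed.

Lemma cfMl A X e : ofil 0 A -> ofil e X -> cf (A *m X) e = cf A 0 *m cf X e.
Proof.
move=> A0 Xe; apply/matrixP => i j; rewrite !mxE lc_sum; apply: eq_bigr => l _.
have [_ H] := @lcM_ord (A i l) (X l j) e (fun k => @lc_ofil _ _ i l k A0)
  (fun k => @lc_ofil _ _ l j k Xe).
by rewrite H !mxE.
Qed.

Lemma ofilMr A X e : ofil 0 A -> ofil e X -> ofil e (X *m A).
Proof.
move=> A0 Xe k ke; apply/matrixP => i j; rewrite !mxE lc_sum big1 // => l _.
have [H _] := @lcM_ord (A l j) (X i l) e (fun k => @lc_ofil _ _ l j k A0)
  (fun k => @lc_ofil _ _ i l k Xe).
by rewrite mulrC; apply: H.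
Qed.

Lemma cfMr A X e : ofil 0 A -> ofil e X -> cf (X *m A) e = cf X e *m cf A 0.
Proof.
move=> A0 Xe; apply/matrixP => i j; rewrite !mxE lc_sum; apply: eq_bigr => l _.
have [_ H] := @lcM_ord (A l j) (X i l) e (fun k => @lc_ofil _ _ l j k A0)
  (fun k => @lc_ofil _ _ i l k Xe).
by rewrite mulrC H !mxE mulrC.
Qed.

Lemma cf_leuloo X k : cf (map_mx (@leuloo C) X) k = (- k%:~R) *: cf X k.
Proof. by apply/matrixP => i j; rewrite !mxE lc_leuloo. Qed.

Variables (A : mat) (m0 : nat).
Hypotheses (A0 : ofil 0 A).
Hypothesis (nilp : cf A 0 ^+ m0 = 0).
Local Notation D := (Doo A).

Lemma ofil_Doo e X : ofil e X -> ofil e (D X).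
Proof.
move=> Xe k ke; rewrite DooE cfD cfB cf_leuloo Xe // scaler0.
by rewrite (ofilMl A0 Xe) // (ofilMr A0 Xe) // subrr addr0.
Qed.

Lemma cf_Doo e X : ofil e X -> cf (D X) e = adk (cf A 0) (- e%:~R) (cf X e).
Proof.
by move=> Xe; rewrite DooE cfD cfB cf_leuloo cfMl // cfMr // addrC.
Qed.

(** The leading coefficient of a pole would be killed by [adk] with a nonzero constant, against
    [adk_inj]. *)
Lemma ofil_Doo_up X : ofil 0 (D X) -> ofil 0 X.
Proof.
move=> DX; have [N XN] := ofil_bound X.
suff H m : (m <= N)%N -> ofil (m%:Z - N%:Z) X by rewrite -(subrr N%:Z); apply: H.
elim: m => [|m IH] mN; first by rewrite sub0r.
have Xm := IH (ltnW mN); move=> k; have [|km km1|-> _] := ltgtP k (m%:Z - N%:Z).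
- by move=> km _; apply: Xm.
- by exfalso; lia.
apply: (adk_inj (c := - (m%:Z - N%:Z)%:~R) nilp); last by rewrite -cf_Doo // DX //; lia.
by rewrite oppr_eq0 intr_eq0; apply/eqP; lia.
Qed.

Lemma monomial_mx (x : 'M[C]_n) e :
  exists2 X, ofil e X & cf X e = x /\ forall k, k != e -> cf X k = 0.
Proof.
exists (\matrix_(i, j) (lconst (x i j) * lvar C ^ e)) => [k ke|].
  by apply/matrixP => i j; rewrite !mxE lcZ lc_lvarXz lt_eqF // mulr0.
split=> [|k /negbTE ke]; apply/matrixP => i j.
  by rewrite !mxE lcZ lc_lvarXz eqxx mulr1.
by rewrite !mxE lcZ lc_lvarXz ke mulr0.
Qed.

Lemma ofilS e X : ofil e X -> cf X e = 0 -> ofil (e + 1) X.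
Proof. by move=> Xe X0 k; rewrite ltzD1 le_eqVlt => /orP[/eqP -> //|]; apply: Xe. Qed.

Lemma Doo_surj W : ofil 0 W -> (exists x, cf W 0 = adk (cf A 0) 0 x) ->
  exists2 X, ofil 0 X & D X = W.
Proof.
pose F (m : nat) X := ofil m%:Z X.
apply: (@solve_by_approximation _ _ F F
  (fun W => exists x, cf W 0 = adk (cf A 0) 0 x) D 0) => //.
- by move=> m X; rewrite addn0; apply: ofil_Doo.
- by move=> m X Y Xm Ym k km; rewrite cfB Xm // Ym // subrr.
- by move=> m X Xm k km; apply: Xm; lia.
- by move=> X XP; apply: cf_inj => k; rewrite cf0 (XP `|(k + 1)%R|%N) //; lia.
- move=> x xP.
  have xlc (l : nat) i j k : k < l%:Z -> lc (x l i j) k = 0.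
    by move=> kl; rewrite lc_cf (xP l) // mxE.
  pose s i j := projT1 (cid (laurent_of 0 (fun m => \sum_(l < m.+1) lc (x l i j) m%:Z))).
  exists (\matrix_(i, j) s i j) => m k km; rewrite cfB cf_sum; apply/matrixP => i j.
  rewrite !mxE summxE /s; case: cid => y /= yP; rewrite yP subr0.
  under eq_bigr => l _ do rewrite mxE.
  case: k km => [k|k] km; last first.
    by rewrite sub0r big1 ?oppr0 // => l _; apply: xlc.
  rewrite -(big_mkord xpredT (fun l => lc (x l i j) k)).
  rewrite -(big_mkord xpredT (fun l => lc (x l i j) k)).
  rewrite [X in _ - X](@big_cat_nat _ _ _ k.+1) //=.
  have -> : \sum_(k.+1 <= l < m) lc (x l i j) k = 0.
    rewrite big_nat_cond big1 // => l.
    by rewrite andbT => /andP[al lm]; apply: xlc; lia.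
  by rewrite addr0 subrr.
- move=> m V Vm [v vP].
  (* Only degree 0 is obstructed, and there the condition on the value supplies y. *)
  have [y yP] : exists y, adk (cf A 0) (- m%:~R) y = cf V m.
    case: m Vm => [|m] Vm; first by exists v; rewrite oppr0 vP.
    by apply: adk_surj nilp _; rewrite oppr_eq0 intr_eq0.
  have [X Xm [Xy _]] := monomial_mx y m; exists X; split=> //.
    rewrite -addn1 /F PoszD; apply: ofilS => [k km|].
      by rewrite cfB (Vm k) // (@ofil_Doo m%:Z X Xm k) // subrr.
    by rewrite cfB cf_Doo // Xy yP subrr.
  case: m Vm Xm Xy yP => [|m] Vm Xm Xy yP.
    by exists 0; rewrite cfB cf_Doo // Xy yP subrr linear0.
  exists v; rewrite cfB vP (_ : cf (D X) 0 = 0) ?subr0 //.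
  exact: (@ofil_Doo m.+1%:Z X Xm 0).
Qed.

End LocalInfinity.

(** * The rigidity criterion *)

Section LinearAlgebra.
Variables (K : fieldType) (V P Q U : vectType K).
Variables (L : {vspace V}) (psi rho : 'Hom(V, P)) (kap : 'Hom(V, Q)).
Let T := (L :&: lker psi)%VS.

(* In the application [rho] reads the [r] lowest degrees of [X], [psi] the [r]
   lowest degrees of [D X], and [kap] one coefficient in each degree read by
   [rho]. *)
Lemma dim_window :
  (rho @: L = fullv)%VS ->
  (forall x, x \in L -> rho x = 0 -> psi x = 0 /\ kap x = 0) ->
  (forall x, x \in T -> kap x = 0 -> rho x = 0) ->
  (kap @: T = fullv)%VS ->
  (\dim T + \dim {:P} = \dim L + \dim {:Q})%N.
Proof.
move=> rhoL rho0 kap0 kapT.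
(* Rank-nullity for rho on L and for kap on T can be compared because the two kernels coincide. *)
have KE : (L :&: lker rho = T :&: lker kap)%VS.
  apply/vspaceP => x; rewrite !memv_cap !memv_ker; apply/idP/idP.
    move=> /andP[xL /eqP x0]; have [-> ->] := rho0 x xL x0.
    by rewrite xL !eqxx.
  move=> /andP[/andP[xL x1] /eqP x2]; rewrite xL /=; apply/eqP/kap0 => //.
  by rewrite memv_cap xL memv_ker.
rewrite -(limg_ker_dim rho L) -(limg_ker_dim kap T) rhoL kapT KE.
by rewrite addnAC.
Qed.

Variables (ev : 'Hom(V, U)) (g : 'End(U)) (S : {vspace V}).

(** The codimension of S in L is that of the image of g, which for an endomorphism is the dimension
    of its kernel. [pi] is a projection with kernel [limg g]. *)
Lemma dim_preim_limg : (ev @: L = fullv)%VS ->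
  (forall x, x \in S = (x \in L) && (ev x \in limg g)) ->
  (\dim S + \dim (lker g) = \dim L)%N.
Proof.
move=> evL SE; pose pi : 'End(U) := (\1 - projv (limg g))%VF.
have piE x : (pi x == 0) = (x \in limg g).
  rewrite /pi add_lfunE opp_lfunE id_lfunE subr_eq0; apply/eqP/idP => [->|xg].
    exact: memv_proj.
  by rewrite projv_id.
have -> : S = (L :&: lker (pi \o ev)%VF)%VS.
  by apply/vspaceP => x; rewrite SE memv_cap memv_ker lfunE /= piE.
rewrite -[in RHS](limg_ker_dim (pi \o ev)%VF L); congr (_ + _)%N.
rewrite limg_comp evL; apply/eqP; rewrite -(eqn_add2l (\dim (limg g))).
have := limg_ker_dim g fullv; rewrite capfv => E; rewrite addnC E.
have := limg_ker_dim pi fullv; rewrite capfv => <-.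
rewrite eqn_add2r eq_sym; apply/eqP; congr (\dim _); apply/vspaceP => x.
by rewrite memv_ker piE.
Qed.

(** The inclusion of the image in S being known, the reverse one is a comparison of dim R - 1 = dim
    L + q - p - 1 with dim S = dim L - z. *)
Lemma limg_eq_dim (del : 'End(V)) (R : {vspace V}) (p q z : nat) :
  (\dim R + p = \dim L + q)%N -> (\dim S + z = \dim L)%N ->
  \dim (R :&: lker del)%VS = 1%N -> (del @: R <= S)%VS ->
  (S <= del @: R)%VS = (p + 1 <= q + z)%N.
Proof.
move=> Rd Sd kd RS; have := limg_ker_dim del R; rewrite kd => dd.
apply/idP/idP => [/dimvS|pq]; first by lia.
have /eqP -> // : (del @: R)%VS == S by rewrite eqEdim RS; lia.
Qed.

End LinearAlgebra.

Section Sealed.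
Variable C : numClosedFieldType.
Local Notation ratfun := {fraction {poly C}}.
Local Notation laurent := {fraction (pseries C)}.
Implicit Types f g : ratfun.

Definition ex0 : ratfun -> laurent := locked (@expand0 C).
Definition exoo : ratfun -> laurent := locked (@expandoo C).
Definition reul : ratfun -> ratfun := locked (@euler C).
Lemma ex0E : @expand0 C = ex0. Proof. by rewrite /ex0 -lock. Qed.
Lemma exooE : @expandoo C = exoo. Proof. by rewrite /exoo -lock. Qed.
Lemma reulE : @euler C = reul. Proof. by rewrite /reul -lock. Qed.

Lemma ex0_zmod : zmod_morphism ex0. Proof. rewrite -ex0E; exact: expand0_zmod. Qed.
Lemma ex0_monoid : monoid_morphism ex0. Proof. rewrite -ex0E; exact: expand0_monoid. Qed.
HB.instance Definition _ := GRing.isZmodMorphism.Build _ _ ex0 ex0_zmod.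
HB.instance Definition _ := GRing.isMonoidMorphism.Build _ _ ex0 ex0_monoid.
Lemma exoo_zmod : zmod_morphism exoo. Proof. rewrite -exooE; exact: expandoo_zmod. Qed.
Lemma exoo_monoid : monoid_morphism exoo. Proof. rewrite -exooE; exact: expandoo_monoid. Qed.
HB.instance Definition _ := GRing.isZmodMorphism.Build _ _ exoo exoo_zmod.
HB.instance Definition _ := GRing.isMonoidMorphism.Build _ _ exoo exoo_monoid.

Lemma ex0_const c : ex0 (rconst c) = lconst c.
Proof. by rewrite -ex0E expand0_const. Qed.
Lemma exoo_const c : exoo (rconst c) = lconst c.
Proof. by rewrite -exooE expandoo_const. Qed.
Lemma ex0_varXz (k : int) : ex0 (rvar C ^ k) = lvar C ^ k.
Proof. by rewrite -ex0E expand0_varXz. Qed.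
Lemma ex0_inj : injective ex0.
Proof. by rewrite -ex0E; apply: expand0_inj. Qed.
Lemma lc_exoo f k : regular_on_Gm f -> lc (exoo f) k = lc (ex0 f) (- k).
Proof. by rewrite -exooE -ex0E; apply: lc_expandoo. Qed.
Lemma ex0_reul f : regular_on_Gm f -> ex0 (reul f) = leul (ex0 f).
Proof. by rewrite -ex0E -reulE -leulE; apply: expand0_euler. Qed.
Lemma exoo_reul f : regular_on_Gm f -> exoo (reul f) = leuloo (exoo f).
Proof. by rewrite -exooE -reulE -leulooE; apply: expandoo_euler. Qed.
Lemma regular_reul f : regular_on_Gm f -> regular_on_Gm (reul f).
Proof. by rewrite -reulE; apply: regular_euler. Qed.

Section Matrices.
Variable n : nat.
Implicit Types X Y : 'M[ratfun]_n.
Local Notation e0 := (map_mx ex0).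
Local Notation eoo := (map_mx exoo).

Lemma regular_mxD X Y : regular_mx_on_Gm X -> regular_mx_on_Gm Y -> regular_mx_on_Gm (X + Y).
Proof. by move=> Xr Yr i j; rewrite mxE; apply: regularD. Qed.
Lemma regular_mxN X : regular_mx_on_Gm X -> regular_mx_on_Gm (- X).
Proof. by move=> Xr i j; rewrite mxE; apply: regularN. Qed.
Lemma regular_mxM X Y : regular_mx_on_Gm X -> regular_mx_on_Gm Y -> regular_mx_on_Gm (X *m Y).
Proof. by move=> Xr Yr i j; rewrite mxE; apply: regular_sum => l _; apply: regularM; [apply: Xr|apply: Yr]. Qed.
Lemma regular_mx_const (x : 'M[C]_n) : regular_mx_on_Gm (map_mx (@rconst C) x).
Proof. by move=> i j; rewrite mxE; apply: regular_const. Qed.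
Lemma regular_ad A X : regular_mx_on_Gm A -> regular_mx_on_Gm X ->
  regular_mx_on_Gm (ad_conn reul A X).
Proof.
move=> Ar Xr; apply: regular_mxD; first by move=> i j; rewrite mxE; apply/regular_reul/Xr.
by apply: regular_mxD; [|apply: regular_mxN]; apply: regular_mxM.
Qed.

Lemma cf_eoo X k : regular_mx_on_Gm X -> cf (eoo X) k = cf (e0 X) (- k).
Proof. by move=> Xr; apply/matrixP => i j; rewrite !mxE lc_exoo. Qed.

Lemma e0D X Y : e0 (X + Y) = e0 X + e0 Y. Proof. exact: map_mxD. Qed.
Lemma e0M X Y : e0 (X *m Y) = e0 X *m e0 Y. Proof. exact: map_mxM. Qed.
Lemma eooD X Y : eoo (X + Y) = eoo X + eoo Y. Proof. exact: map_mxD. Qed.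
Lemma eooN X : eoo (- X) = - eoo X. Proof. exact: map_mxN. Qed.

Lemma e0_ad A X : regular_mx_on_Gm X ->
  e0 (ad_conn reul A X) = D0 (e0 A) (e0 X).
Proof.
move=> Xr; rewrite D0E /ad_conn map_mxD map_mxB !map_mxM; congr (_ + _).
by apply/matrixP => i j; rewrite !mxE /= ex0_reul //; apply: Xr.
Qed.

Lemma eoo_ad A X : regular_mx_on_Gm X ->
  eoo (ad_conn reul A X) = Doo (eoo A) (eoo X).
Proof.
move=> Xr; rewrite DooE /ad_conn map_mxD map_mxB !map_mxM; congr (_ + _).
by apply/matrixP => i j; rewrite !mxE /= exoo_reul //; apply: Xr.
Qed.

Lemma e0_inj X Y : e0 X = e0 Y -> X = Y.
Proof.
move=> /matrixP XY; apply/matrixP => i j; apply: ex0_inj.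
by have := XY i j; rewrite !mxE.
Qed.

Lemma adB A X Y : regular_mx_on_Gm X -> regular_mx_on_Gm Y ->
  ad_conn reul A (X + Y) = ad_conn reul A X + ad_conn reul A Y.
Proof.
move=> Xr Yr; have E1 := e0_ad A (regular_mxD Xr Yr).
have E2 : D0 (e0 A) (e0 (X + Y)) = D0 (e0 A) (e0 X) + D0 (e0 A) (e0 Y) :=
  etrans (congr1 (D0 (e0 A)) (e0D X Y)) (raddfD (D0 (e0 A)) (e0 X) (e0 Y)).
have E3 : e0 (ad_conn reul A X + ad_conn reul A Y) = _ :=
  etrans (e0D (ad_conn reul A X) (ad_conn reul A Y))
    (congr2 +%R (e0_ad A Xr) (e0_ad A Yr)).
exact: e0_inj (etrans E1 (etrans E2 (esym E3))).
Qed.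

Definition monomx (x : 'M[C]_n) (k : int) : 'M[ratfun]_n :=
  \matrix_(i, j) (rconst (x i j) * rvar C ^ k).

Lemma regular_monomx x k : regular_mx_on_Gm (monomx x k).
Proof. by move=> i j; rewrite mxE; apply: regularM; [apply: regular_const|apply: regular_varXz]. Qed.

Lemma cf_e0_monomx x k l : cf (e0 (monomx x k)) l = if l == k then x else 0.
Proof.
apply/matrixP => i j; rewrite !mxE rmorphM /= ex0_const ex0_varXz lcZ lc_lvarXz.
by case: eqP; rewrite ?mulr1 // mulr0 mxE.
Qed.

End Matrices.
End Sealed.

Section CoefDegree.
Variables (C : numFieldType) (n : nat).
Local Notation laurent := {fraction (pseries C)}.
Local Notation mat := 'M[laurent]_n.+1.
Implicit Types X Y : mat.

Lemma cfZ c X k : cf (lconst c *: X) k = c *: cf X k.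
Proof. by apply/matrixP => i j; rewrite !mxE lcZ. Qed.

Lemma dc_cf X d i : dc X d i = cf X (qt i d) i (sh i d).
Proof. by rewrite mxE. Qed.

Lemma cf_dc X k i j : cf X k i j = dc X (n.+1%:Z * k + j%:Z - i%:Z) i.
Proof. by rewrite mxE dcP. Qed.

(** The entries of the coefficient of z^k have degrees within n of [n.+1] k; this and [cf_fil]
    translate between the two gradings. *)
Lemma fil_cf s X : (forall k, n.+1%:Z * k < s + n%:Z -> cf X k = 0) -> fil s X.
Proof.
move=> X0 d i ds; rewrite dc_cf X0 ?mxE //.
by have := degE i d; have := ltn_ord i; lia.
Qed.

Lemma cf_fil s X k : fil s X -> n.+1%:Z * k + n%:Z < s -> cf X k = 0.
Proof.
move=> Xs ks; apply/matrixP => i j; rewrite cf_dc mxE; apply: Xs.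
by have := ltn_ord j; lia.
Qed.

Lemma fil1_cf X : (forall k, k <= 0 -> cf X k = 0) -> fil 1 X.
Proof.
move=> X0; apply: fil_cf => k kn; apply: X0; have [//|k0] := leP k 0.
by have : n.+1%:Z * 1 <= n.+1%:Z * k; [rewrite ler_pM2l|lia].
Qed.

End CoefDegree.

(** * The dimension count in a window of bounded degree *)

Section Global.
Variables (C : numClosedFieldType) (n r : nat).
Local Notation ratfun := {fraction {poly C}}.
Local Notation laurent := {fraction (pseries C)}.
Local Notation rmat := 'M[ratfun]_n.+1.
Local Notation mat := 'M[laurent]_n.+1.
Local Notation e0 := (map_mx (@ex0 C)).
Local Notation eoo := (map_mx (@exoo C)).

Variables (A : rmat) (c : C) (u : int -> mat) (m0 : nat).
Hypotheses (r_gt0 : (0 < r)%N) (rn : coprime r n.+1) (c0 : c != 0).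
Hypothesis Ar : regular_mx_on_Gm A.
Hypotheses (fil_B : fil (- r%:Z) (e0 A)) (dc_B : forall i, dc (e0 A) (- r%:Z) i = c).
Hypotheses (fil_u : forall d, fil d (u d)) (dc_u : forall d i, dc (u d) d i = 1).
Hypothesis (comm_u : forall d, fil (d + 1) (e0 A *m u d - u d *m e0 A)).
Hypothesis Boo : ofil 0 (eoo A).
Let N := cf (eoo A) 0.
Hypothesis nilp : N ^+ m0 = 0.

Local Notation D := (D0 (e0 A)).
Local Notation RD := (ad_conn (@reul C) A).

Section Window.
Variable q : nat.
Hypothesis rq : (r <= q)%N.
(** [- M] is the Iwahori degree of the scalar matrix z^-q. As r <= q, the r degrees starting at
    [- M] are negative, and truncation to polynomials in 1/z does not affect them. *)
Let M : int := n.+1%:Z * q%:Z.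
Local Notation V := {ffun 'I_q.+1 -> 'M[C]_n.+1}.
Local Notation P := 'M[C]_(r, n.+1).
Local Notation Q := 'cV[C]_r.

Implicit Types (v w : V) (X Y Z : mat) (k d : int).

Let qM : q%:Z <= M.
Proof. by rewrite ler_peMl. Qed.

Definition emb (v : V) : rmat := \sum_t monomx (v t) (t%:Z - q%:Z).
Definition iota (v : V) : mat := e0 (emb v).
Definition trunc (Z : mat) : V := [ffun t : 'I_q.+1 => cf Z (t%:Z - q%:Z)].

Lemma regular_emb v : regular_mx_on_Gm (emb v).
Proof.
move=> i j; rewrite summxE; apply: regular_sum => t _; exact: regular_monomx.
Qed.

Lemma cf_iota v k : cf (iota v) k = \sum_(t < q.+1) (if k == t%:Z - q%:Z then v t else 0).
Proof.
rewrite /iota raddf_sum /= cf_sum; apply: eq_bigr => t _; exact: cf_e0_monomx.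
Qed.

Lemma cf_iota_t v (t : 'I_q.+1) : cf (iota v) (t%:Z - q%:Z) = v t.
Proof.
rewrite cf_iota (bigD1 t) //= eqxx big1 ?addr0 // => s st.
by case: eqP => // /addIr [] ts; case/eqP: st; apply: val_inj.
Qed.

Lemma cf_iota_out v k : (k < - q%:Z) || (0 < k) -> cf (iota v) k = 0.
Proof.
move=> kq; rewrite cf_iota big1 // => t _; case: eqP => // E.
by have := ltn_ord t; move: kq; rewrite E; lia.
Qed.

Lemma int_window k : - q%:Z <= k -> k <= 0 -> exists t : 'I_q.+1, k = t%:Z - q%:Z.
Proof.
move=> k1 k2; have tq : (`|(k + q%:Z)%R|%N < q.+1)%N by lia.
by exists (Ordinal tq) => /=; lia.
Qed.

Lemma iota_lin a v w : iota (a *: v + w) = lconst a *: iota v + iota w.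
Proof.
apply: cf_inj => k; rewrite cfD cfZ !cf_iota scaler_sumr -big_split /=.
apply: eq_bigr => t _; rewrite !ffunE; case: eqP => //=.
by rewrite scaler0 addr0.
Qed.

Lemma trunc_lin a X Y : trunc (lconst a *: X + Y) = a *: trunc X + trunc Y.
Proof. by apply/ffunP => t; rewrite !ffunE cfD cfZ. Qed.

Lemma D_lin a X Y : D (lconst a *: X + Y) = lconst a *: D X + D Y.
Proof. by rewrite -D0Z; exact: (raddfD (D0 (e0 A))). Qed.

Lemma iotaK v : trunc (iota v) = v.
Proof. by apply/ffunP => t; rewrite ffunE cf_iota_t. Qed.

Lemma cf_trunc_diff Z k : - q%:Z <= k -> k <= 0 -> cf (iota (trunc Z)) k = cf Z k.
Proof. by move=> k1 k2; have [t ->] := int_window k1 k2; rewrite cf_iota_t ffunE. Qed.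

Lemma cf_low Z k : fil (- M) Z -> k < - q%:Z -> cf Z k = 0.
Proof.
move=> ZM kq; apply: (cf_fil ZM).
have : n.+1%:Z * (k + 1) <= n.+1%:Z * (- q%:Z) by rewrite ler_pM2l //; lia.
by rewrite /M; lia.
Qed.

Lemma truncK Z : fil (- M) Z -> (forall k, 0 < k -> cf Z k = 0) -> iota (trunc Z) = Z.
Proof.
move=> ZM Z0; apply: cf_inj => k; have [k1|k1] := ltP k (- q%:Z).
  by rewrite cf_iota_out ?k1 // (cf_low ZM).
have [k2|k2] := leP k 0; first exact: cf_trunc_diff.
by rewrite cf_iota_out ?k2 ?orbT // Z0.
Qed.

Lemma trunc_fil Z : fil (- M) Z -> fil 1 (iota (trunc Z) - Z).
Proof.
move=> ZM; apply: fil1_cf => k k0; rewrite cfB; have [k1|k1] := ltP k (- q%:Z).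
  by rewrite cf_iota_out ?k1 // (cf_low ZM) // subrr.
by rewrite cf_trunc_diff // subrr.
Qed.

Lemma dc_trunc Z d i : fil (- M) Z -> d < 1 -> dc (iota (trunc Z)) d i = dc Z d i.
Proof. by move=> ZM d1; apply/eqP; rewrite -subr_eq0 -dcB (trunc_fil ZM). Qed.

Lemma fil_trunc Z : fil (- M) Z -> fil (- M) (iota (trunc Z)).
Proof.
move=> ZM; rewrite -[iota _](subrK Z); apply: filD => //.
by apply: (fil_weak _ (trunc_fil ZM)); rewrite /M; lia.
Qed.

(** The entries strictly below the diagonal in the coefficient of z^-q are the only ones of degree
    less than [- M]. *)
Definition lower (v : V) : 'M[C]_n.+1 :=
  \matrix_(i, j) (if (j < i)%N then v ord0 i j else 0).
Definition wpsi (v : V) : P :=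
  \matrix_(t, i) dc (D (iota v)) (- M - r%:Z + t%:Z) i.
Definition wrho (v : V) : P := \matrix_(t, i) dc (iota v) (- M + t%:Z) i.
Definition wkap (v : V) : Q := \col_t dc (iota v) (- M + t%:Z) ord0.
Definition wdel (v : V) : V := trunc (D (iota v)).
Definition wev (v : V) : 'M[C]_n.+1 := v ord_max.

Lemma lower_lin : linear lower.
Proof.
move=> a v w; apply/matrixP => i j; rewrite !mxE !ffunE !mxE.
by case: ifP => // _; rewrite mulr0 addr0.
Qed.
Lemma wpsi_lin : linear wpsi.
Proof.
by move=> a v w; apply/matrixP => t i; rewrite !mxE iota_lin D_lin dcD dcZ.
Qed.
Lemma wrho_lin : linear wrho.
Proof. by move=> a v w; apply/matrixP => t i; rewrite !mxE iota_lin dcD dcZ. Qed.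
Lemma wkap_lin : linear wkap.
Proof. by move=> a v w; apply/matrixP => t i; rewrite !mxE iota_lin dcD dcZ. Qed.
Lemma wdel_lin : linear wdel.
Proof. by move=> a v w; rewrite /wdel iota_lin D_lin trunc_lin. Qed.
Lemma wev_lin : linear wev.
Proof. by move=> a v w; rewrite /wev !ffunE. Qed.

HB.instance Definition _ := GRing.isLinear.Build C V 'M[C]_n.+1 _ lower lower_lin.
HB.instance Definition _ := GRing.isLinear.Build C V P _ wpsi wpsi_lin.
HB.instance Definition _ := GRing.isLinear.Build C V P _ wrho wrho_lin.
HB.instance Definition _ := GRing.isLinear.Build C V Q _ wkap wkap_lin.
HB.instance Definition _ := GRing.isLinear.Build C V V _ wdel wdel_lin.
HB.instance Definition _ := GRing.isLinear.Build C V 'M[C]_n.+1 _ wev wev_lin.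

(* [L] consists of the polynomials in [z^-1] lying in [fil (- M)], and [T] is the
   part of [L] that [D] maps to [L]. *)
Let L : {vspace V} := lker (linfun lower).
Let T : {vspace V} := (L :&: lker (linfun wpsi))%VS.

Lemma mem_L v : (v \in L) <-> fil (- M) (iota v).
Proof.
rewrite memv_ker lfunE /=; split=> [/eqP/matrixP v0 d i dM|vM].
  rewrite dc_cf; have E := degE i d; have := ltn_ord (sh i d); have := ltn_ord i.
  have [k1|k1|k1] := ltgtP (qt i d) (- q%:Z).
  - by rewrite cf_iota_out ?k1 // mxE.
  - have : n.+1%:Z * (- q%:Z + 1) <= n.+1%:Z * qt i d by rewrite ler_pM2l //; lia.
    by move: dM; rewrite /M; lia.
  move=> _ _; have := v0 i (sh i d); rewrite mxE [RHS]mxE.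
  have -> : (sh i d < i)%N by move: E dM; rewrite k1 /M; lia.
  by rewrite k1 -cf_iota_t /= sub0r.
apply/eqP/matrixP => i j; rewrite !mxE; case: ifP => // ji.
rewrite -cf_iota_t cf_dc; apply: vM; rewrite /M /=; lia.
Qed.

Lemma fil_DM v : v \in L -> fil (- M - r%:Z) (D (iota v)).
Proof. by move=> /mem_L vM; apply: (fil_D0 r_gt0 rn c0 fil_B vM). Qed.

Lemma mem_T v : (v \in T) <-> fil (- M) (iota v) /\ fil (- M) (D (iota v)).
Proof.
rewrite memv_cap; split=> [/andP[vL]|[vM DM]].
  have vM := (mem_L v).1 vL; have DM := fil_DM vL.
  rewrite memv_ker lfunE /= => /eqP/matrixP p0; split=> // d i dM.
  have [d1|d1] := ltP d (- M - r%:Z); first exact: DM.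
  have tr : (`|(d + M + r%:Z)%R|%N < r)%N by lia.
  have := p0 (Ordinal tr) i; rewrite !mxE /= => <-; congr dc; lia.
apply/andP; split; first exact/mem_L.
rewrite memv_ker lfunE /=; apply/eqP/matrixP => t i; rewrite !mxE DM //.
by have := ltn_ord t; lia.
Qed.

Lemma wrho_surj : (linfun wrho @: L = fullv)%VS.
Proof.
apply/vspaceP => y; rewrite memvf; apply/memv_imgP.
pose y' m i : C := if insub m is Some t then y t i else 0.
have [Z ZP] := mx_of_dc (- M) y'.
have ZM : fil (- M) Z.
  by move=> d i dM; rewrite ZP; case E: (_ - _) => [m|//]; move: dM; lia.
exists (trunc Z); first exact/mem_L/fil_trunc.
rewrite lfunE /=; apply/matrixP => t i; rewrite mxE dc_trunc //.
  rewrite ZP (_ : _ - _ = t%:Z); last by lia.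
  by rewrite /y' valK.
by have := ltn_ord t; rewrite /M; move: qM rq; rewrite /M; lia.
Qed.

Lemma wrho_ker v : v \in L -> linfun wrho v = 0 -> linfun wpsi v = 0 /\ linfun wkap v = 0.
Proof.
move=> vL; have vM := (mem_L v).1 vL; rewrite !lfunE /= => /matrixP r0; split.
  have vr : fil (- M + r%:Z) (iota v).
    move=> d i dM; have [d1|d1] := ltP d (- M); first exact: vM.
    have tr : (`|(d + M)%R|%N < r)%N by lia.
    have := r0 (Ordinal tr) i; rewrite !mxE /= => <-; congr dc; lia.
  have DM := fil_D0 r_gt0 rn c0 fil_B vr; apply/matrixP => t i; rewrite !mxE DM //.
  by have := ltn_ord t; lia.
by apply/colP => t; have := r0 t ord0; rewrite !mxE.
Qed.

(** For v in T, [peel] makes the leading coefficients equal in all rows, so row 0 decides; this is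
    repeated through the r lowest degrees. *)
Lemma wkap_ker v : v \in T -> linfun wkap v = 0 -> linfun wrho v = 0.
Proof.
move=> /mem_T[vM DM]; rewrite !lfunE /= => /colP k0.
suff H m : (m <= r)%N -> fil (- M + m%:Z) (iota v).
  apply/matrixP => t i; rewrite !mxE (H r) //.
  by have := ltn_ord t; lia.
elim: m => [|m IH] mr; first by rewrite addr0.
have vm := IH (ltnW mr).
have [i|a [_ va]] := peel r_gt0 rn c0 fil_B dc_B fil_u dc_u vm.
  by apply: DM; lia.
rewrite -addn1 PoszD addrA; apply: filS => // i; rewrite va.
by have := k0 (Ordinal mr); rewrite !mxE /= va.
Qed.

(** Truncated multiples of the [u d] do it: they are triangular with respect to degree, so the
    entries of the target are matched from the lowest degree upwards. *)
Lemma wkap_surj : (linfun wkap @: T = fullv)%VS.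
Proof.
apply/vspaceP => y; rewrite memvf; apply/memv_imgP.
suff H m : (m <= r)%N -> forall y : Q, (forall t : 'I_r, (t < r - m)%N -> y t ord0 = 0) ->
    exists2 x, x \in T & y = linfun wkap x.
  by apply: (H r) => // t; rewrite subnn.
elim: m => [|m IH] mr y' y0.
  exists 0; first exact: mem0v.
  by rewrite linear0; apply/colP => t; rewrite mxE y0 // subn0.
have tr : (r - m.+1 < r)%N by lia.
pose t0 := Ordinal tr; pose d := - M + t0%:Z.
pose Z := lconst (y' t0 ord0) *: u d.
have dM : - M <= d by rewrite /d; lia.
have ZM : fil (- M) Z by apply: filZ; apply: (fil_weak dM); apply: fil_u.
(* Truncating Z changes it by an element of [fil 1], whose image under D lies in [fil (1 - r)],
   hence still in [fil (- M)]. *)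
have M1 : - M <= 1 - r%:Z by have := qM; have := rq; lia.
have xT : trunc Z \in T.
  apply/mem_T; split; first exact: fil_trunc.
  have -> : iota (trunc Z) = lconst 1 *: (iota (trunc Z) - Z) + Z.
    by rewrite rmorph1 scale1r subrK.
  rewrite D_lin; apply: filD.
    by apply: filZ; apply: (fil_weak M1); apply: (fil_D0 r_gt0 rn c0 fil_B); apply: trunc_fil.
  rewrite D0Z; apply: filZ; apply: (fil_weak dM).
  exact: (fil_D0u r_gt0 rn c0 fil_u comm_u).
have kx t : linfun wkap (trunc Z) t ord0 = dc Z (- M + t%:Z) ord0.
  rewrite lfunE /= mxE dc_trunc //.
  by have := ltn_ord t; have := qM; have := rq; lia.
have [|t tm|x xT' Ex] := IH _ (y' - linfun wkap (trunc Z)); first by lia.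
  rewrite mxE mxE kx; have [lt|ge] := ltnP t (r - m.+1).
    by rewrite y0 // dcZ fil_u ?mulr0 ?subr0 // /d /=; lia.
  have -> : t = t0 by apply: val_inj => /=; lia.
  by rewrite dcZ dc_u mulr1 subrr.
exists (x + trunc Z); first exact: memvD.
by rewrite linearD /= -Ex subrK.
Qed.

Lemma dim_T : (\dim T + r * n.+1 = \dim L + r)%N.
Proof.
have := dim_window wrho_surj wrho_ker wkap_ker wkap_surj.
by rewrite !dimvf /dim /= muln1.
Qed.
Let M0 : - M <= 0.
Proof. by have := qM; lia. Qed.

Lemma ofil_emb v : ofil 0 (eoo (emb v)).
Proof.
move=> k k0; rewrite cf_eoo; last exact: regular_emb.
by apply: cf_iota_out; rewrite oppr_gt0 k0 orbT.
Qed.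

Lemma eoo_RD_emb v : eoo (RD (emb v)) = Doo (eoo A) (eoo (emb v)).
Proof. by apply: eoo_ad; apply: regular_emb. Qed.

Lemma cf_D_iota v k : 0 <= k -> cf (D (iota v)) k = cf (Doo (eoo A) (eoo (emb v))) (- k).
Proof.
move=> k0; rewrite -eoo_RD_emb cf_eoo ?opprK; last exact/regular_ad/regular_emb.
by rewrite e0_ad //; apply: regular_emb.
Qed.

(** D preserves holomorphy at infinity, so no positive power of z appears and truncation loses
    nothing. *)
Lemma iota_wdel v : v \in T -> iota (wdel v) = D (iota v).
Proof.
move=> /mem_T[vM DM]; apply: truncK => // k k0; rewrite cf_D_iota ?ltW //.
by apply: (ofil_Doo Boo (@ofil_emb v)); rewrite oppr_lt0.
Qed.

Lemma iota0 : iota 0 = 0.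
Proof.
by apply: cf_inj => k; rewrite cf_iota cf0 big1 // => t _; rewrite ffunE if_same.
Qed.

Lemma dim_ker_wdel : \dim (T :&: lker (linfun wdel))%VS = 1%N.
Proof.
have I0 : fil (- M) (1%:M : mat).
  by apply: (fil_weak M0); rewrite -Om0; apply: fil_Om.
have I1 : iota (trunc 1%:M) = 1%:M.
  apply: truncK => // k k0; apply/matrixP => i j; rewrite !mxE.
  by case: (i == j); rewrite ?mulr1n ?mulr0n ?lc1 ?lc0 // gt_eqF.
have -> : (T :&: lker (linfun wdel) = <[trunc 1%:M]>)%VS.
  apply/vspaceP => v; rewrite memv_cap memv_ker lfunE /=; apply/idP/vlineP.
    move=> /andP[vT /eqP v0]; have := iota_wdel vT; rewrite v0 iota0.
    move=> /esym/(D0_ker r_gt0 rn c0 fil_B dc_B fil_u dc_u comm_u)[a va].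
    exists a; rewrite -[v]iotaK va; apply/ffunP => t.
    by rewrite !ffunE cfZ.
  move=> [a ->].
  have Ea : iota (a *: trunc 1%:M) = lconst a *: 1%:M.
    rewrite -[a *: _]addr0 iota_lin I1 iota0.
    by rewrite addr0.
  have Da : D (iota (a *: trunc 1%:M)) = 0 by rewrite Ea D0Z D01 scaler0.
  apply/andP; split.
    by apply/mem_T; rewrite Da Ea; split; [apply: filZ|apply: fil0].
  by apply/eqP/ffunP => t; rewrite /wdel Da !ffunE cf0.
rewrite dim_vline; case: eqP => // t0; exfalso.
have := I1; rewrite t0 iota0 => /matrixP/(_ ord0 ord0)/(congr1 (@lc C ^~ 0)) /eqP.
by rewrite !mxE eqxx mulr1n lc1 lc0 eq_sym oner_eq0.
Qed.

(* [S] is the space of the forms in [L] that are exact on both punctured discs. *)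
Let g := linfun (adk N 0).
Let S : {vspace V} := (L :&: (linfun wev @^-1: limg g))%VS.

Lemma mem_S v : (v \in S) = (v \in L) && (linfun wev v \in limg g).
Proof. by rewrite memv_cap memv_preim. Qed.

Lemma wev_surj : (linfun wev @: L = fullv)%VS.
Proof.
apply/vspaceP => y; rewrite memvf; apply/memv_imgP.
pose v : V := [ffun t => if t == ord_max then y else 0].
exists v; last by rewrite lfunE /= /wev ffunE eqxx.
rewrite memv_ker lfunE /=; apply/eqP/matrixP => i j; rewrite !mxE ffunE -val_eqE /=.
by case: eqP => [q0|_]; [have := rq; have := r_gt0; lia|rewrite mxE if_same].
Qed.

Lemma wev_iota v : wev v = cf (iota v) 0.
Proof. by rewrite -[v in LHS]iotaK /wev ffunE /= subrr. Qed.

Lemma wdel_S : (linfun wdel @: T <= S)%VS.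
Proof.
apply/subvP => _ /memv_imgP[v vT ->]; rewrite mem_S !lfunE /=.
have [vM DM] := (mem_T v).1 vT.
apply/andP; split; first by apply/mem_L; rewrite iota_wdel.
rewrite wev_iota iota_wdel // cf_D_iota // oppr0.
rewrite (cf_Doo Boo (@ofil_emb v)) oppr0.
by apply/memv_imgP; exists (cf (eoo (emb v)) 0); rewrite ?memvf // lfunE.
Qed.

Lemma S_wdel : (S <= linfun wdel @: T)%VS = (r * n.+1 + 1 <= r + \dim (lker g))%N.
Proof.
exact: limg_eq_dim dim_T (dim_preim_limg wev_surj mem_S) dim_ker_wdel wdel_S.
Qed.

(** The value of w at infinity is a commutator with N. It is therefore traceless, which gives a
    primitive at 0, and in the image of ad N, which gives one at infinity. Rigidity yields a global
    primitive, and the pole bounds at both points place it in T. *)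
Lemma rigid_S : rigid A -> (S <= linfun wdel @: T)%VS.
Proof.
move=> rA; apply/subvP => w; rewrite mem_S => /andP[/mem_L wM].
rewrite lfunE /= => /memv_imgP[x _]; rewrite lfunE /= wev_iota => wx.
have [X0 X0P] : exists X0, D X0 = iota w.
  apply: (D0_surj r_gt0 rn c0 fil_B dc_B fil_u dc_u comm_u).
  rewrite sum_dc0 -[lc _ _](_ : \tr (cf (iota w) 0) = _); last first.
    by rewrite lc_sum; apply: eq_bigr => i _; rewrite mxE.
  by rewrite wx /adk scale0r addr0 mxtraceD raddfN /= mxtrace_mulC subrr.
have [Xoo _ XooP] : exists2 Xoo, ofil 0 Xoo & Doo (eoo A) Xoo = eoo (emb w).
  apply: (Doo_surj Boo nilp) (@ofil_emb w) _; exists x.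
  by rewrite -wx cf_eoo ?oppr0 //; apply: regular_emb.
have [|X Xr WX] := rA (emb w) X0 Xoo.
  split; first exact: regular_emb.
    by rewrite ex0E leulE -D0_adE.
  by rewrite exooE leulooE -Doo_adE.
rewrite reulE in WX.
have DX : D (e0 X) = iota w by rewrite -e0_ad // -WX.
have XM : fil (- M) (e0 X).
  apply: (fil_D0_nonpos r_gt0 rn c0 fil_B dc_B fil_u dc_u comm_u M0).
  by rewrite DX.
have Xoo0 : ofil 0 (eoo X).
  apply: (ofil_Doo_up Boo nilp); rewrite -eoo_ad // -WX; exact: ofil_emb.
have Xp k : 0 < k -> cf (e0 X) k = 0.
  by move=> k0; rewrite -[k]opprK -cf_eoo // Xoo0 // oppr_lt0.
have iX : iota (trunc (e0 X)) = e0 X by apply: truncK.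
apply/memv_imgP; exists (trunc (e0 X)); first by apply/mem_T; rewrite iX DX.
by rewrite lfunE /= /wdel iX DX iotaK.
Qed.

End Window.

(** Each leading pole term at infinity is removed by the coboundary of a monomial in z, as [adk] is
    surjective in nonzero degrees. *)
Lemma reduce_oo (W : rmat) : regular_mx_on_Gm W ->
  exists P, [/\ regular_mx_on_Gm P, regular_mx_on_Gm (W - RD P) &
    ofil 0 (eoo (W - RD P))].
Proof.
have sub_r X P : regular_mx_on_Gm X -> regular_mx_on_Gm P -> regular_mx_on_Gm (X - RD P).
  by move=> Xr Pr; apply: regular_mxD => //; apply/regular_mxN/regular_ad.
move=> Wr; have [m Wm] := ofil_bound (eoo W).
elim: m W Wr Wm => [|m IH] W Wr Wm.
  exists 0; have R0 : regular_mx_on_Gm (0 : rmat).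
    by move=> i j; rewrite mxE -(rmorph0 (@rconst C)); apply: regular_const.
  have RD0 : RD 0 = 0.
    by apply: e0_inj; rewrite e0_ad // map_mx0 (raddf0 (D0 (e0 A))).
  by rewrite RD0 subr0; split.
set e := - m.+1%:Z in Wm.
have [x xP] : exists x, adk N (- e%:~R) x = cf (eoo W) e.
  by apply: adk_surj nilp _; rewrite oppr_eq0 intr_eq0.
pose P0 := monomx x m.+1; have P0r : regular_mx_on_Gm P0 := @regular_monomx _ _ x m.+1.
have cP0 k : cf (eoo P0) k = if k == e then x else 0.
  by rewrite cf_eoo // cf_e0_monomx /e eqr_oppLR.
have P0e : ofil e (eoo P0) by move=> k ke; rewrite cP0 lt_eqF.
have W1r := sub_r _ _ Wr P0r.
have eW1 : eoo (W - RD P0) = eoo W - Doo (eoo A) (eoo P0).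
  by rewrite eooD eooN eoo_ad.
have [|P1 [P1r W2r W2]] := IH _ W1r.
  rewrite (_ : - m%:Z = e + 1); last by rewrite /e; lia.
  rewrite eW1; apply: ofilS => [k ke|].
    by rewrite cfB Wm // (ofil_Doo Boo P0e) // subrr.
  by rewrite cfB (cf_Doo Boo P0e) cP0 eqxx xP subrr.
have E : W - RD P0 - RD P1 = W - RD (P0 + P1).
  by rewrite (adB A P0r P1r) (opprD (RD P0) (RD P1)) (addrA W).
exists (P0 + P1); rewrite -E; split; [exact: regular_mxD|exact: W2r|exact: W2].
Qed.

(** The inequality does not involve q: one window proves necessity, and for sufficiency the window
    is enlarged to fit the given form. *)
Lemma rigidP : rigid A <-> (r * n.+1 + 1 <= r + \dim (lker (linfun (adk N 0))))%N.
Proof.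
split=> [/(rigid_S (leqnn r))|dimN]; first by rewrite S_wdel.
move=> W X0 Xoo [Wr _ WXoo]; rewrite exooE leulooE -Doo_adE in WXoo.
have [P [Pr W'r W'0]] := reduce_oo Wr; set W' := W - _ in W'r W'0.
have eW' : eoo W' = Doo (eoo A) (Xoo - eoo P).
  by rewrite eooD eooN eoo_ad // (raddfB (Doo (eoo A))) -WXoo.
have XP0 : ofil 0 (Xoo - eoo P) by apply: (ofil_Doo_up Boo nilp); rewrite -eW'.
have [N1 W'N] := fil_bound (e0 W').
(* N1 bounds the pole at 0 of the reduced form, and the summand r keeps the window admissible. *)
pose q := (r + N1)%N; have rq : (r <= q)%N := leq_addr _ _.
have W'M : fil (- (n.+1%:Z * q%:Z)) (e0 W').
  have : q%:Z <= n.+1%:Z * q%:Z by rewrite ler_peMl.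
  by move=> qM; apply: (fil_weak _ W'N); rewrite /q in qM *; lia.
pose w := trunc q (e0 W').
have iw : iota w = e0 W'.
  apply: (truncK rq W'M) => k k0.
  by rewrite -[k]opprK -cf_eoo // W'0 // oppr_lt0.
have /subvP/(_ w) : _ := etrans (S_wdel rq) dimN.
rewrite (mem_S w) => /(_ _)/memv_imgP[].
  apply/andP; split; first by apply/(mem_L rq w); rewrite iw.
  rewrite lfunE /= wev_iota iw -[0]oppr0 -cf_eoo // eW' (cf_Doo Boo XP0) oppr0.
  by apply/memv_imgP; exists (cf (Xoo - eoo P) 0); rewrite ?memvf // lfunE.
move=> v vT; rewrite lfunE /= => Ew.
exists (P + emb v) => [|]; first by apply: regular_mxD => //; apply: regular_emb.
have W'v : W' = RD (emb v).
  apply: e0_inj; rewrite e0_ad; last exact: regular_emb.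
  by rewrite -iw Ew (iota_wdel rq).
rewrite reulE adB //; last exact: regular_emb.
by rewrite -W'v addrC subrK.
Qed.

End Global.

(** F commutes with P, so after conjugation by h only the framing error E contributes; this gives
    the hypothesis [comm_u]. *)
Lemma conj_commutator (K : fieldType) m (h B F P : 'M[K]_m) : h \in unitmx ->
  F *m P = P *m F ->
  let E := h *m B *m invmx h - F in let Q := invmx h *m P *m h in
  B *m Q - Q *m B = invmx h *m (E *m P - P *m E) *m h.
Proof.
move=> hu FP E Q.
have BE : B = invmx h *m (F + E) *m h.
  by rewrite /E addrC subrK -!mulmxA mulVmx // mulmx1 mulKmx.
clearbody E; have -> : E *m P - P *m E = (F + E) *m P - P *m (F + E).
  by rewrite mulmxDl mulmxDr FP opprD addrACA subrr add0r.
by rewrite {1 2}BE mulmxBr mulmxBl /Q -!mulmxA !mulKVmx.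
Qed.

Section FormalType.
Variables (C : fieldType) (n r : nat) (p : {poly C}).
Local Notation laurent := {fraction (pseries C)}.
Local Notation mat := 'M[laurent]_n.+1.
Local Notation Ft := (formal_type n.+1 p).
Implicit Types (B h X : mat).

Lemma formal_type_Om d : Ft *m Om C n d = Om C n d *m Ft.
Proof.
apply: dc_inj => e i; rewrite dc_OmMr dc_OmMl !dc_formal_type.
by [].
Qed.

Lemma fil_formal_type : size p = r.+1 -> fil (- r%:Z) Ft.
Proof.
move=> sp d i dr; rewrite dc_formal_type; case E: (- d) => [m|//].
by rewrite nth_default // sp; lia.
Qed.

Lemma framed_lead B : size p = r.+1 -> fil (1 - r%:Z) (B - Ft) ->
  fil (- r%:Z) B /\ forall i, dc B (- r%:Z) i = p`_r.
Proof.
move=> sp BF; rewrite -(subrK Ft B); split=> [|i].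
  apply: filD; last exact: fil_formal_type.
  by apply: (fil_weak _ BF); lia.
by rewrite dcD BF ?add0r ?dc_formal_type ?opprK //; lia.
Qed.

Definition conj_Om h d : mat := invmx h *m Om C n d *m h.

Lemma conj_lead h X d : fil 1 (h - 1%:M) -> fil d X ->
  fil d (invmx h *m X *m h) /\ forall i, dc (invmx h *m X *m h) d i = dc X d i.
Proof.
move=> h1 Xd; have h1' := unip_inv h1.
have f1 : fil (0 + d) (invmx h *m X) by apply: filM (fil_unip h1') Xd.
have f2 : fil (0 + d + 0) (invmx h *m X *m h) by apply: filM f1 (fil_unip h1).
rewrite add0r addr0 in f2; split=> // i.
have := dcM i f1 (fil_unip h1); rewrite (dcM i (fil_unip h1') Xd) add0r addr0 => ->.
by rewrite !dc_unip // mulr1 mul1r sh0.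
Qed.

Lemma conj_Om_lead h d : fil 1 (h - 1%:M) ->
  fil d (conj_Om h d) /\ forall i, dc (conj_Om h d) d i = 1.
Proof.
move=> h1; have [H1 H2] := conj_lead h1 (@fil_Om C n d); split=> // i.
by rewrite H2 dc_Om eqxx.
Qed.

Lemma conj_Om_comm B h d : fil 1 (h - 1%:M) -> fil 1 (h *m B *m invmx h - Ft) ->
  fil (d + 1) (B *m conj_Om h d - conj_Om h d *m B).
Proof.
move=> h1 E1; rewrite /conj_Om.
rewrite (conj_commutator B (unip_unit h1) (formal_type_Om d)).
have f1 := filM (@fil_Om C n d) E1.
have f2 := filM E1 (@fil_Om C n d); rewrite addrC in f2.
by have [] := conj_lead h1 (filB f2 f1).
Qed.

End FormalType.

(** * Invariance under constant changes of trivialization *)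

Section ChangeOfTrivialization.
Variables (C : numClosedFieldType) (n : nat).
Local Notation ratfun := {fraction {poly C}}.
Local Notation laurent := {fraction (pseries C)}.
Implicit Types (A W X : 'M[ratfun]_n) (g h : 'M[C]_n).

Lemma map_mx_const_conj (F K : comNzRingType) (k : {rmorphism F -> K})
    (delta : {additive K -> K}) (g h : 'M[F]_n) (X : 'M[K]_n) :
  (forall c i j, delta (k c * X i j) = k c * delta (X i j)) ->
  map_mx delta (map_mx k g *m X *m map_mx k h) =
  map_mx k g *m map_mx delta X *m map_mx k h.
Proof.
move=> dk; apply/matrixP => i j; rewrite !mxE raddf_sum; apply: eq_bigr => l _.
rewrite !mxE !mulr_suml raddf_sum; apply: eq_bigr => m _.
rewrite !mxE /= mulrAC -rmorphM /= dk.
by rewrite rmorphM mulrAC.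
Qed.

Lemma ad_conn_conj (F K : comNzRingType) (k : {rmorphism F -> K})
    (delta : {additive K -> K}) (g h : 'M[F]_n) (A X : 'M[K]_n) :
  h *m g = 1%:M ->
  (forall c i j, delta (k c * X i j) = k c * delta (X i j)) ->
  ad_conn delta (map_mx k g *m A *m map_mx k h) (map_mx k g *m X *m map_mx k h) =
  map_mx k g *m ad_conn delta A X *m map_mx k h.
Proof.
move=> hg dk; rewrite /ad_conn map_mx_const_conj //.
have hg' : map_mx k h *m map_mx k g = 1%:M by rewrite -map_mxM hg map_mx1.
rewrite !mulmxDr !mulmxDl mulmxN mulNmx; congr (_ + (_ - _)).
  by rewrite -!mulmxA [map_mx k h *m (map_mx k g *m _)]mulmxA hg' mul1mx.
by rewrite -!mulmxA [map_mx k h *m (map_mx k g *m _)]mulmxA hg' mul1mx.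
Qed.

Local Notation e0 := (map_mx (@ex0 C)).
Local Notation eoo := (map_mx (@exoo C)).
Local Notation rc := (map_mx (@rconst C)).
Local Notation lct := (map_mx (@lconst C)).

Lemma e0_rconst g : e0 (rc g) = lct g.
Proof. by apply/matrixP => i j; rewrite !mxE ex0_const. Qed.
Lemma eoo_rconst g : eoo (rc g) = lct g.
Proof. by apply/matrixP => i j; rewrite !mxE exoo_const. Qed.

Lemma e0_conj g h X : e0 (rc g *m X *m rc h) = lct g *m e0 X *m lct h.
Proof. by rewrite !e0M !e0_rconst. Qed.
Lemma eooM X A : eoo (X *m A) = eoo X *m eoo A.
Proof. exact: map_mxM. Qed.
Lemma eoo_conj g h X : eoo (rc g *m X *m rc h) = lct g *m eoo X *m lct h.
Proof. by rewrite !eooM !eoo_rconst. Qed.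

Lemma leuloo_const c (x : laurent) : leuloo (lconst c * x) = lconst c * leuloo x.
Proof. by apply: lc_inj => k; rewrite lc_leuloo !lcZ lc_leuloo mulrCA. Qed.

Lemma D0_conj g h (B X : 'M[laurent]_n) : h *m g = 1%:M ->
  D0 (lct g *m B *m lct h) (lct g *m X *m lct h) = lct g *m D0 B X *m lct h.
Proof.
move=> hg; have H := @ad_conn_conj C laurent (@lconst C) (@leul C) g h B X hg.
by rewrite !D0E; apply: H => c i j; apply: leulZ.
Qed.

Lemma Doo_conj g h (B X : 'M[laurent]_n) : h *m g = 1%:M ->
  Doo (lct g *m B *m lct h) (lct g *m X *m lct h) = lct g *m Doo B X *m lct h.
Proof.
move=> hg; have H := @ad_conn_conj C laurent (@lconst C) (@leuloo C) g h B X hg.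
by rewrite !DooE; apply: H => c i j; apply: leuloo_const.
Qed.

Lemma rconstK g h X : g *m h = 1%:M -> rc g *m (rc h *m X *m rc g) *m rc h = X.
Proof.
move=> gh; have gh' : rc g *m rc h = 1%:M by rewrite -map_mxM gh map_mx1.
by rewrite !mulmxA gh' mul1mx -mulmxA gh' mulmx1.
Qed.

Lemma lconstK g h (X : 'M[laurent]_n) : g *m h = 1%:M ->
  lct g *m (lct h *m X *m lct g) *m lct h = X.
Proof.
move=> gh; have gh' : lct g *m lct h = 1%:M by rewrite -map_mxM gh map_mx1.
by rewrite !mulmxA gh' mul1mx -mulmxA gh' mulmx1.
Qed.

Lemma regular_conj g h X : regular_mx_on_Gm X -> regular_mx_on_Gm (rc g *m X *m rc h).
Proof.
by move=> Xr; apply: regular_mxM; [apply: regular_mxM|]; try exact: regular_mx_const.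
Qed.

Lemma rigid_change_triv g A : g \in unitmx -> regular_mx_on_Gm A ->
  rigid A -> rigid (change_triv g A).
Proof.
move=> gu Ar rA W X0 Xoo; rewrite /change_triv; set h := invmx g.
have gh : g *m h = 1%:M by rewrite mulmxV.
have hg : h *m g = 1%:M by rewrite mulVmx.
rewrite /dRc_cocycle ex0E exooE leulE leulooE => -[Wr].
rewrite -D0_adE -Doo_adE e0_conj eoo_conj => W0 Woo.
pose W' := rc h *m W *m rc g.
have [|X Xr] := rA W' (lct h *m X0 *m lct g) (lct h *m Xoo *m lct g).
  rewrite /dRc_cocycle ex0E exooE leulE leulooE -D0_adE -Doo_adE e0_conj eoo_conj.
  split; first exact: regular_conj.
    by rewrite -[e0 A](lconstK _ hg) D0_conj // W0.
  by rewrite -[eoo A](lconstK _ hg) Doo_conj // Woo.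
rewrite reulE => W'E; exists (rc g *m X *m rc h); first exact: regular_conj.
rewrite reulE; apply: e0_inj; rewrite e0_ad ?e0_conj; last exact: regular_conj.
by rewrite D0_conj // -e0_ad // -W'E -e0_conj rconstK.
Qed.

Lemma residue_change_triv g A (N0 : 'M[C]_n) : g \in unitmx ->
  residue_oo_in (adjoint_orbit N0) A ->
  exists Y, [/\ adjoint_orbit N0 Y, ofil 0 (eoo (change_triv g A)) &
    cf (eoo (change_triv g A)) 0 = - Y].
Proof.
move=> gu [Y AY [g0 g0u Y0]]; rewrite exooE in AY.
have Aoo : ofil 0 (eoo A) /\ cf (eoo A) 0 = - (g0 *m N0 *m invmx g0).
  have E k i j : lc (eoo A i j) k = - zcoef (Y i j) k.
    have H : lc ((- eoo A) i j) k = lc (map_mx (@FracField.tofrac _) Y i j) k.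
      by rewrite AY.
    have H1 : (- eoo A) i j = - (eoo A i j) by rewrite mxE.
    have H2 : map_mx (@FracField.tofrac _) Y i j = FracField.tofrac (Y i j).
      by rewrite mxE.
    by rewrite H1 H2 lcN lc_tofrac in H; rewrite -H opprK.
  split=> [k k0|]; apply/matrixP => i j; rewrite mxE E.
    by case: k k0 => // m _; rewrite oppr0 mxE.
  by rewrite Y0 !mxE.
have [A0 A1] := Aoo.
have lc_ofil0 (x : 'M[C]_n) : ofil 0 (lct x) /\ cf (lct x) 0 = x.
  split=> [k k0|]; apply/matrixP => i j; rewrite !mxE lc_const ?eqxx //.
  by rewrite lt_eqF.
have [g1 g2] := lc_ofil0 g; have [h1 h2] := lc_ofil0 (invmx g).
exists (g *m (g0 *m N0 *m invmx g0) *m invmx g); rewrite /change_triv eoo_conj; split.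
- exists (g *m g0); first by rewrite /= unitmx_mul gu.
  rewrite -!mulmxA; do 3!congr (_ *m _).
  have u2 : g *m g0 \in unitmx by rewrite unitmx_mul gu.
  apply: (can_inj (mulKmx u2)); rewrite mulmxV //.
  by rewrite -!mulmxA mulKVmx // mulmxV.
- by apply: ofilMr => //; apply: ofilMl.
rewrite cfMr //; last exact: ofilMl.
by rewrite cfMl // g2 h2 A1 mulmxN mulNmx.
Qed.

End ChangeOfTrivialization.

Lemma dim_le_inj (K : fieldType) (V W : vectType K) (f : 'Hom(V, W))
    (U : {vspace V}) (U' : {vspace W}) :
  (forall x, x \in U -> f x = 0 -> x = 0) -> (forall x, x \in U -> f x \in U') ->
  (\dim U <= \dim U')%N.
Proof.
move=> f0 fU; have <- : \dim (f @: U) = \dim U.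
  apply: limg_dim_eq; apply/eqP; rewrite -subv0; apply/subvP => x.
  by rewrite memv_cap memv_ker memv0 => /andP[xU /eqP/(f0 _ xU) ->].
by apply: dimvS; apply/subvP => _ /memv_imgP[x xU ->]; apply: fU.
Qed.

(** * Centralizers of nilpotent matrices *)

Section Centralizer.
Variables (C : fieldType) (n : nat).
Implicit Types (X Y g : 'M[C]_n).

Definition cdim X := \dim (lker (linfun (adk X 0))).

Lemma mem_centr X Y : (Y \in lker (linfun (adk X 0))) = (X *m Y == Y *m X).
Proof. by rewrite memv_ker lfunE /= /adk scale0r addr0 subr_eq0. Qed.

Let cdim_conj_le X g : g \in unitmx -> (cdim X <= cdim (g *m X *m invmx g))%N.
Proof.
move=> gu; pose f := linfun (mulmx g \o mulmxr (invmx g)).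
have fE Y : f Y = g *m Y *m invmx g by rewrite lfunE /= mulmxA.
apply: (@dim_le_inj _ _ _ f) => Y; rewrite fE.
  move=> _ Y0; rewrite -[Y](mulKmx gu) -[g *m Y](mulmxKV gu) Y0.
  by rewrite mul0mx mulmx0.
rewrite !mem_centr => /eqP XY; apply/eqP.
by rewrite -!mulmxA !mulKmx // !mulmxA -(mulmxA g X) XY !mulmxA.
Qed.

Lemma cdim_conj X g : g \in unitmx -> cdim (g *m X *m invmx g) = cdim X.
Proof.
move=> gu; apply/eqP; rewrite eqn_leq cdim_conj_le // andbT.
have := @cdim_conj_le (g *m X *m invmx g) (invmx g); rewrite unitmx_inv invmxK => /(_ gu).
by rewrite -!mulmxA mulKmx // mulVmx // mulmx1.
Qed.

Lemma cdimN X : cdim (- X) = cdim X.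
Proof.
congr (\dim _); apply/vspaceP => Y; rewrite !mem_centr mulNmx mulmxN.
by rewrite (inj_eq oppr_inj).
Qed.

Lemma adjoint_orbit_sim X Y g : g \in unitmx -> X *m g = g *m Y ->
  adjoint_orbit X = adjoint_orbit Y.
Proof.
move=> gu XY; have -> : X = g *m Y *m invmx g by rewrite -XY mulmxK.
apply/seteqP; split=> _ [h /= hu <-].
  exists (h *m g); first by rewrite /= unitmx_mul hu.
  have u2 : h *m g \in unitmx by rewrite unitmx_mul hu.
  have -> : invmx (h *m g) = invmx g *m invmx h.
    apply: (can_inj (mulKmx u2)); rewrite mulmxV // -!mulmxA mulKVmx // mulmxV //.
  by rewrite !mulmxA.
exists (h *m invmx g); first by rewrite /= unitmx_mul hu unitmx_inv.
have u2 : h *m invmx g \in unitmx by rewrite unitmx_mul hu unitmx_inv.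
have -> : invmx (h *m invmx g) = g *m invmx h.
  by apply: (can_inj (mulKmx u2)); rewrite mulmxV // -!mulmxA mulKmx // mulmxV.
by rewrite -!mulmxA !mulKmx.
Qed.

Lemma cdim_orbit X Y : adjoint_orbit X Y -> cdim Y = cdim X.
Proof. by move=> [g /= gu <-]; rewrite cdim_conj. Qed.

End Centralizer.

Section Jordan.
Variables (C : fieldType) (n : nat) (s : seq nat).
Hypothesis sn : sumn s = n.+1.
Local Notation J := (jordan_nilp C n.+1 s).
Local Notation sz a := (nth 0%N s a).
Implicit Types (i j : 'I_n.+1) (a b c d : nat).

(** [bi] is the Jordan block of an index and [oi] its position in that block; [pos] is the
    inverse. *)
Definition bi i := reshape_index s i.
Definition oi i := reshape_offset s i.
Definition pos a c : 'I_n.+1 := inord (flatten_index s a c).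

Lemma pos_val a c : (c < sz a)%N -> pos a c = flatten_index s a c :> nat.
Proof. by move=> ca; rewrite inordK // -sn flatten_indexP. Qed.

Lemma bi_pos a c : (c < sz a)%N -> bi (pos a c) = a.
Proof. by move=> ca; rewrite /bi pos_val // flatten_indexKl. Qed.
Lemma oi_pos a c : (c < sz a)%N -> oi (pos a c) = c.
Proof. by move=> ca; rewrite /oi pos_val // flatten_indexKr. Qed.
Lemma oi_lt i : (oi i < sz (bi i))%N.
Proof. by apply: reshape_offsetP; rewrite sn. Qed.
Lemma bi_lt i : (bi i < size s)%N.
Proof. by apply: reshape_indexP; rewrite sn. Qed.
Lemma posK i : pos (bi i) (oi i) = i.
Proof. by apply: val_inj; rewrite /= pos_val ?oi_lt // reshape_indexK. Qed.

Lemma eq_pos i j : bi i = bi j -> oi i = oi j -> i = j.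
Proof. by move=> b o; rewrite -(posK i) -(posK j) b o. Qed.

Lemma jordanE i j : J i j = ((bi j == bi i) && (oi j == (oi i).+1))%:R.
Proof.
rewrite mxE -/(bi i) -/(bi j) [bi i == bi j]eq_sym andbC.
congr (nat_of_bool _)%:R; case: eqP => //= bij.
have := reshape_indexK s i; have := reshape_indexK s j; rewrite /flatten_index.
rewrite -/(bi i) -/(bi j) -/(oi i) -/(oi j) bij => <- <-.
by rewrite -addnS eqn_add2l.
Qed.

Lemma mulJr (X : 'M[C]_n.+1) i j :
  (X *m J) i j = if oi j is d.+1 then X i (pos (bi j) d) else 0.
Proof.
rewrite mxE; under eq_bigr => l _ do rewrite jordanE.
case E: (oi j) => [|d].
  by rewrite big1 // => l _; rewrite andbF mulr0.
have dj : (d < sz (bi j))%N by have := oi_lt j; rewrite E => /ltnW.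
rewrite (bigD1 (pos (bi j) d)) //= bi_pos // oi_pos // !eqxx mulr1.
rewrite big1 ?addr0 // => l ld; case: andP => [[/eqP b /eqP[o]]|_]; last by rewrite mulr0.
by case/eqP: ld; apply: eq_pos; rewrite ?bi_pos ?oi_pos.
Qed.

Lemma mulJl (X : 'M[C]_n.+1) i j :
  (J *m X) i j = if ((oi i).+1 < sz (bi i))%N then X (pos (bi i) (oi i).+1) j else 0.
Proof.
rewrite mxE; under eq_bigr => l _ do rewrite jordanE.
case: ifP => [lt|nlt]; last first.
  rewrite big1 // => l _; case: andP => [[/eqP b /eqP o]|_]; last by rewrite mul0r.
  by have := oi_lt l; rewrite b o nlt.
rewrite (bigD1 (pos (bi i) (oi i).+1)) //= bi_pos // oi_pos // !eqxx mul1r.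
rewrite big1 ?addr0 // => l ld; case: andP => [[/eqP b /eqP o]|_]; last by rewrite mul0r.
by case/eqP: ld; apply: eq_pos; rewrite ?bi_pos ?oi_pos.
Qed.

(* The homomorphisms between two Jordan blocks have a basis of Toeplitz matrices,
   as many as the smaller size. *)
Definition centr_index := {x : 'I_(size s) * 'I_(size s) & 'I_(minn (sz x.1) (sz x.2))}.
Implicit Types x : centr_index.
Local Notation gap x := (sz (tag x).2 - sz (tag x).1)%N.

(** Starting at offset [gap], a diagonal leaves the block through its right edge no later than in
    the last row, which is what commuting with the two shifts requires. *)
Definition centr_elt x : 'M[C]_n.+1 := \matrix_(i, j)
  [&& bi i == (tag x).1, bi j == (tag x).2 & oi j == (oi i + gap x + tagged x)%N]%:R.

Lemma centr_elt_comm x : J *m centr_elt x = centr_elt x *m J.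
Proof.
apply/matrixP => i j; rewrite mulJl mulJr.
case: (ltnP (oi i).+1 (sz (bi i))) => oiE; case E: (oi j) => [|d] //.
- by rewrite mxE E bi_pos // oi_pos // !addSn !andbF.
- have dj : (d < sz (bi j))%N by have := oi_lt j; rewrite E => /ltnW.
  by rewrite !mxE !bi_pos // !oi_pos // E !addSn eqSS.
have dj : (d < sz (bi j))%N by have := oi_lt j; rewrite E => /ltnW.
rewrite mxE bi_pos // oi_pos //; case: and3P => // -[/eqP b1 /eqP b2 /eqP dE].
by have := oi_lt j; rewrite E dE; move: oiE; rewrite b1 b2; lia.
Qed.

Lemma centr_index_pos x : (0 < sz (tag x).1)%N /\ (gap x + tagged x < sz (tag x).2)%N.
Proof.
have := ltn_ord (tagged x); rewrite leq_min => /andP[? ?]; split; lia.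
Qed.

Lemma card_centr_index :
  #|{: centr_index}| = (\sum_(a < size s) \sum_(b < size s) minn (sz a) (sz b))%N.
Proof.
rewrite card_tagged sumnE big_map big_enum /= pair_big /=.
by apply: eq_bigr => -[a b] _; rewrite card_ord.
Qed.

Local Notation VQ := {ffun centr_index -> C^o}.

Lemma dim_VQ : \dim {:VQ} = #|{: centr_index}|.
Proof. by rewrite dimvf /dim /= muln1. Qed.

Definition centr_mx (y : VQ) : 'M[C]_n.+1 := \sum_x (y x : C) *: centr_elt x.
Lemma centr_mx_lin : linear centr_mx.
Proof.
move=> a y z; rewrite /centr_mx scaler_sumr -big_split /=; apply: eq_bigr => x _.
by rewrite !ffunE scalerDl scalerA.
Qed.
HB.instance Definition _ := GRing.isLinear.Build C VQ 'M[C]_n.+1 _ centr_mx centr_mx_lin.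

Lemma centr_mx_coef y x : centr_mx y (pos (tag x).1 0) (pos (tag x).2 (gap x + tagged x)) = y x.
Proof.
have [x1 x2] := centr_index_pos x.
rewrite summxE (bigD1 x) //= !mxE !bi_pos // !oi_pos // !eqxx mulr1.
rewrite big1 ?addr0 // => z zx; rewrite !mxE !bi_pos // !oi_pos //.
case: and3P => [[/eqP e1 /eqP e2 /eqP e3]|_]; last by rewrite mulr0.
case/eqP: zx; have e : tag z = tag x.
  by move: e1 e2; case: (tag z) (tag x) => [? ?] [? ?] /= /val_inj -> /val_inj ->.
case: z x e e1 e2 e3 {x1 x2} => [z1 z2] [x1 x2] /= e; rewrite e in z2 * => _ _.
by rewrite add0n => /addnI e3; congr existT; apply: val_inj.
Qed.

Definition centr_coef (X : 'M[C]_n.+1) : VQ :=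
  [ffun x : centr_index => X (pos (tag x).1 0) (pos (tag x).2 (gap x + tagged x)) : C^o].
Lemma centr_coef_lin : linear centr_coef.
Proof. by move=> a X Y; apply/ffunP => x; rewrite !ffunE !mxE. Qed.
HB.instance Definition _ := GRing.isLinear.Build C 'M[C]_n.+1 VQ _ centr_coef centr_coef_lin.

Lemma comm_entry (X : 'M[C]_n.+1) a b c d : J *m X = X *m J ->
  (c < sz a)%N -> (d < sz b)%N ->
  (if (c.+1 < sz a)%N then X (pos a c.+1) (pos b d) else 0) =
  (if d is d'.+1 then X (pos a c) (pos b d') else 0).
Proof.
move=> JX ca db; have /matrixP/(_ (pos a c) (pos b d)) := JX.
by rewrite mulJl mulJr !bi_pos // !oi_pos.
Qed.

(** X is constant along the diagonals of each block, so its top rows determine it. Top entries at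
    offset [gap] or later are the given coefficients; an earlier one travels down to the last row,
    where commutation forces 0. *)
Lemma centr_coef_inj (X : 'M[C]_n.+1) : J *m X = X *m J -> centr_coef X = 0 -> X = 0.
Proof.
move=> JX X0; have top a b d : (0 < sz a)%N -> (d < sz b)%N -> X (pos a 0) (pos b d) = 0.
  move=> a0 db; have [ge|lt] := leqP (sz b - sz a) d.
    have sa : (a < size s)%N by case: ltnP => // sa; rewrite nth_default in a0.
    have sb : (b < size s)%N by case: ltnP => // sb; rewrite nth_default in db.
    have t : (d - (sz b - sz a) < minn (sz a) (sz b))%N by rewrite leq_min; lia.
    pose x : centr_index := existT _ (Ordinal sa, Ordinal sb) (Ordinal t).
    have /ffunP/(_ x) := X0; rewrite !ffunE /= subnKC //.
  have E e : (e < sz a)%N -> X (pos a e) (pos b (d + e)) = X (pos a 0) (pos b d).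
    elim: e => [|e IH] ea; first by rewrite addn0.
    have := @comm_entry X a b e (d + e).+1 JX (ltnW ea) ltac:(lia).
    by rewrite ea /= => E; rewrite addnS E IH // ltnW.
  have := @comm_entry X a b (sz a).-1 (d + sz a).-1.+1 JX ltac:(lia) ltac:(lia).
  rewrite prednK // ltnn => E'; rewrite -(E (sz a).-1); last by rewrite prednK.
  by rewrite E'; congr (X _ (pos _ _)); lia.
apply/matrixP => i j; rewrite mxE -(posK i) -(posK j).
move: (bi i) (bi j) (oi i) (oi j) (oi_lt i) (oi_lt j) => a b c d.
elim: c d => [|c IH] d ca db; first by apply: top.
have := comm_entry JX (ltnW ca) db; rewrite ca => ->.
by case: d db => // d db; apply: IH; [exact: ltnW|exact: ltnW].
Qed.

Lemma cdim_jordan :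
  cdim J = (\sum_(a < size s) \sum_(b < size s) minn (sz a) (sz b))%N.
Proof.
rewrite -card_centr_index -dim_VQ; apply/eqP; rewrite eqn_leq; apply/andP; split.
  apply: (@dim_le_inj _ _ _ (linfun centr_coef)) => X; last by rewrite memvf.
  by rewrite mem_centr lfunE /= => /eqP; apply: centr_coef_inj.
apply: (@dim_le_inj _ _ _ (linfun centr_mx)) => y _; rewrite lfunE /=.
  by move=> y0; apply/ffunP => x; rewrite -centr_mx_coef y0 ffunE mxE.
rewrite mem_centr /centr_mx mulmx_sumr mulmx_suml; apply/eqP; apply: eq_bigr => x _.
by rewrite -scalemxAr -scalemxAl centr_elt_comm.
Qed.

(** phi renumbers the basis, and the weights c^-k at position k of each chain absorb the factor
    c. *)
Lemma adjoint_orbit_chain (X : 'M[C]_n.+1) (c : C) (phi : 'I_n.+1 -> 'I_n.+1) :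
  c != 0 -> injective phi -> (forall i j, X (phi i) (phi j) = c * J i j) ->
  adjoint_orbit X = adjoint_orbit J.
Proof.
move=> c0 phi_inj XJ.
pose g : 'M[C]_n.+1 := \matrix_(i, j) (if i == phi j then c ^- oi j else 0).
pose g' : 'M[C]_n.+1 := \matrix_(j, i) (if i == phi j then c ^+ oi j else 0).
have g'g : g' *m g = 1%:M.
  apply/matrixP => i j; rewrite !mxE (bigD1 (phi i)) //= !mxE eqxx (inj_eq phi_inj).
  rewrite big1 ?addr0 => [|l /negbTE li]; last by rewrite !mxE li mul0r.
  by case: eqP => [->|_]; rewrite ?mulr0 // divff // expf_neq0.
have [_ gu] := mulmx1_unit g'g.
apply: (adjoint_orbit_sim gu); apply/matrixP => i j.
have [psi _ psiK] := injF_bij phi_inj.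
rewrite -(psiK i); move: (psi i) => k; rewrite !mxE.
rewrite (bigD1 (phi j)) //= !mxE eqxx big1 ?addr0 => [|l /negbTE lj]; last first.
  by rewrite !mxE lj mulr0.
rewrite [RHS](bigD1 k) //= !mxE eqxx big1 ?addr0 => [|l /negbTE lk]; last first.
  by rewrite !mxE (inj_eq phi_inj) eq_sym lk mul0r.
rewrite XJ -[(_ && _)%:R](_ : J k j = _); last by rewrite mxE.
rewrite jordanE; case: andP => [[_ /eqP ->]|_]; last by rewrite !mulr0 mul0r.
by rewrite !mulr1 exprS invfM mulrA divff // mul1r.
Qed.

End Jordan.

Definition min_blocks (n r : nat) : seq nat :=
  [seq b <- nseq (n %% r) (n %/ r).+1 ++ nseq (r - n %% r) (n %/ r) | 0 < b]%N.

Section MinBlocks.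
Local Open Scope nat_scope.
Variables (n r : nat).
Hypothesis r_gt0 : (0 < r)%N.

Lemma sumn_filter_pos (s : seq nat) : sumn [seq b <- s | 0 < b]%N = sumn s.
Proof. by elim: s => //= -[|b] s IH //=; rewrite IH. Qed.

Lemma sumn_min_blocks : sumn (min_blocks n r) = n.
Proof.
rewrite sumn_filter_pos sumn_cat !sumn_nseq {5}(divn_eq n r).
have := ltn_pmod n r_gt0; move: (n %% r)%N (n %/ r)%N => u k ur.
have [d ->] : exists d, r = (u + d)%N by exists (r - u)%N; lia.
by rewrite addKn mulSn mulnDr; lia.
Qed.

Lemma min_blocksE : min_blocks n r = if (n %/ r == 0)%N then nseq (n %% r) 1%N
  else nseq (n %% r) (n %/ r).+1 ++ nseq (r - n %% r) (n %/ r).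
Proof.
rewrite /min_blocks filter_cat !filter_nseq /= mul1n; case: eqP => [->|/eqP k0].
  by rewrite mul0n cats0.
by rewrite lt0n k0 mul1n.
Qed.

Lemma size_min_blocks : (size (min_blocks n r) <= r)%N.
Proof.
rewrite min_blocksE; have := ltn_pmod n r_gt0; case: ifP => _.
  by rewrite size_nseq => /ltnW.
by rewrite size_cat !size_nseq => /ltnW/subnKC ->.
Qed.

(** Positions past the end of the list read the default 0, which is the size of the dropped
    blocks. *)
Lemma nth_min_blocks b : (b < r)%N ->
  nth 0%N (min_blocks n r) b = (n %/ r + (b < n %% r))%N.
Proof.
move=> br; rewrite min_blocksE; case: eqP => [->|_].
  by rewrite nth_nseq; case: ifP.
rewrite nth_cat size_nseq !nth_nseq; case: ltnP => bu; first by rewrite addn1.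
by rewrite ltn_sub2r ?addn0 //; apply: leq_ltn_trans bu br.
Qed.

End MinBlocks.

Section Orbits.
Variables (C : fieldType) (n : nat).

Lemma adjoint_orbit_perm (s s' : seq nat) : sumn s = n.+1 -> perm_eq s' s ->
  adjoint_orbit (jordan_nilp C n.+1 s) = adjoint_orbit (jordan_nilp C n.+1 s').
Proof.
move=> sn ss'; have sn' : sumn s' = n.+1 by rewrite (perm_sumn ss').
have size_ss' := perm_size ss'.
have [Is IsP s'E] := perm_iotaP 0%N ss'.
have size_Is : size Is = size s' by rewrite (perm_size IsP) size_iota.
have nth_s' a : (a < size s')%N -> nth 0%N s' a = nth 0%N s (nth 0%N Is a).
  by move=> a_s; rewrite s'E (nth_map 0%N) // size_Is.
have Is_uniq : uniq Is by rewrite (perm_uniq IsP) iota_uniq.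
pose phi (i : 'I_n.+1) := pos n s (nth 0%N Is (bi s' i)) (oi s' i).
have phi_lt (i : 'I_n.+1) : (oi s' i < nth 0%N s (nth 0%N Is (bi s' i)))%N.
  by rewrite -nth_s'; [exact: (oi_lt sn')|exact: (bi_lt sn')].
have bphi i : bi s (phi i) = nth 0%N Is (bi s' i) by rewrite bi_pos.
have ophi i : oi s (phi i) = oi s' i by rewrite oi_pos.
have Is_inj (i j : 'I_n.+1) : (nth 0%N Is (bi s' i) == nth 0%N Is (bi s' j)) = (bi s' i == bi s' j).
  by rewrite nth_uniq // size_Is (bi_lt sn').
apply: (@adjoint_orbit_chain C n s' _ 1 phi) => [|i j ij|i j].
- exact: oner_neq0.
- apply: (eq_pos sn'); last by rewrite -!ophi ij.
  by apply/eqP; rewrite -Is_inj -!bphi ij.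
by rewrite mul1r !jordanE // !bphi !ophi Is_inj.
Qed.

(** The chains of the shift by r are the residue classes modulo r, whose cardinalities are the sizes
    in [min_blocks]. *)
Lemma adjoint_orbit_shift r (c : C) : (0 < r)%N -> c != 0 ->
  adjoint_orbit (\matrix_(i < n.+1, j < n.+1) (c *+ (i == j + r :> nat)%N)) =
  min_orbit C n.+1 r.
Proof.
move=> r_gt0 c0; set s := min_blocks n.+1 r; rewrite /min_orbit -/(min_blocks _ _) -/s.
have sn : sumn s = n.+1 := sumn_min_blocks _ r_gt0.
have br (i : 'I_n.+1) : (bi s i < r)%N by apply: leq_trans (bi_lt sn i) (size_min_blocks _ r_gt0).
have sb (i : 'I_n.+1) : nth 0%N s (bi s i) = (n.+1 %/ r + (bi s i < n.+1 %% r)%N)%N.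
  exact: nth_min_blocks.
(* Block b becomes the class of b, run from its largest member downwards because the shift lies
   below the diagonal and the Jordan matrix above it. *)
pose v (i : 'I_n.+1) := (bi s i + r * (nth 0 s (bi s i) - (oi s i).+1))%N.
have ol i := oi_lt sn i.
have v_lt i : (v i < n.+1)%N.
  have E0 := divn_eq n.+1 r; have E1 := ltn_pmod n.+1 r_gt0.
  rewrite /v; have := ol i; have := br i; rewrite sb.
  rewrite [X in _ -> _ -> (_ < X)%N]E0.
  move: E1; move: (n.+1 %% r)%N (n.+1 %/ r)%N (bi s i) (oi s i) => u k b o ur br'.
  set w := (k + _)%N => ow; case E : (b < u)%N @w ow => w ow.
    have : (r * (w - o.+1) <= r * k)%N by rewrite leq_mul2l /w /=; apply/orP; right; lia.
    by rewrite [(k * r)%N]mulnC; move: (r * k)%N (r * _)%N => y z; lia.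
  have [k' Ek] : exists k', k = k'.+1 by exists k.-1; move: ow; rewrite /w /=; lia.
  have : (r * (w - o.+1) <= r * k')%N by rewrite leq_mul2l /w Ek /=; apply/orP; right; lia.
  rewrite Ek mulSn [(k' * r)%N]mulnC; move: (r * k')%N (r * _)%N => y z; lia.
have v_eq i j : (v i == v j + r)%N = (bi s j == bi s i) && (oi s j == (oi s i).+1).
  rewrite /v; apply/eqP/andP => [E|[/eqP bij /eqP oij]].
    have bE : bi s j = bi s i.
      have := congr1 (modn^~ r) E.
      by rewrite modnDr ![(bi s _ + _)%N]addnC ![(r * _)%N]mulnC !modnMDl !modn_small.
    rewrite bE eqxx; move: E; rewrite bE -addnA => /addnI.
    rewrite -{3}[r]muln1 -mulnDr => /eqP; rewrite eqn_pmul2l // => /eqP.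
    by have := ol i; have := ol j; rewrite bE => *; split=> //; lia.
  have := ol j; rewrite bij oij => H.
  rewrite -addnA; congr (_ + _)%N; rewrite -{3}[r]muln1 -mulnDr; congr (_ * _)%N; lia.
apply: (@adjoint_orbit_chain C n s _ c (fun i => Ordinal (v_lt i))) => // i j.
  move=> [E]; have bE : bi s i = bi s j.
    have := congr1 (modn^~ r) E.
    by rewrite /v ![(bi s _ + _)%N]addnC ![(r * _)%N]mulnC !modnMDl !modn_small.
  apply: (eq_pos sn) => //; move: E; rewrite /v bE => /addnI/eqP.
  rewrite eqn_pmul2l // => /eqP; have := ol i; have := ol j; rewrite bE; lia.
by rewrite mxE jordanE // mulr_natr /= v_eq.
Qed.

End Orbits.

(** * Combinatorics of block sizes *)

Section Balance.
Local Open Scope nat_scope.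
Variables (r : nat) (f : 'I_r -> nat).

Let dist a b := ((a - b) + (b - a))%N.
Let disp := (\sum_(a < r) \sum_(b < r) dist (f a) (f b))%N.

(** 2 min(x, y) + |x - y| = x + y, summed over ordered pairs; [disp] thus counts each unordered pair
    twice. *)
Lemma sum_minn : (2 * (\sum_(a < r) \sum_(b < r) minn (f a) (f b)) + disp =
  2 * (r * \sum_(a < r) f a))%N.
Proof.
have E : (\sum_(a < r) \sum_(b < r) (f a + f b) = 2 * (r * \sum_(a < r) f a))%N.
  under eq_bigr => a _ do rewrite big_split /= sum_nat_const card_ord.
  by rewrite big_split /= sum_nat_const card_ord -big_distrr /= mul2n addnn.
rewrite -E /disp big_distrr -big_split /=; apply: eq_bigr => a _.
rewrite big_distrr -big_split /=; apply: eq_bigr => b _.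
by rewrite /dist; lia.
Qed.

(* Every value is at total distance at least [dist (f a0) (f b0)] from the pair
   [f a0], [f b0]. *)
Lemma disp_lower a0 b0 : f a0 != f b0 ->
  (2 * (r - 1) * dist (f a0) (f b0) <= disp)%N.
Proof.
move=> ab; have ba : b0 != a0 by apply: contraNneq ab => ->.
rewrite /disp (bigD1 a0) //= [X in _ <= _ + X](bigD1 b0) //= addnA.
have r2 : (1 < r)%N.
  have := ltn_ord a0; have := ltn_ord b0; move: ba; rewrite -val_eqE /=; lia.
set d := dist _ _.
(* By the triangle inequality the rows a0 and b0 give r d together, and each of the other r - 2 rows
   gives d from its columns a0 and b0. *)
have H1 : (r * d <= \sum_(b < r) dist (f a0) (f b) + \sum_(b < r) dist (f b0) (f b))%N.
  rewrite -big_split /= -[r in (r * _)%N]card_ord -sum_nat_const; apply: leq_sum => b _.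
  by rewrite /d /dist; lia.
have H2 : ((r - 2) * d <= \sum_(a < r | (a != a0) && (a != b0)) \sum_(b < r) dist (f a) (f b))%N.
  have -> : (r - 2)%N = #|[pred a : 'I_r | (a != a0) && (a != b0)]|.
    have := cardC (pred2 a0 b0); rewrite card_ord card2 eq_sym ba => E.
    rewrite -{1}E addKn; apply: eq_card => a; rewrite !inE negb_or //.
  rewrite -sum_nat_const; apply: leq_sum => a /andP[aa ab'].
  rewrite (bigD1 a0) //= [X in _ <= _ + X](bigD1 b0) //= addnA; apply: leq_trans (leq_addr _ _).
  by rewrite /d /dist; lia.
apply: leq_trans (leq_add H1 H2); rewrite -mulnDl leq_mul2r; apply/orP; right; lia.
Qed.

Lemma disp_two_values m (u := (\sum_(a < r) (f a == m.+1))%N) :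
  (forall a, f a = m \/ f a = m.+1) -> disp = (2 * (u * (r - u)))%N.
Proof.
move=> fm.
have -> : disp = (\sum_(a < r) \sum_(b < r) ((f a == m.+1) * ~~ (f b == m.+1) + ~~ (f a == m.+1) * (f b == m.+1)))%N.
  apply: eq_bigr => a _; apply: eq_bigr => b _; rewrite /dist.
  by case: (fm a) => ->; case: (fm b) => ->; rewrite ?eqxx ?(ltn_eqF (ltnSn m)) /=; lia.
have uC : (\sum_(a < r) ~~ (f a == m.+1) = r - u)%N.
  have : (\sum_(a < r) ((f a == m.+1) + ~~ (f a == m.+1)) = r)%N.
    rewrite -[RHS]card_ord -sum1_card; apply: eq_bigr => a _.
    by case: (_ == _).
  by rewrite big_split /= -/u; lia.
under eq_bigr => a _ do rewrite big_split /= -!big_distrr /= uC -/u.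
by rewrite big_split /= -!big_distrl /= uC -/u; lia.
Qed.

End Balance.

Section BlockSizes.
Local Open Scope nat_scope.
Implicit Types (r n : nat) (s : seq nat).

Lemma perm_two_values s m : {in s, forall x, x = m \/ x = m.+1} ->
  perm_eq s (nseq (count_mem m.+1 s) m.+1 ++ nseq (size s - count_mem m.+1 s) m).
Proof.
move=> sm; have {1}<- : filter (pred1 m.+1) s = nseq (count_mem m.+1 s) m.+1.
  have /all_pred1P := filter_all (pred1 m.+1) s; by rewrite size_filter.
have <- : filter (predC (pred1 m.+1)) s = nseq (size s - count_mem m.+1 s) m.
  rewrite -(count_predC (pred1 m.+1) s) addKn -size_filter; apply/all_pred1P/allP => x.
  by rewrite mem_filter /= => /andP[xm /sm[-> //|/eqP E]]; rewrite E in xm.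
by rewrite perm_sym perm_filterC.
Qed.

Lemma sum_widen s r (F : nat -> nat) : size s <= r -> F 0 = 0 ->
  \sum_(a < size s) F (nth 0 s a) = \sum_(a < r) F (nth 0 s a).
Proof.
move=> sr F0; rewrite (big_ord_widen r (fun a => F (nth 0 s a)) sr) big_mkcond /=.
by apply: eq_bigr => a _; case: ltnP => // sa; rewrite nth_default.
Qed.

Lemma sum_minn_widen s r : size s <= r ->
  \sum_(a < size s) \sum_(b < size s) minn (nth 0 s a) (nth 0 s b) =
  \sum_(a < r) \sum_(b < r) minn (nth 0 s a) (nth 0 s b).
Proof.
move=> sr; rewrite (@sum_widen s r (fun x => \sum_(b < size s) minn x (nth 0 s b))) //; last first.
  by rewrite big1 // => b _; rewrite min0n.
apply: eq_bigr => a _.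
by rewrite (@sum_widen s r (fun x => minn (nth 0 s a) x)) // minn0.
Qed.

Lemma sum_nth_widen s r : size s <= r -> \sum_(a < r) nth 0 s a = sumn s.
Proof.
by move=> sr; rewrite -(@sum_widen s r id) // sumnE (big_nth 0) big_mkord.
Qed.

(** Since the value m occurs, fewer than r entries equal m + 1; hence m and their number are the
    quotient and the remainder of the sum by r. *)
Lemma balanced_perm s r m : 0 < r -> size s <= r -> all (leq 1) s ->
  (forall a, a < r -> nth 0 s a = m \/ nth 0 s a = m.+1) ->
  (exists2 a, a < r & nth 0 s a = m) ->
  perm_eq s (min_blocks (sumn s) r) /\
  sumn s %% r = \sum_(a < r) (nth 0 s a == m.+1).
Proof.
move=> r0 sr s1 sm [a0 a0r a0m].
pose t := s ++ nseq (r - size s) 0.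
have st : size t = r by rewrite size_cat size_nseq subnKC.
have nt a : nth 0 t a = nth 0 s a.
  by rewrite nth_cat nth_nseq; case: ltnP => // sa; rewrite if_same nth_default.
have tm : {in t, forall x, x = m \/ x = m.+1}.
  by move=> _ /(nthP 0)[a ar <-]; rewrite nt; apply: sm; rewrite -st.
have tP := perm_two_values tm; set c := count_mem _ _ in tP; rewrite st in tP.
have cr : c < r.
  rewrite ltn_neqAle -{2}st count_size andbT -st /c -all_count.
  apply/negP => /allP/(_ m); rewrite -{1}a0m -nt mem_nth ?st // => /(_ isT) /=.
  by rewrite ltn_eqF.
have sum_t : sumn t = sumn s by rewrite sumn_cat sumn_nseq mul0n addn0.
have E : sumn s = m * r + c.
  rewrite -sum_t (perm_sumn tP) sumn_cat !sumn_nseq mulSn -addnA -mulnDr.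
  by rewrite (subnKC (ltnW cr)) addnC.
have dE : sumn s %/ r = m by rewrite E divnMDl // divn_small ?addn0.
have mE : sumn s %% r = c by rewrite E modnMDl modn_small.
split.
  rewrite /min_blocks dE mE; have {1}-> : s = [seq b <- t | 0 < b].
    rewrite filter_cat filter_nseq /= cats0; apply/esym/all_filterP.
    by apply: sub_all s1.
  exact: perm_filter.
apply: (@addnI (m * r)); rewrite mE -E.
have mr : \sum_(a < r) m = m * r by rewrite sum_nat_const card_ord mulnC.
rewrite -(sum_nth_widen sr) -mr -big_split /=.
apply: eq_bigr => a _; case: (sm a (ltn_ord a)) => ->; rewrite ?eqxx ?addn1 //.
by rewrite ltn_eqF // addn0.
Qed.

Lemma sum_minn_bound s n r : 0 < r -> 0 < n -> coprime r n -> size s <= r ->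
  all (leq 1) s -> sumn s = n ->
  r * n + 1 <= r + \sum_(a < size s) \sum_(b < size s) minn (nth 0 s a) (nth 0 s b) ->
  perm_eq s (min_blocks n r) /\ ((r %| n + 1) \/ (r %| n - 1)).
Proof.
move=> r0 n0 rn sr s1 sn; rewrite (sum_minn_widen sr) => H.
pose f (a : 'I_r) := nth 0 s a.
have sumf : \sum_(a < r) f a = n by rewrite (sum_nth_widen sr).
have := sum_minn f; rewrite sumf; set S := \sum_(a < r) _ => dE.
have {}H : r * n + 1 <= r + S := H.
move: dE; set d := (X in _ + X) => dE.
have dle : d <= 2 * (r - 1) by lia.
have [eqf|] := boolP [forall a, forall b, f a == f b].
  pose a0 := Ordinal r0; pose m := f a0.
  have fm a : f a = m by apply/eqP; move/forallP: eqf => /(_ a)/forallP/(_ a0).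
  (* Equal sizes make r divide n, and r is prime to n. *)
  have r1 : r = 1.
    move: rn; rewrite -sumf; under eq_bigr => a _ do rewrite fm.
    by rewrite sum_nat_const card_ord /coprime gcdnMr => /eqP.
  split; last by left; rewrite r1 dvd1n.
  have [|//|] := @balanced_perm s r m r0 sr s1; last by rewrite sn.
    by move=> a ar; left; apply: (fm (Ordinal ar)).
  by exists 0.
rewrite negb_forall => /existsP[a0]; rewrite negb_forall => /existsP[b0 ab].
have ba : b0 != a0 by apply: contraNneq ab => ->.
have r2 : 1 < r.
  have := ltn_ord a0; have := ltn_ord b0; move: ba; rewrite -val_eqE /=; lia.
(* Two sizes at distance d cost at least 2 (r - 1) d, and only 2 (r - 1) is available. *)
have close a b : (f a - f b) + (f b - f a) <= 1.
  have [->|fab] := eqVneq (f a) (f b); first by rewrite subnn.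
  have /leq_trans/(_ dle) := disp_lower fab; rewrite -[X in _ <= X]muln1.
  by rewrite leq_pmul2l // muln_gt0 subn_gt0.
wlog lt_ab : a0 b0 ab ba / f a0 < f b0.
  by move=> W; have := W _ _ ab ba; have := W b0 a0; rewrite eq_sym ab eq_sym ba; move: ab; lia.
pose m := f a0.
have fb : f b0 = m.+1 by have := close a0 b0; rewrite /m; lia.
have fm a : f a = m \/ f a = m.+1.
  by have := close a a0; have := close a b0; rewrite fb /m; lia.
have [||pe ue] := @balanced_perm s r m r0 sr s1.
- by move=> a ar; apply: (fm (Ordinal ar)).
- by exists a0.
rewrite sn in pe ue; split=> //.
have dd := disp_two_values fm; rewrite -/d in dd.
move: ue dd; set u := (\sum_(a < r) _) => ue dd.
have u1 : 0 < u by rewrite /u (bigD1 b0) //= -/(f b0) fb eqxx.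
have ur : u < r by rewrite -ue ltn_mod.
(* With u = x + 1 and r - u = y + 1 the bound u (r - u) <= r - 1 reads (x + 1) (y + 1) <= x + y + 1,
   so x y = 0. *)
have [x ux] : exists x, u = x.+1 by exists u.-1; lia.
have [y uy] : exists y, r - u = y.+1 by exists (r - u).-1; lia.
have xy : x * y = 0 by move: dle; rewrite dd ux in uy *; rewrite uy; lia.
have nE := divn_eq n r; rewrite ue in nE.
have /orP[/eqP x0|/eqP y0] : (x == 0) || (y == 0) by rewrite -muln_eq0 xy.
  by right; rewrite nE ux x0 addn1 subn1 /= dvdn_mull.
left; rewrite nE -addnA (_ : u + 1 = r); last by lia.
by rewrite dvdn_addl // dvdn_mull.
Qed.

Lemma sum_minn_min_blocks n r : 0 < r -> 0 < n -> (r %| n + 1) \/ (r %| n - 1) ->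
  r * n + 1 <= r + \sum_(a < size (min_blocks n r)) \sum_(b < size (min_blocks n r))
    minn (nth 0 (min_blocks n r) a) (nth 0 (min_blocks n r) b).
Proof.
move=> r0 n0 rdiv; set s := min_blocks n r; rewrite (sum_minn_widen (size_min_blocks n r0)).
set k := n %/ r; set u := n %% r.
have E a : nth 0 s (a : 'I_r) = k + (a < u) by apply: nth_min_blocks.
have nE : n = k * r + u := divn_eq n r.
have ur : u < r := ltn_pmod n r0.
have sumu : \sum_(a < r) (a < u) = u.
  have := sum_nth_widen (size_min_blocks n r0); rewrite (sumn_min_blocks n r0).
  under eq_bigr => a _ do rewrite E.
  by rewrite big_split /= sum_nat_const card_ord nE mulnC => /addnI.
have -> : \sum_(a < r) \sum_(b < r) minn (nth 0 s a) (nth 0 s b) = r * (r * k) + u * u.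
  under eq_bigr => a _ do under eq_bigr => b _ do rewrite !E -addn_minr.
  under eq_bigr => a _ do rewrite big_split /= sum_nat_const card_ord.
  rewrite big_split /= sum_nat_const card_ord; congr (_ + _).
  transitivity (\sum_(a < r) \sum_(b < r) (a < u) * (b < u)).
    by apply: eq_bigr => a _; apply: eq_bigr => b _; case: (a < u); case: (b < u).
  under eq_bigr => a _ do rewrite -big_distrr /= sumu.
  by rewrite -big_distrl /= sumu.
(* Equivalent to (u - 1) (r - u - 1) <= 0; for r > 1 the divisibility makes u equal to r - 1 or
   1. *)
have uE : u * r + 1 <= r + u * u.
  have [r1|r1] := leqP r 1; first by have -> : u = 0; lia.
  case: rdiv => /dvdnP[q qE].
    have : (n + 1) %% r = 0 by rewrite qE modnMl.
    rewrite nE -addnA modnMDl; have [lt|ge] := ltnP (u + 1) r.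
      by rewrite modn_small // addn1.
    by move=> _; have -> : r = u + 1; lia.
  have : n %% r = (q * r + 1) %% r by congr (_ %% _); lia.
  by rewrite modnMDl -/u => ->; rewrite modn_small //; lia.
by rewrite {1}nE; nia.
Qed.

End BlockSizes.

(** * Existence of framable connections *)

Lemma conj_mul (K : fieldType) m (g h X : 'M[K]_m) : g \in unitmx -> h \in unitmx ->
  (g *m h) *m X *m invmx (g *m h) = g *m (h *m X *m invmx h) *m invmx g.
Proof.
move=> gu hu; have ghu : g *m h \in unitmx by rewrite unitmx_mul gu.
apply: (can_inj (mulmxK ghu)); rewrite mulmxKV // -!mulmxA; congr (_ *m (_ *m _)).
by rewrite mulKmx // mulVmx // mulmx1.
Qed.

(** Exact effect of a further gauge by 1 + Z on the error E: in [framed_step] the commutator [Z, F]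
    cancels its leading part and Z E has higher degree. *)
Lemma perturbed_conj (K : fieldType) m (A F Z h : 'M[K]_m) :
  let g := 1%:M + Z in let E := h *m A *m invmx h - F in
  g \in unitmx -> h \in unitmx ->
  (g *m h) *m A *m invmx (g *m h) - F =
  (E + (Z *m F - F *m Z) + Z *m E) *m invmx g.
Proof.
move=> g E gu hu; rewrite conj_mul //.
have -> : h *m A *m invmx h = F + E by rewrite addrC subrK.
clearbody E; rewrite -{2}(mulmxK gu F) -mulmxBl; congr (_ *m _).
rewrite /g mulmxDl mul1mx !mulmxDr mulmx1.
move: (Z *m F) (Z *m E) (F *m Z) => a b c.
by apply/matrixP => i j; rewrite !mxE; ring.
Qed.

Section Existence.
Variables (C : numClosedFieldType) (n r : nat) (p : {poly C}).
Local Notation ratfun := {fraction {poly C}}.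
Local Notation laurent := {fraction (pseries C)}.
Local Notation rmat := 'M[ratfun]_n.+1.
Local Notation mat := 'M[laurent]_n.+1.
Local Notation e0 := (map_mx (@ex0 C)).
Local Notation eoo := (map_mx (@exoo C)).
Hypotheses (r_gt0 : (0 < r)%N) (rn : coprime r n.+1).
Hypotheses (sp : size p = r.+1) (p0 : p`_0 = 0).
Local Notation Ft := (formal_type n.+1 p).
Let S : 'M[C]_n.+1 := \matrix_(i, j) (p`_r *+ (i == j + r :> nat)%N).

Let pr0 : p`_r != 0.
Proof. by have := lead_coef_eq0 p; rewrite lead_coefE sp -size_poly_eq0 sp => ->. Qed.

Definition single (i0 : 'I_n.+1) (d : int) : rmat :=
  \matrix_(i, j) (if (i == i0) && (j == sh i d) then rvar C ^ qt i d else 0).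

Lemma regular_single i0 d : regular_mx_on_Gm (single i0 d).
Proof.
move=> i j; rewrite mxE; case: ifP => _; first exact: regular_varXz.
by rewrite -(rmorph0 (@rconst C)); apply: regular_const.
Qed.

Lemma dc_single i0 d e i : dc (e0 (single i0 d)) e i = ((e == d) && (i == i0))%:R.
Proof.
have -> : dc (e0 (single i0 d)) e i = if i == i0 then dc (Om C n d) e i else 0.
  rewrite /dc !mxE; case: (i == i0) => /=; last by rewrite rmorph0 lc0.
  by case: eqP => _; rewrite ?ex0_varXz // rmorph0.
by rewrite dc_Om andbC; case: (i == i0).
Qed.

Lemma qt_neg (i : 'I_n.+1) d : i%:Z + d < 0 -> qt i d < 0.
Proof.
have := shqtE i d; have := ltn_ord (sh i d) => s E id0.
have [//|q0] := ltP (qt i d) 0.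
by have : n.+1%:Z * 0 <= n.+1%:Z * qt i d; [rewrite ler_pM2l|lia].
Qed.

(** Row 0 is the row in which every negative degree carries a negative power of z; in row i the
    degrees from -i to -1 have exponent 0 and would change the value at infinity. *)
Lemma cf_single d k : d < 0 -> 0 <= k -> cf (e0 (single ord0 d)) k = 0.
Proof.
move=> d0 k0; apply/matrixP => i j; rewrite !mxE; case: andP => [[/eqP -> _]|_].
  rewrite ex0_varXz lc_lvarXz gt_eqF //; apply: lt_le_trans k0; apply: qt_neg.
  by rewrite add0r.
by rewrite rmorph0 lc0.
Qed.

Definition base_mx : rmat := rconst p`_r *: \sum_i single i (- r%:Z).

Lemma regular_base : regular_mx_on_Gm base_mx.
Proof.
move=> i j; rewrite mxE; apply: regularM; first exact: regular_const.
by rewrite summxE; apply: regular_sum => l _; apply: regular_single.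
Qed.

Lemma dc_base d i : dc (e0 base_mx) d i = p`_r *+ (d == - r%:Z).
Proof.
have -> : e0 base_mx = lconst p`_r *: \sum_i e0 (single i (- r%:Z)).
  apply/matrixP => a b; rewrite !mxE rmorphM /= ex0_const !summxE rmorph_sum.
  by congr (_ * _); apply: eq_bigr => l _; rewrite [RHS]mxE.
rewrite dcZ dc_sum (bigD1 i) //= dc_single eqxx andbT.
rewrite big1 ?addr0 ?mulr_natr // => l li; rewrite dc_single.
by rewrite [i == l]eq_sym (negbTE li) andbF.
Qed.

Lemma cf_base k : 0 <= k -> cf (e0 base_mx) k = if k == 0 then S else 0.
Proof.
move=> k0; apply/matrixP => i j; rewrite cf_dc dc_base.
have [->|kn0] := eqVneq k 0.
  rewrite mxE mulr0 add0r; congr (_ *+ _); apply/f_equal; apply/idP/idP; lia.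
rewrite mxE (_ : (_ == _) = false) //; apply/negbTE/eqP => E.
have : n.+1%:Z * 1 <= n.+1%:Z * k by rewrite ler_pM2l //; move: k0 kn0; lia.
have := ltn_ord i; have := r_gt0; lia.
Qed.

(* The framed matrix is built degree by degree: the trace of the leading error
   is removed by adding a multiple of the top left entry of that degree, the
   rest by a unipotent gauge transformation. *)
Lemma framed_step (A : rmat) (h : mat) (t : nat) : (t < r)%N ->
  [/\ regular_mx_on_Gm A, forall k, 0 <= k -> cf (e0 A) k = if k == 0 then S else 0 &
      fil (1 - r%:Z) (e0 A - Ft)] ->
  fil 1 (h - 1%:M) -> fil (1 - r%:Z + t%:Z) (h *m e0 A *m invmx h - Ft) ->
  exists A' h', [/\ regular_mx_on_Gm A',
      forall k, 0 <= k -> cf (e0 A') k = if k == 0 then S else 0,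
      fil (1 - r%:Z) (e0 A' - Ft), fil 1 (h' - 1%:M) &
      fil (1 - r%:Z + t.+1%:Z) (h' *m e0 A' *m invmx h' - Ft)].
Proof.
move=> tr [Ar Acf AF] h1 Xd; pose d : int := 1 - r%:Z + t%:Z.
pose X : mat := h *m e0 A *m invmx h - Ft; rewrite -/d -/X in Xd.
have hu := unip_unit h1; have h1' := unip_inv h1.
have fF := @fil_formal_type C n r p sp.
pose tau := \sum_i dc X d i.
(* Conjugation preserves the trace, and in degree 0 both S and the formal type are traceless, the
   latter because p has no constant term. *)
have tau0 : d = 0 -> tau = 0.
  move=> E; rewrite /tau E sum_dc0 /X mxtraceD raddfN /= lcD lcN.
  rewrite -mulmxA mxtrace_mulC -mulmxA mulVmx // mulmx1 -!sum_dc0.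
  have -> : \sum_i dc (e0 A) 0 i = \tr (cf (e0 A) 0).
    by apply: eq_bigr => i _; rewrite dc_cf sh0 qt0.
  have trS : \tr S = 0.
    rewrite /mxtrace big1 // => i _; rewrite mxE (_ : (_ == _) = false) //.
    by apply/negbTE; have := r_gt0; lia.
  rewrite Acf // eqxx trS sub0r big1 ?oppr0 // => i _.
  by rewrite dc_formal_type.
pose A' := A + rconst (- tau) *: single ord0 d.
have eA' : e0 A' = e0 A + lconst (- tau) *: e0 (single ord0 d).
  by apply/matrixP => i j; rewrite !mxE rmorphD rmorphM /= ex0_const.
have Es : fil d (e0 (single ord0 d)).
  by move=> e i ed; rewrite dc_single lt_eqF.
pose X' := h *m e0 A' *m invmx h - Ft.
pose Eh := h *m e0 (single ord0 d) *m invmx h.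
have [Ehd EhE] : fil d Eh /\ forall i, dc Eh d i = dc (e0 (single ord0 d)) d i.
  by have := conj_lead h1' Es; rewrite invmxK.
have X'E : X' = X + lconst (- tau) *: Eh.
  rewrite /X' eA' mulmxDr mulmxDl -scalemxAr -scalemxAl -/Eh /X.
  by rewrite -!addrA; congr (_ + _); rewrite addrC.
have X'd : fil d X' by rewrite X'E; apply: filD => //; apply: filZ.
have X'0 : \sum_i dc X' d i = 0.
  have dX' i : dc X' d i = dc X d i - tau * (i == ord0)%:R.
    have E1 := congr1 (fun Z : mat => dc Z d i) X'E.
    have E2 := dcD X (lconst (- tau) *: Eh) d i; have E3 := dcZ (- tau) Eh d i.
    have E4 := etrans (EhE i) (dc_single ord0 d d i).
    rewrite eqxx in E4; rewrite E4 mulNr in E3.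
    exact: etrans E1 (etrans E2 (congr1 (+%R (dc X d i)) E3)).
  under eq_bigr => i _ do rewrite dX'.
  have E1 : \sum_(i < n.+1) (i == ord0)%:R = 1 :> C.
    by rewrite (bigD1 ord0) //= big1 ?addr0 // => i /negbTE ->.
  by rewrite sumrB -mulr_sumr E1 mulr1 subrr.
(* Z is chosen so that [Z, [Ft]], whose leading coefficient in row i is p_r (y_i - y_(i - r)),
   cancels the leading part of X'. *)
have [|y yP] := @cyc_solve C n r rn (fun i => (p`_r)^-1 * dc X' d i).
  by rewrite -mulr_sumr X'0 mulr0.
have [Z Zd Zy] := single_dc (d + r%:Z) y.
have Z1 : fil 1 Z by apply: (fil_weak _ Zd); rewrite /d; lia.
pose g := 1%:M + Z; have g1 : fil 1 (g - 1%:M) by rewrite /g addrAC subrr add0r.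
have gu := unip_unit g1.
exists A', (g *m h); split.
- apply: regular_mxD => // i j; rewrite mxE; apply: regularM; first exact: regular_const.
  exact: regular_single.
- move=> k k0; rewrite eA' cfD cfZ Acf //.
  have [dE|d0] := eqVneq d 0; first by rewrite tau0 // oppr0 scale0r addr0.
  by rewrite cf_single ?scaler0 ?addr0 //; move: d0; rewrite /d; lia.
- rewrite eA' addrAC; apply: filD => //; apply: filZ.
  by apply: (fil_weak _ Es); rewrite /d; lia.
- exact: unip_mul.
have X'F := perturbed_conj (e0 A') Ft gu hu.
have dE : 1 - r%:Z + t.+1%:Z = d + 1 by rewrite /d; lia.
rewrite dE X'F -/X' -[d + 1]addr0; apply: filM; last by apply: fil_unip; apply: unip_inv.
apply: filD; last by rewrite addrC; apply: filM Z1 X'd.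
have ZF := filM Zd fF; have FZ := filM fF Zd.
rewrite addrK in ZF; rewrite addrC addrK in FZ.
apply: filS => [|i]; first by apply: filD => //; apply: filB.
have := dcM i Zd fF; have := dcM i fF Zd; rewrite addrK addrC addrK => e1 e2.
rewrite (dcD X' (Z *m Ft - Ft *m Z)) (dcB (Z *m Ft) (Ft *m Z)) e1 e2 !Zy !dc_formal_type !opprK.
have yE : y (sh i (- r%:Z)) = y i + (p`_r)^-1 * dc X' d i.
  by rewrite -yP addrC subrK.
rewrite yE; move: (dc X' d i) (y i) => a b; by field.
Qed.

Lemma framed_exists : exists A h, [/\ regular_mx_on_Gm A,
      forall k, 0 <= k -> cf (e0 A) k = if k == 0 then S else 0,
      fil (1 - r%:Z) (e0 A - Ft), fil 1 (h - 1%:M) &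
      fil 1 (h *m e0 A *m invmx h - Ft)].
Proof.
suff H t : (t <= r)%N -> exists A h, [/\ regular_mx_on_Gm A,
      forall k, 0 <= k -> cf (e0 A) k = if k == 0 then S else 0,
      fil (1 - r%:Z) (e0 A - Ft), fil 1 (h - 1%:M) &
      fil (1 - r%:Z + t%:Z) (h *m e0 A *m invmx h - Ft)].
  by have := H r (leqnn r); rewrite subrK.
elim: t => [|t IH] tr.
  have bF : fil (1 - r%:Z) (e0 base_mx - Ft).
    move=> d i dr; rewrite dcB dc_base dc_formal_type.
    have [->|dr'] := eqVneq d (- r%:Z); first by rewrite opprK subrr.
    rewrite mulr0n sub0r; case E: (- d) => [m|]; last by rewrite oppr0.
    by rewrite nth_default ?oppr0 // sp; move: dr'; lia.
  exists base_mx, 1%:M; split => //.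
  - exact: regular_base.
  - exact: cf_base.
  - by rewrite subrr; apply: fil0.
  by rewrite addr0 mul1mx invmx1 mulmx1.
have [A [h [Ar Acf AF h1 hA]]] := IH (ltnW tr).
by apply: (framed_step tr _ h1 hA); split.
Qed.

End Existence.

(** * The two directions of the equivalence *)

Section Main.
Variables (C : numClosedFieldType) (n r : nat) (p : {poly C}).
Local Notation ratfun := {fraction {poly C}}.
Local Notation laurent := {fraction (pseries C)}.
Local Notation rmat := 'M[ratfun]_n.+1.
Local Notation mat := 'M[laurent]_n.+1.
Local Notation e0 := (map_mx (@ex0 C)).
Local Notation eoo := (map_mx (@exoo C)).
Local Notation Ft := (formal_type n.+1 p).
Hypotheses (r_gt0 : (0 < r)%N) (rn : coprime r n.+1) (sp : size p = r.+1).

Lemma framed_rigidP (A : rmat) (h : mat) (N Y : 'M[C]_n.+1) (m : nat) :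
  regular_mx_on_Gm A -> fil (1 - r%:Z) (e0 A - Ft) -> fil 1 (h - 1%:M) ->
  fil 1 (h *m e0 A *m invmx h - Ft) -> ofil 0 (eoo A) -> cf (eoo A) 0 = - Y ->
  adjoint_orbit N Y -> N ^+ m = 0 ->
  rigid A <-> (r * n.+1 + 1 <= r + cdim N)%N.
Proof.
move=> Ar AF h1 hA Aoo A0 NY Nm.
have [fB dB] := framed_lead sp AF.
have pr0 : p`_r != 0.
  by have := lead_coef_eq0 p; rewrite lead_coefE sp -size_poly_eq0 sp => ->.
have Ym : Y ^+ m = 0.
  have [g /= gu <-] := NY.
  have E k : (g *m N *m invmx g) ^+ k = g *m N ^+ k *m invmx g.
    elim: k => [|k IH]; first by rewrite !expr0 mulmx1 mulmxV.
    by rewrite !exprS IH -[_ * _]/(_ *m _) -!mulmxA mulKmx // !mulmxA.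
  by rewrite E Nm mulmx0 mul0mx.
have nilp : cf (eoo A) 0 ^+ m = 0 by rewrite A0 exprNn Ym mulr0.
have u1 d : fil d (conj_Om h d) by have [] := @conj_Om_lead _ _ h d h1.
have u2 d i : dc (conj_Om h d) d i = 1 by have [] := @conj_Om_lead _ _ h d h1.
have u3 d := @conj_Om_comm _ _ p (e0 A) h d h1 hA.
have H := rigidP r_gt0 rn pr0 Ar fB dB u1 u2 u3 Aoo nilp.
by rewrite H A0 -[\dim _]/(cdim (- Y)) cdimN (cdim_orbit NY).
Qed.

Lemma rigid_framable_iff (p0 : p`_0 = 0) (O : set 'M[C]_n.+1) :
  is_nilpotent_orbit O -> at_most_jordan_blocks r O ->
  (exists A, framable_coxeter r Ft O A /\ rigid A) <->
  (O = min_orbit C n.+1 r /\ ((r %| n.+1 + 1)%N \/ (r %| n.+1 - 1)%N)).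
Proof.
move=> [N [[m Nm] ON]] [s [s1 sn Os] sr]; split=> [[A [[Ar frA resA] rA]]|[Omin rdiv]].
  have [g gu [_ BF [h hI hB]]] := frA.
  have {}BF : fil (1 - r%:Z) (e0 (change_triv g A) - Ft).
    by rewrite -ex0E; apply/iwahori_filtP.
  have h1 : fil 1 (h - 1%:M) by apply/iwahori_filtP.
  have {}hB : fil 1 (h *m e0 (change_triv g A) *m invmx h - Ft).
    by rewrite -ex0E; apply/iwahori_filtP.
  rewrite ON in resA; have [Y [NY Aoo A0]] := residue_change_triv gu resA.
  have A'r : regular_mx_on_Gm (change_triv g A) by apply: regular_conj.
  have /(framed_rigidP A'r BF h1 hB Aoo A0 NY Nm) := rigid_change_triv gu Ar rA.
  have JN : adjoint_orbit (jordan_nilp C n.+1 s) N.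
    by rewrite -Os ON; exists 1%:M; rewrite /= ?unitmx1 // invmx1 mul1mx mulmx1.
  rewrite (cdim_orbit JN) cdim_jordan // => /(sum_minn_bound r_gt0 (ltn0Sn n) rn sr s1 sn).
  move=> [sP rdiv]; split=> //; rewrite Os.
  exact: esym (adjoint_orbit_perm C (sumn_min_blocks n.+1 r_gt0) sP).
have pr0 : p`_r != 0.
  by have := lead_coef_eq0 p; rewrite lead_coefE sp -size_poly_eq0 sp => ->.
have [A [h [Ar Acf AF h1 hA]]] := framed_exists r_gt0 rn sp p0.
exists A.
have Aoo : ofil 0 (eoo A).
  by move=> k k0; rewrite cf_eoo // Acf ?oppr_ge0 ?ltW // oppr_eq0 lt_eqF.
(* The residue is taken with respect to dw/w = - dz/z, hence the sign. *)
pose S : 'M[C]_n.+1 := \matrix_(i, j) ((- p`_r) *+ (i == j + r :> nat)%N).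
have A0 : cf (eoo A) 0 = - S.
  rewrite cf_eoo // oppr0 Acf // eqxx; apply/matrixP => i j.
  by rewrite !mxE mulNrn opprK.
have OS : O = adjoint_orbit S by rewrite Omin -(@adjoint_orbit_shift C n r (- p`_r)) ?oppr_eq0.
have OSS : O S by rewrite OS; exists 1%:M; rewrite /= ?unitmx1 // invmx1 mul1mx mulmx1.
split; last first.
  have NS : adjoint_orbit N S by rewrite -ON.
  apply/(framed_rigidP Ar AF h1 hA Aoo A0 NS Nm); rewrite -(cdim_orbit NS).
  have -> : cdim S = cdim (jordan_nilp C n.+1 (min_blocks n.+1 r)).
    by apply: cdim_orbit; rewrite -[adjoint_orbit _]/(min_orbit C n.+1 r) -Omin.
  rewrite cdim_jordan; last exact: sumn_min_blocks.
  exact: sum_minn_min_blocks.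
split=> //.
  exists 1%:M; first exact: unitmx1.
  have -> : change_triv 1%:M A = A.
    by rewrite /change_triv invmx1 map_mx1 mul1mx mulmx1.
  rewrite ex0E; split.
  - by apply/iwahori_filtP; have [] := framed_lead sp AF.
  - exact/iwahori_filtP.
  by exists h; apply/iwahori_filtP.
exists (\matrix_(i, j) PSeries (fun k => lc ((- eoo A) i j) k%:Z)); rewrite ?exooE.
  apply/matrixP => i j; rewrite [RHS]mxE [X in FracField.tofrac X]mxE.
  apply: lc_tofracK => k k0; have E : cf (eoo A) k i j = 0 by rewrite Aoo // mxE.
  by rewrite mxE in E; rewrite mxE lcN E oppr0.
have -> // : map_mx (fun f => pscoef f 0)
  (\matrix_(i, j) PSeries (fun k => lc ((- eoo A) i j) k%:Z)) = S.
apply/matrixP => i j; rewrite mxE [X in pscoef X]mxE /=.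
have -> : lc ((- eoo A) i j) 0 = - cf (eoo A) 0 i j by rewrite !mxE lcN.
by rewrite A0 [X in - X]mxE opprK.
Qed.

End Main.

Local Open Scope complex_scope.
Local Open Scope classical_set_scope.

Theorem theorem4p16 (R : realType) (n r : nat)
    (n_ge1 : (1 <= n)%N) (r_ge1 : (1 <= r)%N) (rn_coprime : coprime r n)
    (p : {poly R[i]}) (p_deg : size p = r.+1) (p_0 : p`_0 = 0)
    (O : set 'M[R[i]]_n) (O_nilp : is_nilpotent_orbit O)
    (O_blocks : at_most_jordan_blocks r O) :
  (exists A : 'M[{fraction {poly R[i]}}]_n,
     framable_coxeter r (formal_type n p) O A /\ rigid A)
  <->
  (O = min_orbit R[i] n r /\ ((r %| n + 1)%N \/ (r %| n - 1)%N)).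
Proof.
case: n n_ge1 rn_coprime O O_nilp O_blocks => // n _ rn O O_nilp O_blocks.
exact: (@rigid_framable_iff R[i] n r p r_ge1 rn p_deg p_0 O O_nilp O_blocks).
Qed.
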